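(* Let $\mathcal S$ be non-singular and $z\in(0,1/k)$. The functions $x\mapsto c(x;z)Q(x,0;z)$ and $y\mapsto\widetilde c(y;z)Q(0,y;z)$, holomorphic on the open unit disc $\mathscr D$, can be holomorphically continued to $\mathscr G X([y_1,y_2])\cup\mathscr D$ and to $\mathscr G Y([x_1,x_2])\cup\mathscr D$, respectively.
   Context: Step set $\mathcal S\subset\{-1,0,1\}^2\setminus\{(0,0)\}$, $k=|\mathcal S|$; $Q(x,y;z)=\sum q(i,j;n)x^iy^jz^n$ counts walks with steps in $\mathcal S$ from $(0,0)$ confined to $\mathbb Z_+^2$ ($q(i,j;n)$ = number of length-$n$ such walks ending at $(i,j)$). $c(x;z)=zx\sum_{(i,-1)\in\mathcal S}x^i$, $\widetilde c(y;z)=zy\sum_{(-1,j)\in\mathcal S}y^j$; kernel $K(x,y;z)=xyz[\sum_{(i,j)\in\mathcal S}x^iy^j-1/z]=a(x)y^2+b(x)y+c(x)=\widetilde a(y)x^2+\widetilde b(y)x+\widetilde c(y)$ with $a(x)=zx\sum_{(i,1)\in\mathcal S}x^i$, $b(x)=-1+zx\sum_{(i,0)\in\mathcal S}x^i$, $\widetilde a(y)=zy\sum_{(1,j)\in\mathcal S}y^j$, $\widetilde b(y)=-1+zy\sum_{(0,j)\in\mathcal S}y^j$; $d=b^2-4ac$, $\widetilde d=\widetilde b^2-4\widetilde a\widetilde c$. Singular step sets: up to exchanging coordinates, $\{(-1,1),(1,-1)\}\cup T$ with $T$ one of $\{(1,1)\},\{(0,1)\},\{(0,1),(1,1)\},\{(0,1),(1,0)\},\{(0,1),(1,1),(1,0)\}$.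 Non-singular: one of the 79 inequivalent quadrant models of Bousquet-Mélou–Mishna other than these five; then for $z\in(0,1/k)$, $d$ has roots $x_1,\dots,x_4$ with $|x_1|<x_2<1<x_3<|x_4|$ ($x_4=\infty$ if $\deg d=3$) and $\widetilde d$ has roots $y_1,\dots,y_4$ with $|y_1|<y_2<1<y_3<|y_4|$. Branches $X_0,X_1$ of the $x$-roots of $K$, $X_{0,1}=(-\widetilde b\pm\widetilde d^{1/2})/(2\widetilde a)$, labeled with $|X_0|\le|X_1|$; similarly $Y_0,Y_1$ with $|Y_0|\le|Y_1|$. $X([y_1,y_2])=\{X_0(y),X_1(y):y\in[y_1,y_2]\}$ is a closed curve symmetric w.r.t. $\mathbb R$; $\mathscr G X([y_1,y_2])$ is the component of its complement containing $x_1$; likewise $\mathscr G Y([x_1,x_2])$ contains $y_1$.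
   Formalization: The stated b(x) = −1 + zxΣx^i and b̃(y) = −1 + zyΣy^j contradict K = ay²+by+c; the formal statement uses the actual coefficients −x + zxΣx^i and −y + zyΣy^j in d and d̃. *)

(* Defs.v *)
From Stdlib Require Import Reals Lra Lia ZArith List.
Import ListNotations.
Open Scope R_scope.

Definition Cplx : Type := (R * R)%type.
Definition RtoC (r : R) : Cplx := (r, 0).
Definition C0 : Cplx := (0, 0).
Definition C1 : Cplx := (1, 0).
Definition Cadd (u v : Cplx) : Cplx := (fst u + fst v, snd u + snd v).
Definition Copp (u : Cplx) : Cplx := (- fst u, - snd u).
Definition Csub (u v : Cplx) : Cplx := Cadd u (Copp v).
Definition Cmul (u v : Cplx) : Cplx :=
  (fst u * fst v - snd u * snd v, fst u * snd v + snd u * fst v).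
Fixpoint Cpow (u : Cplx) (n : nat) : Cplx :=
  match n with O => C1 | S m => Cmul u (Cpow u m) end.
Definition Cnorm (u : Cplx) : R := sqrt (fst u ^ 2 + snd u ^ 2).

Definition Copen (U : Cplx -> Prop) : Prop :=
  forall x, U x -> exists r, 0 < r /\ forall w, Cnorm (Csub w x) < r -> U w.
Definition Cconnected (T : Cplx -> Prop) : Prop :=
  forall U V : Cplx -> Prop, Copen U -> Copen V ->
    (forall w, T w -> U w \/ V w) ->
    (forall w, T w -> U w -> V w -> False) ->
    (exists w, T w /\ U w) -> (exists w, T w /\ V w) -> False.
Definition component (A : Cplx -> Prop) (p : Cplx) : Cplx -> Prop :=
  fun w => exists T : Cplx -> Prop,
    (forall v, T v -> A v) /\ Cconnected T /\ T p /\ T w.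
Definition holomorphic_on (U : Cplx -> Prop) (F : Cplx -> Cplx) : Prop :=
  forall x, U x -> exists f' : Cplx, forall eps, 0 < eps -> exists delta, 0 < delta /\
    forall h, Cnorm h < delta ->
      Cnorm (Csub (Csub (F (Cadd x h)) (F x)) (Cmul f' h)) <= eps * Cnorm h.
Fixpoint Cpartial (u : nat -> Cplx) (n : nat) : Cplx :=
  match n with O => u O | S m => Cadd (Cpartial u m) (u (S m)) end.
Definition Cseries_cv (u : nat -> Cplx) (L : Cplx) : Prop :=
  forall eps, 0 < eps -> exists N, forall n, (N <= n)%nat -> Cnorm (Csub (Cpartial u n) L) < eps.
Definition unit_disc (x : Cplx) : Prop := Cnorm x < 1.

Definition step := (Z * Z)%type.
Definition small_step (s : step) : Prop :=
  (-1 <= fst s <= 1)%Z /\ (-1 <= snd s <= 1)%Z /\ s <> (0%Z, 0%Z).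
Definition valid_stepset (S : list step) : Prop :=
  NoDup S /\ forall s, In s S -> small_step s.
Definition same_set (S T : list step) : Prop := forall s, In s S <-> In s T.
Definition swap_steps (S : list step) : list step := map (fun s => (snd s, fst s)) S.

(* The 138 step sets (79 up to the symmetry x<->y) of Bousquet-Melou--Mishna:
   steps in all four directions, not a hidden half-plane problem (x>=y or x<=y forced),
   and walks can leave the origin. *)
Definition BMM_model (S : list step) : Prop :=
  (exists s, In s S /\ fst s = (-1)%Z) /\ (exists s, In s S /\ fst s = 1%Z) /\
  (exists s, In s S /\ snd s = (-1)%Z) /\ (exists s, In s S /\ snd s = 1%Z) /\
  ~ (forall s, In s S -> (snd s <= fst s)%Z) /\
  ~ (forall s, In s S -> (fst s <= snd s)%Z) /\
  (exists s, In s S /\ (s = (1,0)%Z \/ s = (0,1)%Z \/ s = (1,1)%Z)).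

Definition singular_T : list (list step) :=
  [ [(1,1)%Z]; [(0,1)%Z]; [(0,1)%Z; (1,1)%Z]; [(0,1)%Z; (1,0)%Z];
    [(0,1)%Z; (1,1)%Z; (1,0)%Z] ].
Definition singular (S : list step) : Prop :=
  exists T, In T singular_T /\
    (same_set S ([(-1,1)%Z; (1,-1)%Z] ++ T) \/
     same_set (swap_steps S) ([(-1,1)%Z; (1,-1)%Z] ++ T)).
Definition nonsingular (S : list step) : Prop :=
  valid_stepset S /\ BMM_model S /\ ~ singular S.

Fixpoint words (S : list step) (n : nat) : list (list step) :=
  match n with
  | O => [ [] ]
  | Datatypes.S m => flat_map (fun w => map (fun s => s :: w) S) (words S m)
  end.
Definition addp (p s : step) : step := ((fst p + fst s)%Z, (snd p + snd s)%Z).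
Fixpoint stays (p : step) (w : list step) : bool :=
  match w with
  | [] => true
  | s :: w' => let p' := addp p s in
      (Z.leb 0 (fst p') && Z.leb 0 (snd p') && stays p' w')%bool
  end.
Fixpoint endpoint (p : step) (w : list step) : step :=
  match w with [] => p | s :: w' => endpoint (addp p s) w' end.
Definition q (S : list step) (i j : Z) (n : nat) : nat :=
  length (filter (fun w => (stays (0,0)%Z w &&
                            Z.eqb (fst (endpoint (0,0)%Z w)) i &&
                            Z.eqb (snd (endpoint (0,0)%Z w)) j)%bool) (words S n)).

Fixpoint Csum (f : nat -> Cplx) (n : nat) : Cplx :=
  match n with O => f O | Datatypes.S m => Cadd (Csum f m) (f (Datatypes.S m)) end.

(* n-th term (in z) of Q(x,0;z) = sum_{n} z^n sum_{i=0}^{n} q(i,0;n) x^i  (q(i,0;n)=0 for i>n) *)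
Definition Qx0_term (S : list step) (z : R) (x : Cplx) (n : nat) : Cplx :=
  Cmul (RtoC (z ^ n)) (Csum (fun i => Cmul (RtoC (INR (q S (Z.of_nat i) 0 n))) (Cpow x i)) n).
Definition Q0y_term (S : list step) (z : R) (y : Cplx) (n : nat) : Cplx :=
  Cmul (RtoC (z ^ n)) (Csum (fun j => Cmul (RtoC (INR (q S 0 (Z.of_nat j) n))) (Cpow y j)) n).

Definition sumS (S : list step) (P : step -> bool) (f : step -> Cplx) : Cplx :=
  fold_right (fun s acc => if P s then Cadd (f s) acc else acc) C0 S.
Definition e1 (k : Z) : nat := Z.to_nat (k + 1).

(* K(x,y;z) = xyz [ sum_{(i,j) in S} x^i y^j - 1/z ] *)
Definition K (S : list step) (z : R) (x y : Cplx) : Cplx :=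
  Csub (Cmul (RtoC z) (sumS S (fun _ => true)
          (fun s => Cmul (Cpow x (e1 (fst s))) (Cpow y (e1 (snd s))))))
       (Cmul x y).
(* coefficients of K in y: K = a y^2 + b y + c *)
Definition a_ (S : list step) (z : R) (x : Cplx) : Cplx :=
  Cmul (RtoC z) (sumS S (fun s => Z.eqb (snd s) 1) (fun s => Cpow x (e1 (fst s)))).
Definition b_ (S : list step) (z : R) (x : Cplx) : Cplx :=
  Csub (Cmul (RtoC z) (sumS S (fun s => Z.eqb (snd s) 0) (fun s => Cpow x (e1 (fst s))))) x.
Definition c_ (S : list step) (z : R) (x : Cplx) : Cplx :=
  Cmul (RtoC z) (sumS S (fun s => Z.eqb (snd s) (-1)) (fun s => Cpow x (e1 (fst s)))).
(* coefficients of K in x: K = at x^2 + bt x + ct *)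
Definition at_ (S : list step) (z : R) (y : Cplx) : Cplx :=
  Cmul (RtoC z) (sumS S (fun s => Z.eqb (fst s) 1) (fun s => Cpow y (e1 (snd s)))).
Definition bt_ (S : list step) (z : R) (y : Cplx) : Cplx :=
  Csub (Cmul (RtoC z) (sumS S (fun s => Z.eqb (fst s) 0) (fun s => Cpow y (e1 (snd s))))) y.
Definition ct_ (S : list step) (z : R) (y : Cplx) : Cplx :=
  Cmul (RtoC z) (sumS S (fun s => Z.eqb (fst s) (-1)) (fun s => Cpow y (e1 (snd s)))).
Definition d_ (S : list step) (z : R) (x : Cplx) : Cplx :=
  Csub (Cmul (b_ S z x) (b_ S z x)) (Cmul (RtoC 4) (Cmul (a_ S z x) (c_ S z x))).
Definition dt_ (S : list step) (z : R) (y : Cplx) : Cplx :=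
  Csub (Cmul (bt_ S z y) (bt_ S z y)) (Cmul (RtoC 4) (Cmul (at_ S z y) (ct_ S z y))).

(* r1 < r2 are the two smallest branch points of the polynomial p (of degree 4 or 3):
   p has roots r1,r2,r3,r4 with |r1| < r2 < 1 < r3 < |r4|  (r4 = infinity iff deg p = 3) *)
Definition branch_points (p : Cplx -> Cplx) (r1 r2 : R) : Prop :=
  exists (r3 r4 lc : R), lc <> 0 /\ Rabs r1 < r2 /\ r2 < 1 /\ 1 < r3 /\
   ((r3 < Rabs r4 /\ forall X, p X = Cmul (RtoC lc)
        (Cmul (Csub X (RtoC r1)) (Cmul (Csub X (RtoC r2))
           (Cmul (Csub X (RtoC r3)) (Csub X (RtoC r4))))))
    \/ (forall X, p X = Cmul (RtoC lc)
        (Cmul (Csub X (RtoC r1)) (Cmul (Csub X (RtoC r2)) (Csub X (RtoC r3)))))).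

(* X([y1,y2]) = { X_0(y), X_1(y) : y in [y1,y2] } = finite x-roots of K(.,y), y in [y1,y2] *)
Definition curveX (S : list step) (z y1 y2 : R) (x : Cplx) : Prop :=
  exists y : R, y1 <= y <= y2 /\ K S z x (RtoC y) = C0.
Definition curveY (S : list step) (z x1 x2 : R) (y : Cplx) : Prop :=
  exists x : R, x1 <= x <= x2 /\ K S z (RtoC x) y = C0.
Definition GX (S : list step) (z x1 y1 y2 : R) : Cplx -> Prop :=
  component (fun x => ~ curveX S z y1 y2 x) (RtoC x1).
Definition GY (S : list step) (z y1 x1 x2 : R) : Cplx -> Prop :=
  component (fun y => ~ curveY S z x1 x2 y) (RtoC y1).

(* Main.v *)
(** The two roots [X_0 y], [X_1 y] of the kernel are separated, for [y] in the unit disc off the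
    slit [[y1, y2]], by an explicit holomorphic square root of the discriminant; on [|y| = 1] they
    satisfy [|X_0 y| < 1 < |X_1 y|], because the middle coefficient of the kernel dominates there.
    Hence, as long as [x] avoids the curve [X([y1, y2])], the property "x = X_1 y for some y in the
    disc" cannot change inside [|x| <= 1], and "x = X_0 y for exactly one y in the disc" cannot
    change inside [|x| >= 1]; the two fit together on the unit circle.  At [x1] the first property
    fails: along the segment [[x1, x2]] this reduces to [x2], where it follows from the convexity of
    [(u, v) |-> sum_s e^(i u + j v)].  So every [x] of the component of [x1] with [|x| >= 1] has a
    unique [y] in the disc with [x = X_0 y], and [x y + const - ct(y) Q(0, y)] continues
    [c(x) Q(x, 0)], by the functional equation on the zero set of the kernel. *)

(* The component of [x1] is given only through connected sets, so the one available tool is that a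
   property locally constant off the curve spreads from [x1] to the whole component; the work lies
   in finding such a property and checking it at one point. A root y can leave the open disc only
   through |y| = 1, and it can change branch only at the slit. Off the curve the slit is never met,
   and on |y| = 1 a root on X_1 forces |x| > 1 and a root on X_0 forces |x| < 1; this is why each
   branch is followed on its own side of the unit circle. The dominance of the middle coefficient is
   where z < 1/k enters: the step weights have sum less than 1, while K carries the term -xy and
   there is no step (0, 0). As K is quadratic in each variable, roots are counted by sums and
   products of roots instead of contour integrals. Everything about the kernel is proved for eight
   nonnegative weights, so that the statement for Q(0, y) follows by permuting them. *)
From Stdlib Require Import Reals Lra Lia ZArith List Classical ClassicalEpsilon.
Require Import Defs.
From Coquelicot Require Import Coquelicot.
Import ListNotations.
Open Scope C_scope.

(** * Limits and roots of quadratics *)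

(* [ev m P]: [P a] holds as soon as the gauge [m a] (a distance to the limit point) is small. *)
Definition ev {A : Type} (m : A -> R) (P : A -> Prop) : Prop :=
  exists r : R, (0 < r)%R /\ forall a, (m a < r)%R -> P a.
Definition lim {A : Type} (m : A -> R) (f : A -> C) (l : C) : Prop :=
  forall eps : R, (0 < eps)%R -> ev m (fun a => (Cmod (f a - l) < eps)%R).
Definition dist (x w : C) : R := Cmod (w - x).
Definition cont (f : C -> C) (x : C) : Prop := lim (dist x) f (f x).

Lemma ev_and {A : Type} (m : A -> R) (P Q : A -> Prop) :
  ev m P -> ev m Q -> ev m (fun a => P a /\ Q a).
Proof.
  intros [r [Hr HP]] [s [Hs HQ]]. exists (Rmin r s). split; [now apply Rmin_pos|].
  intros a Ha. split; [apply HP|apply HQ]; eapply Rlt_le_trans; eauto using Rmin_l, Rmin_r.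
Qed.

Lemma ev_imp {A : Type} (m : A -> R) (P Q : A -> Prop) :
  ev m P -> (forall a, P a -> Q a) -> ev m Q.
Proof. intros [r [Hr HP]] H. exists r. split; auto. Qed.

Lemma lim_const {A : Type} (m : A -> R) (c : C) : lim m (fun _ => c) c.
Proof.
  intros e He. exists 1. split; [lra|]. intros _ _.
  replace (c - c) with (RtoC 0) by ring. now rewrite Cmod_0.
Qed.

Lemma lim_plus {A : Type} (m : A -> R) f g (l k : C) :
  lim m f l -> lim m g k -> lim m (fun a => f a + g a) (l + k).
Proof.
  intros Hf Hg e He.
  apply ev_imp with (1 := ev_and m _ _ (Hf (e/2)%R ltac:(lra)) (Hg (e/2)%R ltac:(lra))).
  intros a [H1 H2]. replace (f a + g a - (l + k)) with ((f a - l) + (g a - k)) by ring.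
  pose proof (Cmod_triangle (f a - l) (g a - k)). lra.
Qed.

Lemma lim_mult {A : Type} (m : A -> R) f g (l k : C) :
  lim m f l -> lim m g k -> lim m (fun a => f a * g a) (l * k).
Proof.
  intros Hf Hg e He.
  pose proof (Cmod_ge_0 l) as Hl. pose proof (Cmod_ge_0 k) as Hk.
  set (M := (1 + Cmod l + Cmod k)%R).
  assert (HM : (0 < M)%R) by (unfold M; lra).
  set (n := Rmin 1 (e / M)).
  assert (Hn : (0 < n)%R).
  { apply Rmin_pos; [lra|]. apply Rdiv_lt_0_compat; lra. }
  assert (Hn1 : (n <= 1)%R) by apply Rmin_l.
  assert (HnM : (n * M <= e)%R).
  { apply Rle_trans with (e / M * M)%R.
    - apply Rmult_le_compat_r; [lra|apply Rmin_r].
    - right. field. lra. }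
  apply ev_imp with (1 := ev_and m _ _ (Hf n Hn) (Hg n Hn)).
  intros a [H1 H2].
  replace (f a * g a - l * k) with ((f a - l) * (g a - k) + ((f a - l) * k + l * (g a - k))) by ring.
  pose proof (Cmod_triangle ((f a - l) * (g a - k)) ((f a - l) * k + l * (g a - k))) as T1.
  pose proof (Cmod_triangle ((f a - l) * k) (l * (g a - k))) as T2.
  rewrite !Cmod_mult in *.
  pose proof (Cmod_ge_0 (f a - l)). pose proof (Cmod_ge_0 (g a - k)).
  unfold M in *. nra.
Qed.

Lemma lim_opp {A : Type} (m : A -> R) f (l : C) : lim m f l -> lim m (fun a => - f a) (- l).
Proof.
  intros Hf e He. apply ev_imp with (1 := Hf e He). intros a Ha.
  replace (- f a - - l) with (- (f a - l)) by ring. now rewrite Cmod_opp.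
Qed.

Lemma lim_minus {A : Type} (m : A -> R) f g (l k : C) :
  lim m f l -> lim m g k -> lim m (fun a => f a - g a) (l - k).
Proof. intros Hf Hg. apply lim_plus; [easy|now apply lim_opp]. Qed.

Lemma lim_comp {A : Type} (m : A -> R) f g (l : C) :
  lim m g l -> cont f l -> lim m (fun a => f (g a)) (f l).
Proof. intros Hg Hf e He. destruct (Hf e He) as [r [Hr Hr']]. eauto using ev_imp. Qed.

Lemma Cminus_neq_0 (x y : C) : x <> y -> x - y <> 0.
Proof. intros H E. apply H. replace x with ((x - y) + y) by ring. rewrite E. ring. Qed.

Lemma lim_neq {A : Type} (m : A -> R) f (l k : C) :
  lim m f l -> l <> k -> ev m (fun a => f a <> k).
Proof.
  intros Hf Hl. pose proof (proj1 (Cmod_gt_0 _) (Cminus_neq_0 l k Hl)) as Hp.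
  apply ev_imp with (1 := Hf _ Hp). intros a Ha E. rewrite E in Ha.
  rewrite <- (Cmod_opp (k - l)) in Ha. replace (- (k - l)) with (l - k) in Ha by ring. lra.
Qed.

Lemma Cmod_diff (x y : C) : (Rabs (Cmod x - Cmod y) <= Cmod (x - y))%R.
Proof.
  pose proof (Cmod_triangle (x - y) y) as H. pose proof (Cmod_triangle (- (x - y)) x) as H'.
  replace (- (x - y) + x) with y in H' by ring. replace (x - y + y) with x in H by ring.
  rewrite Cmod_opp in H'.
  apply Rabs_le. lra.
Qed.

Lemma lim_Cmod_lt {A : Type} (m : A -> R) f (l : C) (b : R) :
  lim m f l -> (Cmod l < b)%R -> ev m (fun a => (Cmod (f a) < b)%R).
Proof.
  intros Hf Hl. apply ev_imp with (1 := Hf (b - Cmod l)%R ltac:(lra)). intros a Ha.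
  pose proof (Cmod_diff (f a) l) as H. apply Rabs_le_between in H. lra.
Qed.

Lemma lim_Cmod_gt {A : Type} (m : A -> R) f (l : C) (b : R) :
  lim m f l -> (b < Cmod l)%R -> ev m (fun a => (b < Cmod (f a))%R).
Proof.
  intros Hf Hl. apply ev_imp with (1 := Hf (Cmod l - b)%R ltac:(lra)). intros a Ha.
  pose proof (Cmod_diff (f a) l) as H. apply Rabs_le_between in H. lra.
Qed.

Lemma lim_Re_gt {A : Type} (m : A -> R) f (l : C) (b : R) :
  lim m f l -> (b < Re l)%R -> ev m (fun a => (b < Re (f a))%R).
Proof.
  intros Hf Hl. apply ev_imp with (1 := Hf (Re l - b)%R ltac:(lra)). intros a Ha.
  pose proof (re_le_Cmod (f a - l)) as H.
  change (Re (f a - l)) with (Re (f a) + - Re l)%R in H. apply Rabs_le_between in H. lra.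
Qed.

Lemma lim_inv {A : Type} (m : A -> R) f (l : C) :
  lim m f l -> l <> 0 -> lim m (fun a => / f a) (/ l).
Proof.
  intros Hf Hl e He. pose proof (proj1 (Cmod_gt_0 l) Hl) as Hm.
  assert (Hd : (0 < e * (Cmod l * Cmod l / 2))%R) by (apply Rmult_lt_0_compat; nra).
  apply ev_imp with (1 := ev_and m _ _ (Hf _ Hd) (lim_Cmod_gt m f l (Cmod l / 2) Hf ltac:(lra))).
  intros a [H1 H2].
  assert (Hfa : f a <> 0) by (intros E; rewrite E, Cmod_0 in H2; lra).
  replace (/ f a - / l) with (- ((f a - l) / (f a * l))) by (field; auto).
  rewrite Cmod_opp, Cmod_div, Cmod_mult by (now apply Cmult_neq_0).
  apply Rlt_div_l; [nra|]. eapply Rlt_le_trans; [exact H1|].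
  apply Rmult_le_compat_l; nra.
Qed.

Lemma cont_id (x : C) : cont (fun w => w) x.
Proof. intros e He. exists e. split; [easy|]. now intros a Ha. Qed.

Ltac limtac := repeat first [ apply lim_const | assumption | apply lim_minus | apply lim_plus
  | apply lim_mult | apply lim_opp | apply cont_id ].

(** * The principal square root *)

Lemma Cmod_sqr (w : C) : (Cmod w * Cmod w = Re w * Re w + Im w * Im w)%R.
Proof. pose proof (Cmod2_alt w). nra. Qed.

(** The half-angle formula. The condition [0 < Cmod w + Re w] used below says that [w] lies off the
    closed negative real axis, where [r] vanishes and the quotient is meaningless. *)
Definition csqrt (w : C) : C :=
  let r := sqrt ((Cmod w + Re w) / 2) in (r, (Im w / (2 * r))%R).

Lemma csqrt_sqr (w : C) : (0 < Cmod w + Re w)%R -> csqrt w * csqrt w = w.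
Proof.
  intros H. unfold csqrt. set (r := sqrt _).
  assert (Hr : (0 < r)%R) by (apply sqrt_lt_R0; lra).
  assert (Hrr : (r * r = (Cmod w + Re w) / 2)%R) by (apply sqrt_sqrt; lra).
  pose proof (Cmod_sqr w) as Hm.
  apply injective_projections; simpl.
  - fold (Re w).
    assert (E : (Im w / (2 * r) * (Im w / (2 * r)) = (Cmod w - Re w) / 2)%R).
    { replace (Im w / (2 * r) * (Im w / (2 * r)))%R with (Im w * Im w / (4 * (r * r)))%R by (field; lra).
      rewrite Hrr. replace (Im w * Im w)%R with ((Cmod w - Re w) * (Cmod w + Re w))%R by lra.
      field. lra. }
    rewrite E, Hrr. lra.
  - fold (Im w). field. lra.
Qed.

Lemma Re_csqrt (w : C) : (0 < Cmod w + Re w)%R -> (0 < Re (csqrt w))%R.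
Proof. intros H. apply sqrt_lt_R0. lra. Qed.

Lemma csqrt_real (t : R) : (0 < t)%R -> csqrt (RtoC t) = RtoC (sqrt t).
Proof.
  intros H. unfold csqrt. rewrite Cmod_R, Rabs_right by lra. simpl.
  replace ((t + t) / 2)%R with t by lra. unfold RtoC. f_equal. unfold Rdiv. ring.
Qed.

Lemma Re_pos_slit (w : C) : (0 < Re w)%R -> (0 < Cmod w + Re w)%R.
Proof. pose proof (Cmod_ge_0 w). lra. Qed.

(** The difference of the two roots times their sum is v - w, and the sum has modulus at least
    [Re (csqrt w)] because both real parts are positive. The first radius keeps [v] off the negative
    axis, the second gives the estimate. *)
Lemma csqrt_cont (w : C) : (0 < Cmod w + Re w)%R -> cont csqrt w.
Proof.
  intros H e He. pose proof (Re_csqrt w H) as Hs.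
  exists (Rmin ((Cmod w + Re w) / 2) (e * Re (csqrt w))). split.
  { apply Rmin_pos; [lra|]. now apply Rmult_lt_0_compat. }
  intros v Hv. unfold dist in Hv.
  assert (H1 : (Cmod (v - w) < (Cmod w + Re w) / 2)%R) by (eapply Rlt_le_trans; [exact Hv|apply Rmin_l]).
  assert (H2 : (Cmod (v - w) < e * Re (csqrt w))%R) by (eapply Rlt_le_trans; [exact Hv|apply Rmin_r]).
  assert (H3 : (0 < Cmod v + Re v)%R).
  { pose proof (Cmod_diff v w) as D. apply Rabs_le_between in D.
    pose proof (re_le_Cmod (v - w)) as D'. change (Re (v - w)) with (Re v + - Re w)%R in D'.
    apply Rabs_le_between in D'. lra. }
  pose proof (csqrt_sqr w H) as E. pose proof (csqrt_sqr v H3) as E'. pose proof (Re_csqrt v H3) as Hs'.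
  assert (P : (Cmod (csqrt v - csqrt w) * Cmod (csqrt v + csqrt w) = Cmod (v - w))%R).
  { rewrite <- Cmod_mult. f_equal.
    transitivity (csqrt v * csqrt v - csqrt w * csqrt w); [ring|now rewrite E, E']. }
  assert (Q : (Re (csqrt w) <= Cmod (csqrt v + csqrt w))%R).
  { pose proof (re_le_Cmod (csqrt v + csqrt w)) as D.
    change (Re (csqrt v + csqrt w)) with (Re (csqrt v) + Re (csqrt w))%R in D.
    apply Rabs_le_between in D. lra. }
  pose proof (Cmod_ge_0 (csqrt v - csqrt w)). nra.
Qed.

Lemma sqrt_exists (w : C) : exists s, s * s = w.
Proof.
  destruct (Rlt_dec 0 (Cmod w + Re w)) as [H|H].
  - exists (csqrt w). now apply csqrt_sqr.
  - exists (0, sqrt (- Re w))%R.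
    pose proof (re_le_Cmod w) as D. apply Rabs_le_between in D.
    pose proof (Cmod_sqr w) as E. pose proof (Cmod_ge_0 w).
    assert (Cmod w = - Re w)%R as E2 by lra. rewrite E2 in E.
    assert (E3 : (Im w * Im w = 0)%R) by nra.
    assert (E4 : Im w = 0%R) by (destruct (Rmult_integral _ _ E3); easy).
    apply injective_projections; simpl.
    + fold (Re w). rewrite Rmult_0_l. rewrite sqrt_sqrt; lra.
    + fold (Im w). rewrite E4. ring.
Qed.

Lemma quadratic_factor (a b c : C) : a <> 0 ->
  exists r r', forall y, a * y * y + b * y + c = a * (y - r) * (y - r').
Proof.
  intros Ha. destruct (sqrt_exists (b * b - 4 * a * c)) as [s Hs].
  exists ((- b + s) / (2 * a)), ((- b - s) / (2 * a)). intros y.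
  assert (Hc : c = (b * b - s * s) / (4 * a)) by (rewrite Hs; field; auto).
  rewrite Hc. field. auto.
Qed.

(** The leading coefficient may tend to 0, so no formula for the root is available. After the
    translation y = y0 + t the constant term tends to 0. If the translated linear coefficient tends
    to 0 too, the product of the two roots t is small, hence one of them is. Otherwise the sum of
    the reciprocals 1/t is large, hence one of them is. *)
Lemma root_persists {A : Type} (m : A -> R) (a b c : A -> C) (al be ga y0 : C) :
  lim m a al -> lim m b be -> lim m c ga ->
  al * y0 * y0 + be * y0 + ga = 0 -> (al <> 0 \/ be <> 0) ->
  forall eps, (0 < eps)%R -> ev m (fun x => exists y,
     a x * y * y + b x * y + c x = 0 /\ (Cmod (y - y0) < eps)%R).
Proof.
  intros La Lb Lc H0 Hnz eps He.
  set (b' := fun x => 2 * a x * y0 + b x). set (c' := fun x => a x * y0 * y0 + b x * y0 + c x).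
  assert (Lb' : lim m b' (2 * al * y0 + be)) by (unfold b'; limtac).
  assert (Lc' : lim m c' 0) by (rewrite <- H0; unfold c'; limtac).
  destruct (classic (2 * al * y0 + be = 0)) as [Z|Z].
  - assert (Ha : al <> 0).
    { intros E. destruct Hnz as [F|F]; [easy|]. apply F. rewrite E in Z. rewrite <- Z. ring. }
    pose proof (proj1 (Cmod_gt_0 al) Ha) as Hm.
    assert (Hd : (0 < eps * eps * (Cmod al / 2))%R) by (apply Rmult_lt_0_compat; nra).
    apply ev_imp with (1 := ev_and m _ _ (Lc' _ Hd) (lim_Cmod_gt m a al (Cmod al / 2) La ltac:(lra))).
    intros x [H1 H2]. replace (c' x - 0) with (c' x) in H1 by ring.
    assert (Hax : a x <> 0) by (intros E; rewrite E, Cmod_0 in H2; lra).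
    destruct (quadratic_factor (a x) (b' x) (c' x) Hax) as [r [r' Hr]].
    assert (Hc : (Cmod (c' x) = Cmod (a x) * (Cmod r * Cmod r'))%R).
    { rewrite <- !Cmod_mult. f_equal. specialize (Hr 0).
      replace (c' x) with (a x * 0 * 0 + b' x * 0 + c' x) by ring. rewrite Hr. ring. }
    assert (K : forall t, a x * t * t + b' x * t + c' x = 0 ->
       a x * (y0 + t) * (y0 + t) + b x * (y0 + t) + c x = 0).
    { intros t Ht. rewrite <- Ht. unfold b', c'. ring. }
    destruct (Rlt_dec (Cmod r) eps) as [L|L]; [|destruct (Rlt_dec (Cmod r') eps) as [L'|L']].
    + exists (y0 + r). split; [apply K; rewrite Hr; ring|]. now replace (y0 + r - y0) with r by ring.
    + exists (y0 + r'). split; [apply K; rewrite Hr; ring|]. now replace (y0 + r' - y0) with r' by ring.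
    + exfalso. assert (eps * eps <= Cmod r * Cmod r')%R by nra. nra.
  - pose proof (proj1 (Cmod_gt_0 _) Z) as Hm. set (B := Cmod (2 * al * y0 + be)) in *.
    assert (Hd : (0 < eps * (B / 4))%R) by (apply Rmult_lt_0_compat; lra).
    apply ev_imp with (1 := ev_and m _ _ (Lc' _ Hd) (lim_Cmod_gt m b' _ (B / 2) Lb' ltac:(fold B; lra))).
    intros x [H1 H2]. replace (c' x - 0) with (c' x) in H1 by ring.
    destruct (classic (c' x = 0)) as [Zc|Zc].
    { exists y0. split; [exact Zc|]. replace (y0 - y0) with (RtoC 0) by ring. now rewrite Cmod_0. }
    (* The reversed quadratic, whose nonzero roots are the values 1/t, keeps degree two even where
       [a x] vanishes. *)
    destruct (quadratic_factor (c' x) (b' x) (a x) Zc) as [r [r' Hr]].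
    pose proof (proj1 (Cmod_gt_0 _) Zc) as Hcp.
    assert (Hb : b' x = - c' x * (r + r')).
    { pose proof (Hr 1) as E1. pose proof (Hr (- (1))) as E2.
      replace (b' x) with (((c' x * 1 * 1 + b' x * 1 + a x) -
        (c' x * - (1) * - (1) + b' x * - (1) + a x)) / 2) by field.
      rewrite E1, E2. field. }
    assert (Hbm : (Cmod (b' x) <= Cmod (c' x) * (Cmod r + Cmod r'))%R).
    { rewrite Hb, Cmod_mult, Cmod_opp. apply Rmult_le_compat_l; [apply Cmod_ge_0|apply Cmod_triangle]. }
    assert (K : forall s, c' x * s * s + b' x * s + a x = 0 -> (1 < eps * Cmod s)%R -> exists y,
       a x * y * y + b x * y + c x = 0 /\ (Cmod (y - y0) < eps)%R).
    { intros s Hs Hl. assert (Hs0 : s <> 0) by (intros E; rewrite E, Cmod_0 in Hl; lra).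
      exists (y0 + / s). split.
      - replace (a x) with (- (c' x * s * s + b' x * s)).
        + replace (c x) with (c' x - a x * y0 * y0 - b x * y0) by (unfold c'; ring).
          replace (b x) with (b' x - 2 * a x * y0) by (unfold b'; ring).
          replace (a x) with (- (c' x * s * s + b' x * s)).
          * field. auto.
          * replace (a x) with (0 - (c' x * s * s + b' x * s)); [ring|]. rewrite <- Hs. ring.
        + replace (a x) with (0 - (c' x * s * s + b' x * s)); [ring|]. rewrite <- Hs. ring.
      - replace (y0 + / s - y0) with (/ s) by ring. rewrite Cmod_inv by auto.
        pose proof (proj1 (Cmod_gt_0 _) Hs0).
        apply Rmult_lt_reg_r with (Cmod s); [easy|]. rewrite Rinv_l by lra. lra. }
    destruct (Rlt_dec 1 (eps * Cmod r)) as [L|L]; [|destruct (Rlt_dec 1 (eps * Cmod r')) as [L'|L']].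
    + apply (K r); [rewrite Hr; ring|easy].
    + apply (K r'); [rewrite Hr; ring|easy].
    + exfalso. assert (S : (eps * (Cmod r + Cmod r') <= 2)%R) by lra.
      assert (eps * Cmod (b' x) <= 2 * Cmod (c' x))%R.
      { apply Rle_trans with (Cmod (c' x) * (eps * (Cmod r + Cmod r')))%R; nra. }
      nra.
Qed.

(** On the closed disc the varying quadratic is uniformly close to its limit, so the limit is small
    at each root found there, and its factorisation puts that root near [r] or [r']. *)
Lemma roots_localised {A : Type} (m : A -> R) (a b c : A -> C) (al be ga : C) :
  lim m a al -> lim m b be -> lim m c ga -> (al <> 0 \/ be <> 0 \/ ga <> 0) ->
  exists r r' : C,
    (al * r * r + be * r + ga = 0 \/ (1 < Cmod r)%R) /\
    (al * r' * r' + be * r' + ga = 0 \/ (1 < Cmod r')%R) /\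
    forall eps, (0 < eps)%R -> ev m (fun x => forall y,
       a x * y * y + b x * y + c x = 0 -> (Cmod y <= 1)%R ->
       (Cmod (y - r) < eps)%R \/ (Cmod (y - r') < eps)%R).
Proof.
  intros La Lb Lc Hnz.
  assert (small : forall d, (0 < d)%R -> ev m (fun x => forall y,
       a x * y * y + b x * y + c x = 0 -> (Cmod y <= 1)%R ->
       (Cmod (al * y * y + be * y + ga) < d)%R)).
  { intros d Hd.
    apply ev_imp with (1 := ev_and m _ _ (La (d/3)%R ltac:(lra))
       (ev_and m _ _ (Lb (d/3)%R ltac:(lra)) (Lc (d/3)%R ltac:(lra)))).
    intros x [H1 [H2 H3]] y Hy Hy1.
    replace (al * y * y + be * y + ga) with
      (- (((a x - al) * y * y + (b x - be) * y) + (c x - ga))).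
    2:{ transitivity (al * y * y + be * y + ga - (a x * y * y + b x * y + c x)); [ring|rewrite Hy; ring]. }
    rewrite Cmod_opp.
    eapply Rle_lt_trans; [apply Cmod_triangle|].
    eapply Rle_lt_trans; [apply Rplus_le_compat_r, Cmod_triangle|].
    rewrite !Cmod_mult. pose proof (Cmod_ge_0 y). pose proof (Cmod_ge_0 (a x - al)).
    pose proof (Cmod_ge_0 (b x - be)).
    assert (Cmod (a x - al) * Cmod y * Cmod y <= Cmod (a x - al))%R.
    { rewrite Rmult_assoc. assert (Cmod y * Cmod y <= 1)%R by nra. nra. }
    assert (Cmod (b x - be) * Cmod y <= Cmod (b x - be))%R by nra. lra. }
  assert (H2 : (1 < Cmod 2)%R) by (rewrite Cmod_R, Rabs_right; lra).
  destruct (classic (al = 0)) as [Za|Za].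
  - destruct (classic (be = 0)) as [Zb|Zb].
    + assert (Zc : ga <> 0) by tauto. pose proof (proj1 (Cmod_gt_0 _) Zc) as Hg.
      (* The limit is a nonzero constant and has no root; 2 is a placeholder outside the disc. *)
      exists 2, 2. split; [now right|]. split; [now right|]. intros eps He.
      apply ev_imp with (1 := small _ Hg). intros x Hx y Hy Hy1. exfalso.
      specialize (Hx y Hy Hy1). rewrite Za, Zb in Hx.
      replace (0 * y * y + 0 * y + ga) with ga in Hx by ring. lra.
    + exists (- ga / be), (- ga / be).
      assert (E : al * (- ga / be) * (- ga / be) + be * (- ga / be) + ga = 0) by (rewrite Za; field; auto).
      split; [now left|]. split; [now left|]. intros eps He.
      pose proof (proj1 (Cmod_gt_0 _) Zb) as Hb.
      apply ev_imp with (1 := small (eps * Cmod be)%R ltac:(now apply Rmult_lt_0_compat)).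
      intros x Hx y Hy Hy1. specialize (Hx y Hy Hy1). left.
      replace (al * y * y + be * y + ga) with ((y - - ga / be) * be) in Hx by (rewrite Za; field; auto).
      rewrite Cmod_mult in Hx. eapply Rmult_lt_reg_r; eauto.
  - destruct (quadratic_factor al be ga Za) as [r [r' Hr]]. exists r, r'.
    split; [left; rewrite Hr; ring|]. split; [left; rewrite Hr; ring|]. intros eps He.
    pose proof (proj1 (Cmod_gt_0 _) Za) as Ha.
    assert (Hd : (0 < Cmod al * (eps * eps))%R) by (apply Rmult_lt_0_compat; nra).
    apply ev_imp with (1 := small _ Hd).
    intros x Hx y Hy Hy1. specialize (Hx y Hy Hy1). rewrite Hr, !Cmod_mult in Hx.
    destruct (Rlt_dec (Cmod (y - r)) eps) as [L|L]; [now left|]. right.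
    destruct (Rlt_dec (Cmod (y - r')) eps) as [L'|L']; [easy|]. exfalso.
    assert (eps * eps <= Cmod (y - r) * Cmod (y - r'))%R by nra. nra.
Qed.

(** Connectedness of [u, v], through the supremum of the points up to which [P] agrees with
    [P u]. *)
Lemma interval_constant (P : R -> Prop) (u v : R) : (u <= v)%R ->
  (forall t, (u <= t <= v)%R -> exists r, (0 < r)%R /\
     forall s, (u <= s <= v)%R -> (Rabs (s - t) < r)%R -> (P s <-> P t)) ->
  (P u <-> P v).
Proof.
  intros Huv Hloc.
  set (E := fun t => (u <= t <= v)%R /\ forall s, (u <= s <= t)%R -> (P s <-> P u)).
  assert (Eu : E u).
  { split; [lra|]. intros s Hs. replace s with u by lra. tauto. }
  destruct (completeness E) as [l [Hub Hl]].
  { exists v. intros t [Ht _]. lra. }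
  { now exists u. }
  assert (Hul : (u <= l)%R) by now apply Hub.
  assert (Hlv : (l <= v)%R) by (apply Hl; intros t [Ht _]; lra).
  destruct (Hloc l ltac:(lra)) as [r [Hr H]].
  assert (Ht : exists t, E t /\ (l - r < t)%R).
  { apply NNPP. intros N. assert (l <= l - r)%R; [|lra]. apply Hl. intros t Et.
    destruct (Rle_dec t (l - r)); [easy|]. exfalso. apply N. exists t. split; [easy|lra]. }
  destruct Ht as [t [Et Ht]]. assert (Htl : (t <= l)%R) by now apply Hub.
  assert (Pl : P l <-> P u).
  { rewrite <- (H t); [|destruct Et; lra|apply Rabs_def1; lra]. apply Et. destruct Et; lra. }
  assert (El : E (Rmin v (l + r / 2))).
  { split; [split; [apply Rmin_glb; lra|apply Rmin_l]|].
    intros s Hs. pose proof (Rmin_l v (l + r/2)). pose proof (Rmin_r v (l + r/2)).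
    destruct (Rle_dec s t) as [D|D]; [apply Et; lra|].
    rewrite (H s); [easy|lra|apply Rabs_def1; lra]. }
  pose proof (Hub _ El) as Hle.
  assert (l = v) as <-; [|easy].
  unfold Rmin in Hle. destruct (Rle_dec v (l + r / 2)); lra.
Qed.

(** * Square root of a polynomial off a slit *)

Lemma Re_le_Cmod (w : C) : (Re w <= Cmod w)%R.
Proof. pose proof (re_le_Cmod w) as H. apply Rabs_le_between in H. lra. Qed.

Lemma Re_ge_opp_Cmod (w : C) : (- Cmod w <= Re w)%R.
Proof. pose proof (re_le_Cmod w) as H. apply Rabs_le_between in H. lra. Qed.

Lemma csqrt_spec (w : C) : (0 < Re w)%R ->
  csqrt w * csqrt w = w /\ cont csqrt w /\ csqrt w <> 0.
Proof.
  intros H. pose proof (Re_pos_slit w H) as H'.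
  split; [now apply csqrt_sqr|]. split; [now apply csqrt_cont|].
  intros E. pose proof (Re_csqrt w H') as P. rewrite E in P. simpl in P. lra.
Qed.

(** [g] is a root of the factor of [p] made of its leading coefficient and its zeros outside the
    disc. Positivity on the real segment fixes its sign, and thereby which branch will be X_1. *)
Definition outer_root (p : C -> C) (r1 r2 : R) (g : C -> C) : Prop :=
  (forall y, (Cmod y <= 1)%R -> cont g y /\ p y = (y - r1) * (y - r2) * (g y * g y) /\ g y <> 0) /\
  (forall t : R, (-1 <= t <= 1)%R -> exists u : R, (0 < u)%R /\ g (RtoC t) = RtoC u).

(** For |y| <= 1 < s the number s - ey lies in the right half-plane, where the principal root is
    continuous. The sign [e] allows for an outer zero on either side of the disc. *)
Lemma outer_root_linear (s e : R) : (1 < s)%R -> e = 1%R \/ e = (-1)%R ->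
  exists g : C -> C,
  (forall y, (Cmod y <= 1)%R -> cont g y /\ s - e * y = g y * g y /\ g y <> 0) /\
  (forall t : R, (-1 <= t <= 1)%R -> exists u : R, (0 < u)%R /\ g (RtoC t) = RtoC u).
Proof.
  intros Hs He. exists (fun y => csqrt (s - e * y)). split.
  - intros y Hy.
    assert (Hp : (0 < Re (s - e * y))%R).
    { pose proof (Re_le_Cmod y) as H1. pose proof (Re_ge_opp_Cmod y) as H2.
      replace (Re (s - e * y)) with (s - e * Re y)%R by (unfold Re; simpl; ring).
      destruct He as [-> | ->]; lra. }
    destruct (csqrt_spec _ Hp) as [H1 [H2 H3]].
    split; [|now split].
    apply (lim_comp (dist y) csqrt (fun y => s - e * y) (s - e * y)); [limtac|exact H2].
  - intros t Ht. exists (sqrt (s - e * t)).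
    assert (Hp : (0 < s - e * t)%R) by (destruct He as [-> | ->]; lra).
    split; [now apply sqrt_lt_R0|].
    rewrite <- csqrt_real by easy. f_equal. now rewrite RtoC_minus, RtoC_mult.
Qed.

Lemma RtoC_inj' (x y : R) : RtoC x = RtoC y -> x = y.
Proof. intros H. now injection H. Qed.

(** The sign of [lc] is not given. It is read off from p(1) > 0 and distributed so that each linear
    factor and the remaining constant are positive on the real segment. *)
Lemma outer_root_exists (p : C -> C) (r1 r2 p1 : R) :
  branch_points p r1 r2 -> p 1 = RtoC p1 -> (0 < p1)%R ->
  (Rabs r1 < r2)%R /\ (r2 < 1)%R /\ exists g, outer_root p r1 r2 g.
Proof.
  intros (r3 & r4 & lc & Hlc & H12 & H21 & H3 & Hp) Hp1 Hpos.
  split; [easy|]. split; [easy|].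
  assert (H1 : (r1 < 1)%R) by (apply Rabs_def2 in H12 || (pose proof (Rle_abs r1)); lra).
  assert (build : forall (k : R) (f : C -> C), (0 < k)%R ->
    (forall y, (Cmod y <= 1)%R -> cont f y /\ p y = (y - r1) * (y - r2) * (k * (f y * f y)) /\ f y <> 0) ->
    (forall t : R, (-1 <= t <= 1)%R -> exists u : R, (0 < u)%R /\ f (RtoC t) = RtoC u) ->
    exists g, outer_root p r1 r2 g).
  { intros k f Hk Hf Hr. exists (fun y => sqrt k * f y). split.
    - intros y Hy. destruct (Hf y Hy) as [F1 [F2 F3]]. split; [apply lim_mult; [apply lim_const|exact F1]|].
      split.
      + rewrite F2. rewrite <- (sqrt_sqrt k) at 1 by lra. rewrite RtoC_mult. ring.
      + apply Cmult_neq_0; [|easy]. intros E. apply RtoC_inj' in E.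
        pose proof (sqrt_lt_R0 k Hk). lra.
    - intros t Ht. destruct (Hr t Ht) as [u [Hu E]]. exists (sqrt k * u)%R.
      split; [apply Rmult_lt_0_compat; [now apply sqrt_lt_R0|easy]|]. now rewrite E, RtoC_mult. }
  destruct (outer_root_linear r3 1 H3 (or_introl eq_refl)) as [g3 [G3 G3']].
  destruct Hp as [[H4 Hp]|Hp].
  - change (forall X : C, p X = lc * ((X - r1) * ((X - r2) * ((X - r3) * (X - r4))))) in Hp.
    assert (E1 : (p1 = lc * ((1 - r1) * ((1 - r2) * ((1 - r3) * (1 - r4)))))%R).
    { apply RtoC_inj'. rewrite <- Hp1, Hp. now rewrite !RtoC_mult, !RtoC_minus. }
    assert (Q : (0 < (1 - r1) * (1 - r2) * (r3 - 1))%R) by (repeat apply Rmult_lt_0_compat; lra).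
    destruct (Rle_dec 0 r4) as [S|S].
    + rewrite Rabs_right in H4 by lra.
      assert (Hlp : (0 < lc)%R).
      { assert (0 < (1 - r1) * (1 - r2) * (r3 - 1) * (r4 - 1))%R by (apply Rmult_lt_0_compat; lra).
        apply Rmult_lt_reg_r with ((1 - r1) * (1 - r2) * (r3 - 1) * (r4 - 1))%R; [easy|]. lra. }
      destruct (outer_root_linear r4 1 ltac:(lra) (or_introl eq_refl)) as [g4 [G4 G4']].
      apply (build lc (fun y => g3 y * g4 y)); [easy| |].
      * intros y Hy. destruct (G3 y Hy) as [A1 [A2 A3]]. destruct (G4 y Hy) as [B1 [B2 B3]].
        split; [now apply lim_mult|]. split; [|now apply Cmult_neq_0].
        transitivity (lc * ((y - r1) * ((y - r2) * ((r3 - 1 * y) * (r4 - 1 * y))))).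
        { rewrite Hp. ring. } rewrite A2, B2. ring.
      * intros t Ht. destruct (G3' t Ht) as [u [Hu Eu]]. destruct (G4' t Ht) as [v [Hv Ev]].
        exists (u * v)%R. split; [now apply Rmult_lt_0_compat|]. now rewrite Eu, Ev, RtoC_mult.
    + rewrite Rabs_left in H4 by lra.
      assert (Hlp : (0 < - lc)%R).
      { assert (0 < (1 - r1) * (1 - r2) * (r3 - 1) * (1 - r4))%R by (apply Rmult_lt_0_compat; lra).
        apply Rmult_lt_reg_r with ((1 - r1) * (1 - r2) * (r3 - 1) * (1 - r4))%R; [easy|]. lra. }
      destruct (outer_root_linear (- r4) (-1) ltac:(lra) (or_intror eq_refl)) as [g4 [G4 G4']].
      apply (build (- lc)%R (fun y => g3 y * g4 y)); [easy| |].
      * intros y Hy. destruct (G3 y Hy) as [A1 [A2 A3]]. destruct (G4 y Hy) as [B1 [B2 B3]].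
        split; [now apply lim_mult|]. split; [|now apply Cmult_neq_0].
        transitivity ((- lc)%R * ((y - r1) * ((y - r2) * ((r3 - 1 * y) * ((- r4)%R - (-1)%R * y))))).
        { rewrite Hp, !RtoC_opp. ring. } rewrite A2, B2. ring.
      * intros t Ht. destruct (G3' t Ht) as [u [Hu Eu]]. destruct (G4' t Ht) as [v [Hv Ev]].
        exists (u * v)%R. split; [now apply Rmult_lt_0_compat|]. now rewrite Eu, Ev, RtoC_mult.
  - change (forall X : C, p X = lc * ((X - r1) * ((X - r2) * (X - r3)))) in Hp.
    assert (E1 : (p1 = lc * ((1 - r1) * ((1 - r2) * (1 - r3))))%R).
    { apply RtoC_inj'. rewrite <- Hp1, Hp. now rewrite !RtoC_mult, !RtoC_minus. }
    assert (Q : (0 < (1 - r1) * (1 - r2) * (r3 - 1))%R) by (repeat apply Rmult_lt_0_compat; lra).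
    assert (Hlp : (0 < - lc)%R).
    { apply Rmult_lt_reg_r with ((1 - r1) * (1 - r2) * (r3 - 1))%R; [easy|]. lra. }
    apply (build (- lc)%R g3); [easy| |easy].
    intros y Hy. destruct (G3 y Hy) as [A1 [A2 A3]]. split; [easy|]. split; [|easy].
    transitivity ((- lc)%R * ((y - r1) * ((y - r2) * (r3 - 1 * y)))).
    { rewrite Hp, RtoC_opp. ring. } rewrite A2. ring.
Qed.

Definition slit (r1 r2 : R) (y : C) : Prop := exists t : R, (r1 <= t <= r2)%R /\ y = RtoC t.

(* The Moebius ratio takes values in the closed negative axis exactly on the slit, so the principal
   square root makes this a square root of [(y - r1) (y - r2) g^2] that is holomorphic off the slit. *)
Definition slit_root (r1 r2 : R) (g : C -> C) (y : C) : C :=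
  (y - r1) * csqrt ((y - r2) / (y - r1)) * g y.

Lemma slit_ratio (r1 r2 : R) (y : C) : (r1 <= r2)%R -> ~ slit r1 r2 y ->
  y - r1 <> 0 /\ (0 < Cmod ((y - r2) / (y - r1)) + Re ((y - r2) / (y - r1)))%R.
Proof.
  intros H12 Hy.
  assert (N : y - r1 <> 0).
  { apply Cminus_neq_0. intros E. apply Hy. exists r1. split; [lra|easy]. }
  split; [easy|]. apply Rnot_le_lt. intros H. apply Hy. set (w := (y - r2) / (y - r1)) in *.
  pose proof (Re_ge_opp_Cmod w) as H1. pose proof (Cmod_ge_0 w) as H2.
  assert (Er : (Cmod w = - Re w)%R) by lra.
  pose proof (Cmod_sqr w) as E. rewrite Er in E.
  assert (E3 : (Im w * Im w = 0)%R) by nra.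
  assert (E4 : Im w = 0%R) by (destruct (Rmult_integral _ _ E3); easy).
  set (s := Cmod w) in *.
  assert (Ew : w = RtoC (- s)).
  { apply injective_projections; [change (Re w = - s)%R; lra|exact E4]. }
  assert (Ey : y - r2 = RtoC (- s) * (y - r1)) by (rewrite <- Ew; unfold w; field; easy).
  (* The equation y - r2 = -s (y - r1) solved for y: a convex combination of [r1] and [r2]. *)
  exists ((r2 + s * r1) / (1 + s))%R. split.
  - assert (Eq : ((r2 + s * r1) / (1 + s) * (1 + s) = r2 + s * r1)%R) by (field; lra).
    set (t := ((r2 + s * r1) / (1 + s))%R) in *. split; nra.
  - assert (S : 1 + RtoC s <> 0).
    { rewrite <- RtoC_plus. intros F. apply RtoC_inj' in F. lra. }
    assert (E5 : y * (1 + RtoC s) = r2 + RtoC s * r1).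
    { transitivity (y - r2 - RtoC (- s) * (y - r1) + (r2 + RtoC s * r1)).
      - rewrite RtoC_opp. ring.
      - rewrite Ey. ring. }
    rewrite RtoC_div by lra. rewrite !RtoC_plus, RtoC_mult, <- E5. field. exact S.
Qed.

Lemma slit_root_spec (p : C -> C) (r1 r2 : R) (g : C -> C) : (r1 <= r2)%R ->
  outer_root p r1 r2 g -> forall y, (Cmod y <= 1)%R -> ~ slit r1 r2 y ->
  cont (slit_root r1 r2 g) y /\ slit_root r1 r2 g y * slit_root r1 r2 g y = p y /\
  slit_root r1 r2 g y <> 0.
Proof.
  intros H12 [Hg _] y Hy Hs. destruct (Hg y Hy) as [G1 [G2 G3]].
  destruct (slit_ratio r1 r2 y H12 Hs) as [N P].
  assert (N2 : y - r2 <> 0).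
  { apply Cminus_neq_0. intros E. apply Hs. exists r2. split; [lra|easy]. }
  assert (E : slit_root r1 r2 g y * slit_root r1 r2 g y = p y).
  { unfold slit_root.
    transitivity ((y - r1) * (y - r1) * (csqrt ((y - r2) / (y - r1)) * csqrt ((y - r2) / (y - r1))) * (g y * g y)); [ring|].
    rewrite csqrt_sqr by easy. rewrite G2. field. easy. }
  split; [|split; [easy|]].
  - apply lim_mult; [|exact G1]. apply lim_mult; [limtac|].
    apply (lim_comp (dist y) csqrt (fun y => (y - r2) / (y - r1)) ((y - r2) / (y - r1))).
    + apply lim_mult; [limtac|]. apply lim_inv; [limtac|easy].
    + now apply csqrt_cont.
  - intros F. rewrite F in E. rewrite G2 in E.
    assert (K : (y - r1) * (y - r2) * (g y * g y) <> 0) by (repeat apply Cmult_neq_0; easy).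
    apply K. rewrite <- E. ring.
Qed.

Lemma slit_root_real (p : C -> C) (r1 r2 : R) (g : C -> C) (t : R) : (r1 <= r2)%R ->
  outer_root p r1 r2 g -> (-1 <= t <= 1)%R -> (r2 < t)%R ->
  exists u : R, (0 < u)%R /\ slit_root r1 r2 g (RtoC t) = RtoC u.
Proof.
  intros H12 [_ Hg] Ht H2. destruct (Hg t Ht) as [u [Hu E]].
  exists ((t - r1) * sqrt ((t - r2) / (t - r1)) * u)%R.
  assert (P : (0 < (t - r2) / (t - r1))%R) by (apply Rdiv_lt_0_compat; lra).
  split.
  - repeat apply Rmult_lt_0_compat; try lra. now apply sqrt_lt_R0.
  - unfold slit_root. rewrite E, !RtoC_mult, <- csqrt_real by easy.
    rewrite RtoC_div by lra. now rewrite !RtoC_minus.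
Qed.

Lemma slit_closed (r1 r2 : R) (y0 : C) : ~ slit r1 r2 y0 -> ev (dist y0) (fun y => ~ slit r1 r2 y).
Proof.
  intros H. destruct (Req_dec (Im y0) 0) as [Z|Z].
  - assert (E0 : y0 = RtoC (Re y0)) by (apply injective_projections; simpl; easy).
    assert (O : (Re y0 < r1 \/ r2 < Re y0)%R).
    { destruct (Rlt_dec (Re y0) r1); [now left|]. destruct (Rlt_dec r2 (Re y0)); [now right|].
      exfalso. apply H. exists (Re y0). split; [lra|easy]. }
    exists (if Rlt_dec (Re y0) r1 then r1 - Re y0 else Re y0 - r2)%R.
    split; [destruct (Rlt_dec (Re y0) r1); lra|].
    intros y Hy [t [Ht ->]]. unfold dist in Hy. pose proof (re_le_Cmod (t - y0)) as D.
    change (Re (t - y0)) with (t + - Re y0)%R in D. apply Rabs_le_between in D.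
    destruct (Rlt_dec (Re y0) r1); lra.
  - exists (Rabs (Im y0)). split; [now apply Rabs_pos_lt|].
    intros y Hy [t [Ht ->]]. unfold dist in Hy.
    pose proof (Rmax_Cmod (t - y0)) as D. pose proof (Rmax_r (Rabs (fst (t - y0))) (Rabs (snd (t - y0)))) as D'.
    pose proof (Rle_trans _ _ _ D' D) as D''.
    change (snd (t - y0)) with (0 + - Im y0)%R in D''. rewrite Rplus_0_l, Rabs_Ropp in D''. lra.
Qed.

(** * Dominated quadratics, complex derivatives, components *)

Definition quad (p q r : R) (x : C) : C := p + q * x + r * (x * x).
Definition midquad (p r : R) (x : C) : C := p - x + r * (x * x).

Lemma quad_lim {A : Type} (m : A -> R) f (l : C) (p q r : R) :
  lim m f l -> lim m (fun t => quad p q r (f t)) (quad p q r l).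
Proof. intros H. unfold quad. limtac. Qed.

Lemma midquad_lim {A : Type} (m : A -> R) f (l : C) (p r : R) :
  lim m f l -> lim m (fun t => midquad p r (f t)) (midquad p r l).
Proof. intros H. unfold midquad. limtac. Qed.

Lemma quad_real (p q r t : R) : quad p q r (RtoC t) = RtoC (p + q * t + r * (t * t)).
Proof. unfold quad. now rewrite !RtoC_plus, !RtoC_mult. Qed.

Lemma midquad_real (p r t : R) : midquad p r (RtoC t) = RtoC (p - t + r * (t * t)).
Proof. unfold midquad. now rewrite !RtoC_plus, !RtoC_minus, !RtoC_mult. Qed.

Lemma quad_bound (p q r : R) (x : C) : (0 <= p)%R -> (0 <= q)%R -> (0 <= r)%R -> Cmod x = 1%R ->
  (Cmod (quad p q r x) <= p + q + r)%R.
Proof.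
  intros Hp Hq Hr Hx. unfold quad. eapply Rle_trans; [apply Cmod_triangle|].
  apply Rplus_le_compat.
  - eapply Rle_trans; [apply Cmod_triangle|]. rewrite Cmod_mult, !Cmod_R, Hx, !Rabs_right by lra. lra.
  - rewrite !Cmod_mult, Cmod_R, Hx, Rabs_right by lra. lra.
Qed.

Lemma midquad_bound (p r : R) (x : C) : (0 <= p)%R -> (0 <= r)%R -> Cmod x = 1%R ->
  (1 - p - r <= Cmod (midquad p r x))%R.
Proof.
  intros Hp Hr Hx. unfold midquad.
  pose proof (Cmod_triangle (p - x + r * (x * x)) (- (p + r * (x * x)))) as T.
  replace (p - x + r * (x * x) + - (p + r * (x * x))) with (- x) in T by ring.
  rewrite !Cmod_opp, Hx in T. pose proof (Cmod_triangle p (r * (x * x))) as T'.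
  rewrite !Cmod_mult, !Cmod_R, Hx, !Rabs_right in T' by lra. lra.
Qed.

(** (u - al)(u - ga) = u(u + v - al - ga) > 0 puts [al] and [ga] on the same side of [u]; above [u],
    their product would exceed uv. *)
Lemma dominant_factor (al ga u v : R) : (0 <= al)%R -> (0 <= ga)%R -> (0 <= v)%R -> (v < u)%R ->
  (u * v = al * ga)%R -> (al + ga < u + v)%R -> (al < u)%R /\ (ga < u)%R.
Proof.
  intros Ha Hg Hv Hvu E S.
  assert (P : (0 < (u - al) * (u - ga))%R).
  { replace ((u - al) * (u - ga))%R with (u * (u + v - (al + ga)))%R by lra.
    apply Rmult_lt_0_compat; lra. }
  split.
  - apply Rnot_le_lt. intros L. assert (ga > u)%R by nra. assert (u * v < al * ga)%R by nra. lra.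
  - apply Rnot_le_lt. intros L. assert (al > u)%R by nra. assert (u * v < al * ga)%R by nra. lra.
Qed.

(** The relation on y + y' makes [y'] the second root counted with multiplicity, so y = y' is
    covered. From (1 - |y|)(1 - |y'|) >= 0 follows |y + y'| <= 1 + |y y'|, against the dominance of
    [b]. *)
Lemma two_in_disc (b a c y y' : C) :
  (Cmod a + Cmod c < Cmod b)%R -> a * (y + y') + b = 0 -> a * y * y + b * y + c = 0 ->
  (Cmod y <= 1)%R -> (Cmod y' <= 1)%R -> False.
Proof.
  intros H Hs Hr H1 H2.
  assert (Eb : b = - (a * (y + y'))).
  { transitivity (a * (y + y') + b - a * (y + y')); [ring|]. rewrite Hs. ring. }
  assert (Ec : c = a * (y * y')).
  { transitivity (a * y * y + b * y + c - (a * (y + y') + b) * y + a * (y * y')); [ring|].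
    rewrite Hs, Hr. ring. }
  rewrite Eb, Ec, Cmod_opp, !Cmod_mult in H.
  pose proof (Cmod_triangle y y'). pose proof (Cmod_ge_0 a). pose proof (Cmod_ge_0 y). pose proof (Cmod_ge_0 y').
  assert (Cmod (y + y') <= 1 + Cmod y * Cmod y')%R by nra. nra.
Qed.

(** If both roots had modulus at least 1, the inequality |r + r'| <= 1 + |r r'| would hold again,
    now from (|r| - 1)(|r'| - 1) >= 0. *)
Lemma one_in_disc (b a c : C) : (Cmod a + Cmod c < Cmod b)%R ->
  exists y, a * y * y + b * y + c = 0 /\ (Cmod y < 1)%R.
Proof.
  intros H. pose proof (Cmod_ge_0 a). pose proof (Cmod_ge_0 c).
  destruct (classic (a = 0)) as [Z|Z].
  - assert (Hb : b <> 0) by (intros E; rewrite E, Cmod_0 in H; lra).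
    exists (- c / b). split; [rewrite Z; field; easy|].
    rewrite Cmod_div, Cmod_opp by easy. apply Rlt_div_l; lra.
  - destruct (quadratic_factor a b c Z) as [r [r' Hr]].
    destruct (Rlt_dec (Cmod r) 1) as [L|L]; [exists r; split; [rewrite Hr; ring|easy]|].
    destruct (Rlt_dec (Cmod r') 1) as [L'|L']; [exists r'; split; [rewrite Hr; ring|easy]|].
    exfalso.
    assert (Ec : c = a * (r * r')).
    { transitivity (a * 0 * 0 + b * 0 + c); [ring|]. rewrite Hr. ring. }
    assert (Eb : b = - (a * (r + r'))).
    { transitivity ((a * 1 * 1 + b * 1 + c) - c - a); [ring|]. rewrite Hr, Ec. ring. }
    rewrite Eb, Ec, Cmod_opp, !Cmod_mult in H.
    pose proof (Cmod_triangle r r').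
    assert (Cmod (r + r') <= 1 + Cmod r * Cmod r')%R by nra. nra.
Qed.

(* Any point of the unit circle is joined to 1 by an arc parametrised by its real part. *)
Lemma circle_constant (P : C -> Prop) :
  (forall y, Cmod y = 1%R -> exists r, (0 < r)%R /\
     forall w, Cmod w = 1%R -> (Cmod (w - y) < r)%R -> (P w <-> P y)) ->
  P 1 -> forall y, Cmod y = 1%R -> P y.
Proof.
  intros Hloc H1 y Hy.
  pose proof (Cmod_sqr y) as Hsq. rewrite Hy in Hsq.
  assert (Hs : exists e, (e = 1%R \/ e = (-1)%R) /\ Im y = (e * sqrt (1 - Re y * Re y))%R).
  { replace (1 - Re y * Re y)%R with (Rsqr (Im y)) by (unfold Rsqr; lra). rewrite sqrt_Rsqr_abs.
    destruct (Rle_dec 0 (Im y)).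
    - exists 1%R. split; [now left|]. rewrite Rabs_right; lra.
    - exists (-1)%R. split; [now right|]. rewrite Rabs_left; lra. }
  destruct Hs as [e [He Ei]].
  set (arc := fun t : R => ((t, (e * sqrt (1 - t * t))%R) : C)).
  assert (Hmod : forall t, (Re y <= t <= 1)%R -> Cmod (arc t) = 1%R).
  { intros t Ht. unfold Cmod, arc. simpl. transitivity (sqrt 1); [f_equal|apply sqrt_1].
    assert (Hp : (0 <= 1 - t * t)%R) by (pose proof (Re_ge_opp_Cmod y); nra). pose proof (sqrt_sqrt _ Hp) as S.
    replace (t * (t * 1) + e * sqrt (1 - t * t) * (e * sqrt (1 - t * t) * 1))%R
      with (t * t + e * e * (sqrt (1 - t * t) * sqrt (1 - t * t)))%R by ring.
    rewrite S. destruct He as [-> | ->]; ring. }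
  assert (Hr : (Re y <= 1)%R) by nra.
  assert (K : P (arc (Re y)) <-> P (arc 1)).
  { apply (interval_constant (fun t => P (arc t))); [easy|]. intros t Ht.
    destruct (Hloc (arc t) (Hmod t Ht)) as [r [Hrp Hrr]].
    assert (Hp : (0 <= 1 - t * t)%R) by (pose proof (Re_ge_opp_Cmod y); nra).
    assert (Hc : continuity_pt (fun s => e * sqrt (1 - s * s))%R t).
    { apply (continuity_pt_mult (fun _ => e) (fun s => sqrt (1 - s * s))%R);
        [apply continuity_pt_const; easy|].
      apply (continuity_pt_comp (fun s => 1 - s * s)%R sqrt); [|now apply continuity_pt_sqrt].
      apply continuity_pt_minus; [apply continuity_pt_const; easy|].
      apply continuity_pt_mult; apply derivable_continuous_pt, derivable_pt_id. }
    destruct (Hc (r / 2)%R ltac:(lra)) as [d [Hd Hdd]].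
    exists (Rmin d (r / 2)). split; [apply Rmin_pos; lra|].
    intros s Hs Hst.
    assert (S1 : (Rabs (s - t) < d)%R) by (eapply Rlt_le_trans; [exact Hst|apply Rmin_l]).
    assert (S2 : (Rabs (s - t) < r / 2)%R) by (eapply Rlt_le_trans; [exact Hst|apply Rmin_r]).
    apply Hrr; [now apply Hmod|].
    assert (S3 : (Rabs (e * sqrt (1 - s * s) - e * sqrt (1 - t * t)) < r / 2)%R).
    { destruct (Req_dec s t) as [-> | N].
      - replace (e * sqrt (1 - t * t) - e * sqrt (1 - t * t))%R with 0%R by ring. rewrite Rabs_R0. lra.
      - apply Hdd. split; [split; [exact I|congruence]|exact S1]. }
    assert (Ed : arc s - arc t = RtoC (s - t) + Ci * RtoC (e * sqrt (1 - s * s) - e * sqrt (1 - t * t))).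
    { apply injective_projections; simpl; ring. }
    rewrite Ed. eapply Rle_lt_trans; [apply Cmod_triangle|].
    rewrite Cmod_mult, Cmod_Ci, !Cmod_R. lra. }
  replace y with (arc (Re y)) by (apply injective_projections; [easy|symmetry; exact Ei]).
  apply K. unfold arc. replace (1 - 1 * 1)%R with 0%R by ring. rewrite sqrt_0, Rmult_0_r. exact H1.
Qed.

Definition cdiff (F : C -> C) (x : C) : Prop :=
  exists f' : C, forall eps : R, (0 < eps)%R -> exists delta : R, (0 < delta)%R /\
    forall h, (Cmod h < delta)%R -> (Cmod (F (x + h)%C - F x - f' * h) <= eps * Cmod h)%R.

Lemma cdiff_of_slope (F phi : C -> C) (x l : C) :
  lim Cmod phi l -> ev Cmod (fun h => F (x + h) - F x = h * phi h) -> cdiff F x.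
Proof.
  intros L E. exists l. intros e He.
  destruct (ev_and _ _ _ E (L e He)) as [d [Hd H]]. exists d. split; [easy|].
  intros h Hh. destruct (H h Hh) as [H1 H2]. rewrite H1.
  replace (h * phi h - l * h) with ((phi h - l) * h) by ring.
  rewrite Cmod_mult. apply Rmult_le_compat_r; [apply Cmod_ge_0|lra].
Qed.

(** Caratheodory's form of the derivative. Limits here are not punctured, so the slope must equal
    [l] at 0; it can then be composed with maps that vanish at nonzero arguments, and the chain rule
    needs no case distinction. *)
Lemma slope_of_cdiff (F : C -> C) (x : C) : cdiff F x ->
  exists phi l, lim Cmod phi l /\ forall h, F (x + h) - F x = h * phi h.
Proof.
  intros [l H].
  exists (fun h : C => if excluded_middle_informative (h = 0) then l else (F (x + h) - F x) / h), l. split.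
  - intros e He. destruct (H (e / 2)%R ltac:(lra)) as [d [Hd Hh]]. exists d. split; [easy|].
    intros h Hhd. destruct (excluded_middle_informative (h = RtoC 0)) as [Z|Z].
    + replace (l - l) with (RtoC 0) by ring. now rewrite Cmod_0.
    + replace ((F (x + h) - F x) / h - l) with ((F (x + h) - F x - l * h) / h) by (field; easy).
      pose proof (proj1 (Cmod_gt_0 h) Z) as P. rewrite Cmod_div by easy.
      apply Rlt_div_l; [easy|]. specialize (Hh h Hhd). nra.
  - intros h. destruct (excluded_middle_informative (h = RtoC 0)) as [->|Z].
    + rewrite Cplus_0_r. ring.
    + field. easy.
Qed.

Lemma lim_comp_0 {A : Type} (m : A -> R) (f : A -> C) (phi : C -> C) (l : C) :
  lim m f 0 -> lim Cmod phi l -> lim m (fun t => phi (f t)) l.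
Proof.
  intros Lf L e He. destruct (L e He) as [d [Hd H]].
  apply ev_imp with (1 := Lf d Hd). intros t Ht. apply H.
  now replace (f t - 0) with (f t) in Ht by ring.
Qed.

Lemma ev_shift (x : C) (P : C -> Prop) : ev (dist x) P -> ev Cmod (fun h => P (x + h)).
Proof.
  intros [d [Hd H]]. exists d. split; [easy|]. intros h Hh. apply H. unfold dist.
  now replace (x + h - x) with h by ring.
Qed.

Lemma lim_shift (x : C) (f : C -> C) (l : C) : lim (dist x) f l -> lim Cmod (fun h => f (x + h)) l.
Proof. intros L e He. exact (ev_shift x _ (L e He)). Qed.

Lemma lim_id_0 : lim Cmod (fun h => h) 0.
Proof. intros e He. exists e. split; [easy|]. intros h Hh. now replace (h - 0) with h by ring. Qed.

Lemma cdiff_local (F G : C -> C) (x : C) : ev (dist x) (fun w => G w = F w) -> cdiff F x -> cdiff G x.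
Proof.
  intros E H. destruct (slope_of_cdiff F x H) as (phi & l & L & S).
  apply (cdiff_of_slope G phi x l L).
  assert (E0 : G x = F x).
  { destruct E as [d [Hd E]]. apply E. unfold dist. replace (x - x) with (RtoC 0) by ring. now rewrite Cmod_0. }
  apply ev_imp with (1 := ev_shift x _ E). intros h Hh. now rewrite Hh, E0.
Qed.

Lemma cdiff_mult (F G : C -> C) (x : C) : cdiff F x -> cdiff G x -> cdiff (fun w => F w * G w) x.
Proof.
  intros HF HG. destruct (slope_of_cdiff F x HF) as (p & l & L & S).
  destruct (slope_of_cdiff G x HG) as (p' & l' & L' & S').
  apply (cdiff_of_slope _ (fun h => p h * G x + F x * p' h + h * p h * p' h) x (l * G x + F x * l' + 0 * l * l')).
  - pose proof lim_id_0. limtac.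
  - exists 1%R. split; [lra|]. intros h _.
    transitivity ((F (x + h) - F x) * G x + F x * (G (x + h) - G x) + (F (x + h) - F x) * (G (x + h) - G x)); [ring|].
    rewrite S, S'. ring.
Qed.

Lemma cdiff_quad (p q r : R) (x : C) : cdiff (quad p q r) x.
Proof.
  apply (cdiff_of_slope _ (fun h => q + r * (2 * x + h)) x (q + r * (2 * x + 0))).
  - pose proof lim_id_0. limtac.
  - exists 1%R. split; [lra|]. intros h _. unfold quad. ring.
Qed.

(** [P] is controlled only on [A] and need not be open elsewhere, so connectedness is applied to the
    interiors of [P] and of its complement, which together cover [T]. *)
Lemma component_invariant (A P : C -> Prop) (p w : C) :
  (forall x, A x -> ev (dist x) (fun v => P v <-> P x)) ->
  component A p w -> P p -> A w /\ P w.
Proof.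
  intros Hloc (T & HT & Hcon & Hp & Hw) Pp. split; [now apply HT|].
  apply NNPP. intros Nw.
  set (U := fun (Q : C -> Prop) (u : C) => exists x r, Q x /\ (Cmod (u - x) < r)%R /\
    forall v, (Cmod (v - x) < r)%R -> Q v).
  assert (HU : forall Q, Copen (U Q)).
  { intros Q u (x & r & Qx & Hu & Hr). exists (r - Cmod (u - x))%R. split; [lra|].
    intros v Hv. change (Cmod (v - u) < r - Cmod (u - x))%R in Hv. exists x, r. split; [easy|]. split; [|easy].
    replace (v - x) with ((v - u) + (u - x)) by ring. pose proof (Cmod_triangle (v - u) (u - x)). lra. }
  assert (Hin : forall Q : C -> Prop, (forall x, A x -> Q x -> ev (dist x) Q) -> forall v, T v -> Q v -> U Q v).
  { intros Q HQ v Tv Qv. destruct (HQ v (HT v Tv) Qv) as [r [Hr H]]. exists v, r. split; [easy|]. split; [|easy].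
    replace (v - v) with (RtoC 0) by ring. now rewrite Cmod_0. }
  assert (H1 : forall x, A x -> P x -> ev (dist x) P).
  { intros x Ax Px. apply ev_imp with (1 := Hloc x Ax). tauto. }
  assert (H2 : forall x, A x -> ~ P x -> ev (dist x) (fun v => ~ P v)).
  { intros x Ax Px. apply ev_imp with (1 := Hloc x Ax). tauto. }
  apply (Hcon (U P) (U (fun v => ~ P v)) (HU _) (HU _)).
  - intros v Tv. destruct (classic (P v)); [left|right]; now apply Hin.
  - intros v _ (x & r & _ & Hv & H) (x' & r' & _ & Hv' & H'). exact (H' v Hv' (H v Hv)).
  - exists p. split; [easy|]. now apply Hin.
  - exists w. split; [easy|]. now apply Hin.
Qed.

(** * Geometry of the kernel *)

Section Kernel.
(** Letters [a], [b], [c] stand for the powers y^2, y, 1 in K and indices for the power of x; [ta],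
    [tb], [tc] regroup the same weights by powers of x. There is no [b1], as there is no step (0,
    0). *)
Context (a0 a1 a2 b0 b2 c0 c1 c2 : R).
Context (Pa0 : (0 <= a0)%R) (Pa1 : (0 <= a1)%R) (Pa2 : (0 <= a2)%R)
  (Pb0 : (0 <= b0)%R) (Pb2 : (0 <= b2)%R)
  (Pc0 : (0 <= c0)%R) (Pc1 : (0 <= c1)%R) (Pc2 : (0 <= c2)%R).
Context (Hsum : (a0 + a1 + a2 + b0 + b2 + c0 + c1 + c2 < 1)%R).
Context (Ha : (0 < a0 + a1 + a2)%R) (Hc : (0 < c0 + c1 + c2)%R).
Local Notation a := (quad a0 a1 a2).
Local Notation b := (midquad b0 b2).
Local Notation c := (quad c0 c1 c2).
Local Notation ta := (quad c2 b2 a2).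
Local Notation tb := (midquad c1 a1).
Local Notation tc := (quad c0 b0 a0).

Definition ker (x y : C) : C := a x * y * y + b x * y + c x.

Lemma ker_swap (x y : C) : ker x y = ta y * x * x + tb y * x + tc y.
Proof. unfold ker, quad, midquad. ring. Qed.

Lemma dominant_b (x : C) : Cmod x = 1%R -> (Cmod (a x) + Cmod (c x) < Cmod (b x))%R.
Proof.
  intros H. pose proof (quad_bound a0 a1 a2 x Pa0 Pa1 Pa2 H).
  pose proof (quad_bound c0 c1 c2 x Pc0 Pc1 Pc2 H). pose proof (midquad_bound b0 b2 x Pb0 Pb2 H). lra.
Qed.

Lemma dominant_tb (y : C) : Cmod y = 1%R -> (Cmod (ta y) + Cmod (tc y) < Cmod (tb y))%R.
Proof.
  intros H. pose proof (quad_bound c2 b2 a2 y Pc2 Pb2 Pa2 H).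
  pose proof (quad_bound c0 b0 a0 y Pc0 Pb0 Pa0 H). pose proof (midquad_bound c1 a1 y Pc1 Pa1 H). lra.
Qed.

(** * Discriminants and the two branches of x-roots *)

Definition disc (x : C) : C := b x * b x - 4 * (a x * c x).
Definition tdisc (y : C) : C := tb y * tb y - 4 * (ta y * tc y).

Context (x1 x2 y1 y2 : R).
Context (g : C -> C) (Hy12 : (Rabs y1 < y2)%R) (Hy2 : (y2 < 1)%R) (Hg : outer_root tdisc y1 y2 g).

Local Notation rho := (slit_root y1 y2 g).

Lemma y1_lt_y2 : (y1 < y2)%R.
Proof. pose proof (Rle_abs y1). lra. Qed.

Lemma rho_spec (y : C) : (Cmod y <= 1)%R -> ~ slit y1 y2 y ->
  cont rho y /\ rho y * rho y = tdisc y /\ rho y <> 0.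
Proof. apply slit_root_spec; [pose proof y1_lt_y2; lra|exact Hg]. Qed.

Lemma circle_not_slit (y : C) : Cmod y = 1%R -> ~ slit y1 y2 y.
Proof.
  intros H [t [Ht ->]]. rewrite Cmod_R in H. apply Rabs_def2 in Hy12.
  unfold Rabs in H. destruct (Rcase_abs t); lra.
Qed.

(* On the circle [(rho / tb)^2 = 1 - w] with [|w| < 1], so the ratio never meets the imaginary axis. *)
Lemma circle_ratio_pos (y : C) : Cmod y = 1%R -> (0 < Re (rho y / - tb y))%R.
Proof.
  assert (Hb : forall y, Cmod y = 1%R -> tb y <> 0).
  { intros w Hw E. pose proof (dominant_tb w Hw) as D. rewrite E, Cmod_0 in D.
    pose proof (Cmod_ge_0 (ta w)). pose proof (Cmod_ge_0 (tc w)). lra. }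
  assert (Hn : forall y, Cmod y = 1%R -> Re (rho y / - tb y) <> 0%R).
  { intros w Hw E. pose proof (Hb w Hw) as Nb. pose proof (dominant_tb w Hw) as D.
    destruct (rho_spec w ltac:(lra) (circle_not_slit w Hw)) as [_ [R _]].
    set (q := rho w / - tb w) in *.
    assert (Eq : q = Ci * RtoC (Im q)).
    { apply injective_projections.
      - change (Re q = 0 * Im q - 1 * 0)%R. rewrite E. ring.
      - change (Im q = 0 * 0 + 1 * Im q)%R. ring. }
    assert (Q : 4 * (ta w * tc w) = (tb w * tb w) * RtoC (1 + Im q * Im q)).
    { transitivity (tb w * tb w - tdisc w); [unfold tdisc; ring|]. rewrite <- R.
      replace (rho w) with (- (q * tb w)) by (unfold q; field; easy).
      transitivity (tb w * tb w * (1 - q * q)); [ring|]. f_equal.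
      rewrite RtoC_plus, RtoC_mult. set (t := Im q) in *. rewrite Eq.
      transitivity (1 - (Ci * Ci) * (t * t)); [ring|].
      replace (Ci * Ci) with (- RtoC 1) by (apply injective_projections; simpl; ring). ring. }
    apply (f_equal Cmod) in Q. rewrite !Cmod_mult, !Cmod_R in Q.
    rewrite (Rabs_right 4), (Rabs_right (1 + Im q * Im q)) in Q by nra.
    pose proof (Cmod_ge_0 (ta w)). pose proof (Cmod_ge_0 (tc w)).
    set (u := Cmod (ta w)) in *. set (v := Cmod (tc w)) in *. set (t := Cmod (tb w)) in *.
    assert (4 * (u * v) <= (u + v) * (u + v))%R by (pose proof (Rle_0_sqr (u - v)) as S; unfold Rsqr in S; lra).
    assert ((u + v) * (u + v) < t * t)%R by (apply Rmult_le_0_lt_compat; lra).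
    assert (0 <= t * t * (Im q * Im q))%R by (apply Rmult_le_pos; apply Rle_0_sqr).
    lra. }
  revert y. apply (circle_constant (fun y => (0 < Re (rho y / - tb y))%R)).
  - intros w Hw. destruct (rho_spec w ltac:(lra) (circle_not_slit w Hw)) as [R _].
    assert (L : lim (dist w) (fun y => rho y / - tb y) (rho w / - tb w)).
    { apply lim_mult; [exact R|]. apply lim_inv.
      - apply lim_opp, midquad_lim, cont_id.
      - intros E. apply (Hb w Hw). replace (tb w) with (- - tb w) by ring. rewrite E. ring. }
    destruct (Rtotal_order 0 (Re (rho w / - tb w))) as [P|[P|P]].
    + destruct (lim_Re_gt _ _ _ _ L P) as [r [Hr H]]. exists r. split; [easy|]. intros v Hv Hvw.
      split; [easy|]. intros _. now apply H.
    + exfalso. now apply (Hn w Hw).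
    + apply lim_opp in L.
      destruct (lim_Re_gt _ _ _ 0%R L) as [r [Hr H]].
      { change (Re (- (rho w / - tb w))) with (- Re (rho w / - tb w))%R. lra. }
      exists r. split; [easy|]. intros v Hv Hvw. specialize (H v Hvw).
      change (Re (- (rho v / - tb v))) with (- Re (rho v / - tb v))%R in H. lra.
  (* At y = 1 the sign is known: [rho] is positive there and [tb] equals c1 - 1 + a1 < 0. *)
  - destruct (slit_root_real tdisc y1 y2 g 1 ltac:(pose proof y1_lt_y2; lra) Hg ltac:(lra) Hy2) as [u [Hu E]].
    rewrite E, midquad_real, <- RtoC_opp, <- RtoC_div by lra. simpl.
    apply Rdiv_lt_0_compat; lra.
Qed.

(* [branch_defect (-1) x y = 0] and [branch_defect 1 x y = 0] say that [x] is [X_0 y], resp. [X_1 y]. *)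
Definition branch_defect (s : R) (x y : C) : C := 2 * ta y * x + tb y - s * rho y.

(** The product of the two defects is 4 ta K + (tdisc - rho^2), and both summands vanish. *)
Lemma branch_cases (s : R) (x y : C) : s = 1%R \/ s = (-1)%R -> (Cmod y <= 1)%R -> ~ slit y1 y2 y ->
  ker x y = 0 -> branch_defect s x y = 0 \/ branch_defect (- s) x y = 0.
Proof.
  intros Hs Hy Hn Hk. destruct (rho_spec y Hy Hn) as [_ [R _]].
  assert (E : branch_defect s x y * branch_defect (- s) x y = 0).
  { transitivity (4 * ta y * ker x y + (tdisc y - s * s * (rho y * rho y))).
    - unfold branch_defect. rewrite ker_swap, RtoC_opp. unfold tdisc. ring.
    - rewrite Hk, R. destruct Hs as [-> | ->]; rewrite ?RtoC_opp; ring. }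
  destruct (classic (branch_defect s x y = 0)) as [Z|Z]; [now left|]. right.
  destruct (classic (branch_defect (- s) x y = 0)) as [Z'|Z']; [easy|]. exfalso.
  now apply (Cmult_neq_0 _ _ Z Z').
Qed.

(** The two defects differ by 2 s rho, and [rho] has no zero in the closed disc off the slit. *)
Lemma branch_exclusive (s : R) (x y : C) : s = 1%R \/ s = (-1)%R -> (Cmod y <= 1)%R -> ~ slit y1 y2 y ->
  branch_defect s x y = 0 -> branch_defect (- s) x y <> 0.
Proof.
  intros Hs Hy Hn H H'. destruct (rho_spec y Hy Hn) as [_ [_ N]]. apply N.
  assert (Ns : RtoC s <> 0) by (intros E; apply RtoC_inj' in E; lra).
  replace (rho y) with ((branch_defect (- s) x y - branch_defect s x y) / (2 * s)).
  - rewrite H, H'. field. exact Ns.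
  - unfold branch_defect. rewrite RtoC_opp. field. exact Ns.
Qed.

Definition dist2 (x y : C) (p : C * C) : R := (Cmod (fst p - x) + Cmod (snd p - y))%R.

Lemma fst_lim (x y : C) : lim (dist2 x y) (@fst C C) x.
Proof.
  intros e He. exists e. split; [easy|]. intros p Hp. unfold dist2 in Hp.
  pose proof (Cmod_ge_0 (snd p - y)). lra.
Qed.
Lemma snd_lim (x y : C) : lim (dist2 x y) (@snd C C) y.
Proof.
  intros e He. exists e. split; [easy|]. intros p Hp. unfold dist2 in Hp.
  pose proof (Cmod_ge_0 (fst p - x)). lra.
Qed.

Lemma ev_dist2 (x0 y0 : C) (P : C * C -> Prop) : ev (dist2 x0 y0) P ->
  exists e, (0 < e)%R /\ forall x y : C, (Cmod (x - x0) < e)%R -> (Cmod (y - y0) < e)%R -> P (x, y).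
Proof.
  intros [r [Hr H]]. exists (r / 2)%R. split; [lra|]. intros x y Hx Hy. apply H.
  unfold dist2. simpl. lra.
Qed.

(** Lying on a branch is a closed condition. On the zero set of K it amounts to the other defect
    being nonzero, which is open; this is what makes the branches separately traceable. *)
Lemma branch_stable (s : R) (x0 y0 : C) : s = 1%R \/ s = (-1)%R -> (Cmod y0 <= 1)%R -> ~ slit y1 y2 y0 ->
  branch_defect s x0 y0 = 0 -> ev (dist2 x0 y0) (fun p => branch_defect (- s) (fst p) (snd p) <> 0).
Proof.
  intros Hs Hy Hn H. apply lim_neq with (l := branch_defect (- s) x0 y0); [|now apply branch_exclusive].
  destruct (rho_spec y0 Hy Hn) as [Rc _].
  pose proof (fst_lim x0 y0). pose proof (snd_lim x0 y0).
  unfold branch_defect. apply lim_minus; [apply lim_plus|].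
  - apply lim_mult; [|easy]. apply lim_mult; [apply lim_const|]. now apply quad_lim.
  - now apply midquad_lim.
  - apply lim_mult; [apply lim_const|]. now apply (lim_comp _ rho).
Qed.

(** With q = rho / -tb, the numbers -tb(1 + q) and -tb(1 - q) have moduli u > v because Re q > 0;
    their product is 4 ta tc and their sum is -2 tb. By [dominant_factor], u exceeds 2|ta| and
    2|tc|. Now 2 ta X_1 = -tb(1 + q), and X_0 times the same number is 2 tc. *)
Lemma circle_branch (s : R) (x y : C) : s = 1%R \/ s = (-1)%R -> Cmod y = 1%R -> ker x y = 0 ->
  branch_defect s x y = 0 -> (s = 1%R -> (1 < Cmod x)%R) /\ (s = (-1)%R -> (Cmod x < 1)%R).
Proof.
  intros Hs Hy Hk Ht.
  destruct (rho_spec y ltac:(lra) (circle_not_slit y Hy)) as [_ [R _]].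
  pose proof (circle_ratio_pos y Hy) as Hp. pose proof (dominant_tb y Hy) as D.
  assert (Nb : tb y <> 0).
  { intros E. rewrite E, Cmod_0 in D. pose proof (Cmod_ge_0 (ta y)). pose proof (Cmod_ge_0 (tc y)). lra. }
  set (P := - tb y) in *. set (q := rho y / P) in *.
  assert (NP : P <> 0).
  { unfold P. intros E. apply Nb. replace (tb y) with (- - tb y) by ring. rewrite E. ring. }
  assert (Er : rho y = q * P) by (unfold q; field; easy).
  set (u := Cmod (P * (1 + q))). set (v := Cmod (P * (1 - q))).
  assert (Hvu : (v < u)%R).
  { unfold u, v. rewrite !Cmod_mult. apply Rmult_lt_compat_l; [now apply Cmod_gt_0|].
    apply Rsqr_incrst_0; [|apply Cmod_ge_0|apply Cmod_ge_0]. unfold Rsqr. rewrite !Cmod_sqr.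
    change (Re (1 + q)) with (1 + Re q)%R. change (Re (1 - q)) with (1 + - Re q)%R.
    change (Im (1 + q)) with (0 + Im q)%R. change (Im (1 - q)) with (0 + - Im q)%R. nra. }
  assert (Euv : (u * v = (2 * Cmod (ta y)) * (2 * Cmod (tc y)))%R).
  { unfold u, v. rewrite <- Cmod_mult.
    replace (P * (1 + q) * (P * (1 - q))) with (4 * (ta y * tc y)).
    - rewrite !Cmod_mult, Cmod_R, Rabs_right by lra. ring.
    - transitivity (P * P - (q * P) * (q * P)); [|ring]. rewrite <- Er, R. unfold P, tdisc. ring. }
  assert (Hv0 : (0 <= v)%R) by apply Cmod_ge_0.
  assert (Hs2 : (2 * Cmod (ta y) + 2 * Cmod (tc y) < u + v)%R).
  { assert (T : (2 * Cmod P <= u + v)%R).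
    { pose proof (Cmod_triangle (P * (1 + q)) (P * (1 - q))) as T.
      replace (P * (1 + q) + P * (1 - q)) with (2 * P) in T by ring.
      rewrite Cmod_mult, Cmod_R, Rabs_right in T by lra. exact T. }
    unfold P in T. rewrite Cmod_opp in T. lra. }
  pose proof (Cmod_ge_0 (ta y)). pose proof (Cmod_ge_0 (tc y)).
  assert (N1 : (0 <= 2 * Cmod (ta y))%R) by lra. assert (N2 : (0 <= 2 * Cmod (tc y))%R) by lra.
  destruct (dominant_factor _ _ _ _ N1 N2 Hv0 Hvu Euv Hs2) as [D1 D2].
  pose proof (Cmod_ge_0 x).
  assert (M2 : Cmod 2 = 2%R) by (rewrite Cmod_R; apply Rabs_right; lra).
  split; intros ->.
  - assert (E : (2 * Cmod (ta y) * Cmod x = u)%R).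
    { transitivity (Cmod (2 * ta y * x)); [now rewrite !Cmod_mult, M2|]. unfold u. f_equal.
      transitivity (branch_defect 1 x y + P + rho y); [unfold branch_defect, P; ring|]. rewrite Ht, Er. ring. }
    nra.
  (* This form of the equation for X_0 avoids dividing by [ta], which may vanish. *)
  - assert (E : (Cmod x * u = 2 * Cmod (tc y))%R).
    { transitivity (Cmod (2 * tc y)); [|now rewrite Cmod_mult, M2].
      unfold u. rewrite <- Cmod_mult. f_equal.
      transitivity (branch_defect (-1) x y * x - 2 * ker x y + 2 * tc y).
      + rewrite ker_swap. unfold branch_defect. rewrite Er. unfold P. replace (RtoC (-1)) with (- RtoC 1) by (apply injective_projections; simpl; ring). ring.
      + rewrite Ht, Hk. ring. }
    nra.
Qed.

(** * Roots on a branch and their local constancy in x *)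

Definition branch_root (s : R) (x y : C) : Prop :=
  ker x y = 0 /\ (Cmod y < 1)%R /\ ~ slit y1 y2 y /\ branch_defect s x y = 0.
Definition off_curve (x : C) : Prop := forall t : R, (y1 <= t <= y2)%R -> ker x t <> 0.
(** The side of the unit circle where, by [circle_branch], no root on the given branch can have |y|
    = 1. *)
Definition region (s : R) (x : C) : Prop :=
  (s = 1%R /\ (Cmod x <= 1)%R) \/ (s = (-1)%R /\ (1 <= Cmod x)%R).
Definition has_branch_root (s : R) (x : C) : Prop := exists y, branch_root s x y.
(* Both roots, counted with multiplicity, on the branch [X_0]: nothing excludes this away from the
   component of [x1], and it has to be ruled out for the continuation to be well defined. *)
Definition two_branch_roots (x : C) : Prop :=
  exists y y', branch_root (-1) x y /\ branch_root (-1) x y' /\ a x * (y + y') + b x = 0.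

Lemma region_sign (s : R) (x : C) : region s x -> s = 1%R \/ s = (-1)%R.
Proof. unfold region. tauto. Qed.

Lemma off_curve_slit (x y : C) : off_curve x -> ker x y = 0 -> ~ slit y1 y2 y.
Proof. intros H Hk [t [Ht ->]]. now apply (H t). Qed.

Lemma off_curve_nondegenerate (x : C) : off_curve x -> a x <> 0 \/ b x <> 0 \/ c x <> 0.
Proof.
  intros H. destruct (classic (a x = 0)) as [A|A]; [|now left].
  destruct (classic (b x = 0)) as [B|B]; [|now right; left]. right; right. intros D.
  apply (H y1); [pose proof y1_lt_y2; lra|]. unfold ker. rewrite A, B, D. ring.
Qed.

Lemma branch_root_open (s : R) (x0 y0 : C) : s = 1%R \/ s = (-1)%R -> branch_root s x0 y0 ->
  exists e, (0 < e)%R /\ forall x y, (Cmod (x - x0) < e)%R -> (Cmod (y - y0) < e)%R ->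
    ker x y = 0 -> branch_root s x y.
Proof.
  intros Hs (Hk & Hy & Hn & Ht).
  destruct (ev_dist2 _ _ _ (branch_stable s x0 y0 Hs ltac:(lra) Hn Ht)) as [e1 [He1 T]].
  destruct (slit_closed y1 y2 y0 Hn) as [e2 [He2 S]].
  exists (Rmin (Rmin e1 e2) (1 - Cmod y0)). split; [repeat apply Rmin_pos; lra|].
  intros x y Hx Hyy Hk'.
  pose proof (Rmin_l (Rmin e1 e2) (1 - Cmod y0)). pose proof (Rmin_r (Rmin e1 e2) (1 - Cmod y0)).
  pose proof (Rmin_l e1 e2). pose proof (Rmin_r e1 e2).
  assert (Hy1 : (Cmod y < 1)%R).
  { pose proof (Cmod_diff y y0) as D. apply Rabs_le_between in D. lra. }
  assert (Hn' : ~ slit y1 y2 y) by (apply S; unfold dist; lra).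
  split; [easy|]. split; [easy|]. split; [easy|].
  destruct (branch_cases s x y Hs ltac:(lra) Hn' Hk') as [Z|Z]; [easy|].
  exfalso. apply (T x y); simpl; [lra|lra|exact Z].
Qed.

(** A candidate limit [r] that fails to be a root on the branch has modulus greater than 1, or lies
    on the other branch, or lies on this branch with |r| = 1; [region] rules out the last case, and
    the other two are open. *)
Lemma branch_root_closed (s : R) (x0 r : C) : off_curve x0 -> region s x0 ->
  (ker x0 r = 0 \/ (1 < Cmod r)%R) -> ~ branch_root s x0 r ->
  exists e, (0 < e)%R /\ forall x y, (Cmod (x - x0) < e)%R -> (Cmod (y - r) < e)%R -> ~ branch_root s x y.
Proof.
  intros Ho Hr Hroot Hnot. pose proof (region_sign s x0 Hr) as Hs.
  destruct (Rlt_dec 1 (Cmod r)) as [L|L].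
  { exists (Cmod r - 1)%R. split; [lra|]. intros x y _ Hy (_ & Hy1 & _).
    pose proof (Cmod_diff y r) as D. apply Rabs_le_between in D. lra. }
  assert (Hk : ker x0 r = 0) by (destruct Hroot; [easy|lra]).
  pose proof (off_curve_slit x0 r Ho Hk) as Hn.
  destruct (branch_cases s x0 r Hs ltac:(lra) Hn Hk) as [Z|Z].
  - exfalso. apply Hnot. split; [easy|]. split; [|now split].
    destruct (Req_dec (Cmod r) 1) as [E|E]; [|lra]. exfalso.
    destruct (circle_branch s x0 r Hs E Hk Z) as [D1 D2].
    destruct Hr as [[-> Hx]|[-> Hx]]; [specialize (D1 eq_refl)|specialize (D2 eq_refl)]; lra.
  - assert (Hs' : (- s = 1 \/ - s = -1)%R) by (destruct Hs; lra).
    destruct (ev_dist2 _ _ _ (branch_stable (- s) x0 r Hs' ltac:(lra) Hn Z)) as [e [He T]].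
    exists e. split; [easy|]. intros x y Hx Hy (_ & _ & _ & Z').
    apply (T x y Hx Hy). simpl. now rewrite Ropp_involutive.
Qed.

Lemma a_lim (x : C) : lim (dist x) (fun w => a w) (a x).
Proof. apply quad_lim, cont_id. Qed.
Lemma b_lim (x : C) : lim (dist x) (fun w => b w) (b x).
Proof. apply midquad_lim, cont_id. Qed.
Lemma c_lim (x : C) : lim (dist x) (fun w => c w) (c x).
Proof. apply quad_lim, cont_id. Qed.

Lemma leading_nonzero (x y : C) : off_curve x -> ker x y = 0 -> a x <> 0 \/ b x <> 0.
Proof.
  intros Ho Hk. destruct (off_curve_nondegenerate x Ho) as [N|[N|N]]; [now left|now right|].
  destruct (classic (a x = 0)) as [A|A]; [|now left]. right. intros B. apply N.
  rewrite <- Hk. unfold ker. rewrite A, B. ring.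
Qed.

(** If the property holds at [x0], a nearby root persists on the same branch. If it fails, any root
    in the disc for nearby x is close to [r] or [r'], and neither can be approached along the
    branch. *)
Lemma has_branch_root_locally_constant (s : R) (x0 : C) : off_curve x0 -> region s x0 ->
  ev (dist x0) (fun x => has_branch_root s x <-> has_branch_root s x0).
Proof.
  intros Ho Hr. pose proof (region_sign s x0 Hr) as Hs.
  destruct (classic (has_branch_root s x0)) as [[y0 H]|H].
  - destruct (branch_root_open s x0 y0 Hs H) as [e [He O]]. destruct H as [Hk H].
    pose proof (root_persists (dist x0) _ _ _ _ _ _ y0 (a_lim x0) (b_lim x0) (c_lim x0)
      Hk (leading_nonzero x0 y0 Ho Hk) e He) as P.
    apply ev_imp with (1 := ev_and _ _ _ P (ex_intro _ e (conj He (fun a h => h)))).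
    intros x [[y [Hy Hyy]] Hx]. split; intros _; [exists y0; now split|].
    exists y. now apply O.
  - destruct (roots_localised (dist x0) _ _ _ _ _ _ (a_lim x0) (b_lim x0) (c_lim x0)
      (off_curve_nondegenerate x0 Ho)) as (r & r' & Hr1 & Hr2 & Hloc).
    destruct (branch_root_closed s x0 r Ho Hr Hr1) as [e [He O]]; [intros F; apply H; now exists r|].
    destruct (branch_root_closed s x0 r' Ho Hr Hr2) as [e' [He' O']]; [intros F; apply H; now exists r'|].
    assert (Hm : (0 < Rmin e e')%R) by now apply Rmin_pos.
    apply ev_imp with (1 := ev_and _ _ _ (Hloc _ Hm) (ex_intro _ _ (conj Hm (fun a h => h)))).
    intros x [L Hx]. unfold dist in Hx. split; [|easy]. intros [y Hy]. exfalso.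
    pose proof (Rmin_l e e'). pose proof (Rmin_r e e').
    destruct (L y) as [D|D]; [apply Hy|left; apply Hy| |].
    + apply (O x y); [lra|lra|easy].
    + apply (O' x y); [lra|lra|easy].
Qed.

Lemma pair_closed (x0 r r' : C) : off_curve x0 -> (1 <= Cmod x0)%R ->
  (ker x0 r = 0 \/ (1 < Cmod r)%R) -> (ker x0 r' = 0 \/ (1 < Cmod r')%R) -> ~ two_branch_roots x0 ->
  exists e, (0 < e)%R /\ forall x y y', (Cmod (x - x0) < e)%R -> (Cmod (y - r) < e)%R ->
    (Cmod (y' - r') < e)%R -> branch_root (-1) x y -> branch_root (-1) x y' -> a x * (y + y') + b x <> 0.
Proof.
  intros Ho Hx Hr Hr' Hnot.
  assert (Hreg : region (-1) x0) by now right.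
  destruct (classic (branch_root (-1) x0 r)) as [Z|Z].
  2:{ destruct (branch_root_closed _ x0 r Ho Hreg Hr Z) as [e [He O]]. exists e. split; [easy|].
      intros x y y' H1 H2 _ H3. exfalso. now apply (O x y). }
  destruct (classic (branch_root (-1) x0 r')) as [Z'|Z'].
  2:{ destruct (branch_root_closed _ x0 r' Ho Hreg Hr' Z') as [e [He O]]. exists e. split; [easy|].
      intros x y y' H1 _ H2 _ H3. exfalso. now apply (O x y'). }
  set (m := fun p : C * C * C => (dist2 x0 r (fst p) + Cmod (snd p - r'))%R).
  assert (L1 : lim m (fun p => fst (fst p)) x0).
  { intros e He. exists e. split; [easy|]. intros p Hp. unfold m, dist2 in Hp.
    pose proof (Cmod_ge_0 (snd p - r')). pose proof (Cmod_ge_0 (snd (fst p) - r)). lra. }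
  assert (L2 : lim m (fun p => snd (fst p)) r).
  { intros e He. exists e. split; [easy|]. intros p Hp. unfold m, dist2 in Hp.
    pose proof (Cmod_ge_0 (snd p - r')). pose proof (Cmod_ge_0 (fst (fst p) - x0)). lra. }
  assert (L3 : lim m (fun p => snd p) r').
  { intros e He. exists e. split; [easy|]. intros p Hp. unfold m, dist2 in Hp.
    pose proof (Cmod_ge_0 (fst (fst p) - x0)). pose proof (Cmod_ge_0 (snd (fst p) - r)). lra. }
  destruct (lim_neq m (fun p => a (fst (fst p)) * (snd (fst p) + snd p) + b (fst (fst p)))
    (a x0 * (r + r') + b x0) 0) as [e [He O]].
  - apply lim_plus; [apply lim_mult|]; [now apply quad_lim|now apply lim_plus|now apply midquad_lim].
  - intros E. apply Hnot. now exists r, r'.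
  - exists (e / 3)%R. split; [lra|]. intros x y y' H1 H2 H3 _ _.
    apply (O (x, y, y')). unfold m, dist2. simpl. lra.
Qed.

Lemma two_branch_roots_locally_constant (x0 : C) : off_curve x0 -> (1 <= Cmod x0)%R ->
  ev (dist x0) (fun x => two_branch_roots x <-> two_branch_roots x0).
Proof.
  intros Ho Hx. destruct (classic (two_branch_roots x0)) as [H|H].
  - destruct H as (y0 & y0' & H1 & H2 & Hsum0).
    destruct (branch_root_open (-1) x0 y0 (or_intror eq_refl) H1) as [e [He O]].
    destruct (branch_root_open (-1) x0 y0' (or_intror eq_refl) H2) as [e' [He' O']].
    pose proof (proj1 H1) as Hk.
    assert (Na : a x0 <> 0).
    { intros A. destruct (leading_nonzero x0 y0 Ho Hk) as [N|N]; [easy|]. apply N.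
      rewrite <- Hsum0, A. ring. }
    (* The second root is followed as -b/a - y and not by a second use of persistence, which for a
       double root could return the same root twice. *)
    assert (L : lim (dist2 x0 y0) (fun p => - b (fst p) / a (fst p) - snd p) (- b x0 / a x0 - y0)).
    { pose proof (fst_lim x0 y0). pose proof (snd_lim x0 y0).
      apply lim_minus; [apply lim_mult|easy]; [now apply lim_opp, midquad_lim|].
      apply lim_inv; [now apply quad_lim|easy]. }
    assert (Ey : - b x0 / a x0 - y0 = y0').
    { transitivity (y0' - (a x0 * (y0 + y0') + b x0) / a x0); [field; easy|].
      rewrite Hsum0. field. easy. }
    rewrite Ey in L.
    destruct (ev_dist2 _ _ _ (L e' He')) as [e2 [He2 L2]]. simpl in L2.
    assert (Hm : (0 < Rmin (Rmin e e') e2)%R) by (repeat apply Rmin_pos; easy).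
    pose proof (Rmin_l (Rmin e e') e2). pose proof (Rmin_r (Rmin e e') e2).
    pose proof (Rmin_l e e'). pose proof (Rmin_r e e').
    pose proof (root_persists (dist x0) _ _ _ _ _ _ y0 (a_lim x0) (b_lim x0) (c_lim x0)
      Hk (leading_nonzero x0 y0 Ho Hk) _ Hm) as P.
    apply ev_imp with (1 := ev_and _ _ _ P (ev_and _ _ _ (ex_intro _ _ (conj Hm (fun a h => h)))
      (lim_neq _ _ _ _ (a_lim x0) Na))).
    intros x [[y [Hy Hyy]] [Hxx Nax]]. unfold dist in Hxx. split; intros _; [now exists y0, y0'|].
    assert (Es : a x * (y + (- b x / a x - y)) + b x = 0) by (field; easy).
    exists y, (- b x / a x - y). split; [|split; [|exact Es]].
    + apply O; [lra|lra|exact Hy].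
    + apply O'; [lra| |].
      * apply L2; lra.
      * unfold ker. rewrite <- Hy. field. easy.
  - destruct (roots_localised (dist x0) _ _ _ _ _ _ (a_lim x0) (b_lim x0) (c_lim x0)
      (off_curve_nondegenerate x0 Ho)) as (r & r' & Hr1 & Hr2 & Hloc).
    (* The two roots may gather at the same limit point or at different ones, in either order. *)
    destruct (pair_closed x0 r r Ho Hx Hr1 Hr1 H) as [e1 [He1 O1]].
    destruct (pair_closed x0 r r' Ho Hx Hr1 Hr2 H) as [e2 [He2 O2]].
    destruct (pair_closed x0 r' r Ho Hx Hr2 Hr1 H) as [e3 [He3 O3]].
    destruct (pair_closed x0 r' r' Ho Hx Hr2 Hr2 H) as [e4 [He4 O4]].
    set (e := Rmin (Rmin e1 e2) (Rmin e3 e4)).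
    assert (Hm : (0 < e)%R) by (repeat apply Rmin_pos; easy).
    assert (Hmin : (e <= e1 /\ e <= e2 /\ e <= e3 /\ e <= e4)%R).
    { unfold e. pose proof (Rmin_l (Rmin e1 e2) (Rmin e3 e4)). pose proof (Rmin_r (Rmin e1 e2) (Rmin e3 e4)).
      pose proof (Rmin_l e1 e2). pose proof (Rmin_r e1 e2). pose proof (Rmin_l e3 e4). pose proof (Rmin_r e3 e4). lra. }
    apply ev_imp with (1 := ev_and _ _ _ (Hloc _ Hm) (ex_intro _ _ (conj Hm (fun a h => h)))).
    intros x [L Hxx]. unfold dist in Hxx. split; [|easy]. intros (y & y' & Hy & Hy' & E). exfalso.
    assert (D : forall w, branch_root (-1) x w -> (Cmod (w - r) < e)%R \/ (Cmod (w - r') < e)%R).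
    { intros w Hw. apply L; [apply Hw|left; apply Hw]. }
    destruct (D y Hy) as [D1|D1], (D y' Hy') as [D2|D2].
    + apply (O1 x y y'); try easy; lra.
    + apply (O2 x y y'); try easy; lra.
    + apply (O3 x y y'); try easy; lra.
    + apply (O4 x y y'); try easy; lra.
Qed.

(** Each clause speaks only on the side of the unit circle where it is locally constant. On the
    circle itself both apply, and [admissible_circle] shows that they agree. *)
Definition admissible (x : C) : Prop :=
  ((Cmod x <= 1)%R -> ~ has_branch_root 1 x) /\ ((1 <= Cmod x)%R -> has_branch_root (-1) x /\ ~ two_branch_roots x).

(** On |x| = 1 the dominance of [b] leaves exactly one root y in the open disc, and off the curve
    this root lies on exactly one branch. *)
Lemma admissible_circle (x : C) : off_curve x -> Cmod x = 1%R ->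
  ~ two_branch_roots x /\ (has_branch_root 1 x <-> ~ has_branch_root (-1) x).
Proof.
  intros Ho Hx. pose proof (dominant_b x Hx) as D. split; [|split].
  - intros (y & y' & (Hk & Hy & _) & (_ & Hy' & _) & E).
    apply (two_in_disc _ _ _ y y' D E Hk); lra.
  - intros [y (Hk & Hy & Hn & Ht)] [y' (Hk' & Hy' & Hn' & Ht')].
    assert (N : y - y' <> 0).
    { apply Cminus_neq_0. intros <-. apply (branch_exclusive 1 x y); auto; lra. }
    apply (two_in_disc _ _ _ y y' D); [|exact Hk|lra|lra].
    replace (a x * (y + y') + b x) with ((ker x y - ker x y') / (y - y')).
    + rewrite Hk, Hk'. field. easy.
    + unfold ker. field. easy.
  - intros H. destruct (one_in_disc _ _ _ D) as [y [Hk Hy]].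
    pose proof (off_curve_slit x y Ho Hk) as Hn.
    destruct (branch_cases 1 x y (or_introl eq_refl) ltac:(lra) Hn Hk) as [Z|Z].
    + exists y. now repeat split.
    + exfalso. apply H. exists y. now repeat split.
Qed.

Lemma admissible_locally_constant (x0 : C) : off_curve x0 ->
  ev (dist x0) (fun x => admissible x <-> admissible x0).
Proof.
  intros Ho. destruct (Rtotal_order (Cmod x0) 1) as [L|[L|L]].
  - assert (R1 : region 1 x0) by (left; split; [easy|lra]).
    apply ev_imp with (1 := ev_and _ _ _ (has_branch_root_locally_constant 1 x0 Ho R1)
      (lim_Cmod_lt _ _ _ 1%R (cont_id x0) L)).
    intros x [H1 H2]. unfold admissible. split; intros [G1 _].
    + split; [intros _; rewrite <- H1; apply G1; lra|lra].
    + split; [intros _; rewrite H1; apply G1; lra|lra].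
  - assert (R1 : region 1 x0) by (left; split; [easy|lra]).
    assert (R2 : region (-1) x0) by (right; split; [easy|lra]).
    destruct (admissible_circle x0 Ho L) as [N X].
    apply ev_imp with (1 := ev_and _ _ _ (has_branch_root_locally_constant 1 x0 Ho R1)
      (ev_and _ _ _ (has_branch_root_locally_constant (-1) x0 Ho R2) (two_branch_roots_locally_constant x0 Ho ltac:(lra)))).
    intros x [H1 [H2 H3]]. unfold admissible. rewrite H1, H2, H3. split; [|intros G].
    + intros [G1 G2]. destruct (Rle_dec (Cmod x) 1) as [D|D].
      * specialize (G1 D). split; tauto.
      * destruct G2 as [G2 _]; [lra|]. split; tauto.
    + destruct G as [G1 G2]. specialize (G1 ltac:(lra)). specialize (G2 ltac:(lra)). tauto.
  - assert (R2 : region (-1) x0) by (right; split; [easy|lra]).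
    apply ev_imp with (1 := ev_and _ _ _ (has_branch_root_locally_constant (-1) x0 Ho R2)
      (ev_and _ _ _ (two_branch_roots_locally_constant x0 Ho ltac:(lra)) (lim_Cmod_gt _ _ _ 1%R (cont_id x0) L))).
    intros x [H1 [H2 H3]]. unfold admissible. rewrite H1, H2. split; intros [_ G].
    + split; [lra|]. intros _. apply G. lra.
    + split; [lra|]. intros _. apply G. lra.
Qed.

(** * The real kernel, convexity, and the starting point x1 *)

Context (gx : C -> C) (Hx12 : (Rabs x1 < x2)%R) (Hx2 : (x2 < 1)%R) (Hgx : outer_root disc x1 x2 gx).

Definition kerR (x y : R) : R :=
  ((a0 + a1 * x + a2 * (x * x)) * (y * y) + (b0 - x + b2 * (x * x)) * y + (c0 + c1 * x + c2 * (x * x)))%R.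

Lemma ker_real (x y : R) : ker x y = RtoC (kerR x y).
Proof.
  unfold ker, kerR. rewrite !quad_real, midquad_real, <- !RtoC_mult, <- !RtoC_plus. f_equal. ring.
Qed.

Definition discR (x : R) : R :=
  ((b0 - x + b2 * (x * x)) * (b0 - x + b2 * (x * x)) -
   4 * ((a0 + a1 * x + a2 * (x * x)) * (c0 + c1 * x + c2 * (x * x))))%R.
Definition tdiscR (y : R) : R :=
  ((c1 - y + a1 * (y * y)) * (c1 - y + a1 * (y * y)) -
   4 * ((c2 + b2 * y + a2 * (y * y)) * (c0 + b0 * y + a0 * (y * y))))%R.

Lemma disc_real (x : R) : disc x = RtoC (discR x).
Proof.
  unfold disc, discR. now rewrite !quad_real, midquad_real, <- !RtoC_mult, <- RtoC_minus.
Qed.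
Lemma tdisc_real (y : R) : tdisc y = RtoC (tdiscR y).
Proof.
  unfold tdisc, tdiscR. now rewrite !quad_real, midquad_real, <- !RtoC_mult, <- RtoC_minus.
Qed.

Lemma outer_root_sign (p : C -> C) (pR : R -> R) (r1 r2 : R) (f : C -> C) :
  (forall t : R, p t = RtoC (pR t)) -> outer_root p r1 r2 f ->
  forall t : R, (-1 <= t <= 1)%R -> exists u : R, (0 < u)%R /\ (pR t = (t - r1) * (t - r2) * u)%R.
Proof.
  intros Hp [H1 H2] t Ht. destruct (H2 t Ht) as [u [Hu E]]. exists (u * u)%R.
  split; [now apply Rmult_lt_0_compat|]. apply RtoC_inj'. rewrite <- Hp.
  destruct (H1 (RtoC t)) as [_ [F _]]; [rewrite Cmod_R; apply Rabs_le; lra|].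
  rewrite F, E. now rewrite !RtoC_mult, !RtoC_minus.
Qed.

(** The tangent line of exp at st, evaluated at t and at 0 and averaged with weights s and 1 - s. *)
Lemma exp_chord (s t : R) : (0 <= s <= 1)%R -> (exp (s * t) <= s * exp t + (1 - s))%R.
Proof.
  intros Hs. pose proof (exp_ineq1_le ((1 - s) * t)) as H1. pose proof (exp_ineq1_le (- (s * t))) as H2.
  pose proof (exp_pos (s * t)) as Hp.
  assert (E1 : exp t = (exp (s * t) * exp ((1 - s) * t))%R) by (rewrite <- exp_plus; f_equal; ring).
  assert (E2 : (1 = exp (s * t) * exp (- (s * t)))%R).
  { rewrite <- exp_plus. replace (s * t + - (s * t))%R with 0%R by ring. now rewrite exp_0. }
  set (X := exp (s * t)) in *. set (Y := exp ((1 - s) * t)) in *. set (Z := exp (- (s * t))) in *.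
  assert (A1 : (X * (1 + (1 - s) * t) <= X * Y)%R) by (apply Rmult_le_compat_l; lra).
  assert (A2 : (X * (1 + - (s * t)) <= X * Z)%R) by (apply Rmult_le_compat_l; lra).
  rewrite E1. nra.
Qed.

(** The function z * sum x^i y^j in logarithmic coordinates, where it is convex. By [kerR_exp], on
    positive x and y the kernel is negative exactly where this function is less than 1. *)
Definition laurent (l m : R) : R :=
  (a0 * exp (- l + m) + a1 * exp m + a2 * exp (l + m) + b0 * exp (- l) + b2 * exp l
   + c0 * exp (- l - m) + c1 * exp (- m) + c2 * exp (l - m))%R.

Lemma kerR_exp (l m : R) : kerR (exp l) (exp m) = (exp l * exp m * (laurent l m - 1))%R.
Proof.
  unfold kerR, laurent. unfold Rminus. rewrite !exp_plus, !exp_Ropp.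
  pose proof (exp_pos l). pose proof (exp_pos m). field. split; lra.
Qed.

(* Log-convexity along the segment from [(0, 0)], where [laurent] is [< 1], to [(l, m)]. *)
Lemma laurent_chord (s l m : R) : (0 < s < 1)%R -> laurent l m = 1%R -> (laurent (s * l) (s * m) < 1)%R.
Proof.
  intros Hs. unfold laurent. intros H1.
  pose proof (exp_chord s (- l + m) ltac:(lra)). pose proof (exp_chord s m ltac:(lra)).
  pose proof (exp_chord s (l + m) ltac:(lra)). pose proof (exp_chord s (- l) ltac:(lra)).
  pose proof (exp_chord s l ltac:(lra)). pose proof (exp_chord s (- l - m) ltac:(lra)).
  pose proof (exp_chord s (- m) ltac:(lra)). pose proof (exp_chord s (l - m) ltac:(lra)).
  replace (- (s * l) + s * m)%R with (s * (- l + m))%R by ring.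
  replace (s * l + s * m)%R with (s * (l + m))%R by ring.
  replace (- (s * l))%R with (s * (- l))%R by ring.
  replace (s * - l - s * m)%R with (s * (- l - m))%R by ring.
  replace (- (s * m))%R with (s * (- m))%R by ring.
  replace (s * l - s * m)%R with (s * (l - m))%R by ring.
  apply Rle_lt_trans with (s * (a0 * exp (- l + m) + a1 * exp m + a2 * exp (l + m) + b0 * exp (- l) + b2 * exp l
   + c0 * exp (- l - m) + c1 * exp (- m) + c2 * exp (l - m)) + (1 - s) * (a0 + a1 + a2 + b0 + b2 + c0 + c1 + c2))%R.
  - assert (M : forall k u v, (0 <= k)%R -> (u <= v)%R -> (k * u <= k * v)%R)
      by (intros; now apply Rmult_le_compat_l).
    pose proof (M a0 _ _ Pa0 H). pose proof (M a1 _ _ Pa1 H0). pose proof (M a2 _ _ Pa2 H2).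
    pose proof (M b0 _ _ Pb0 H3). pose proof (M b2 _ _ Pb2 H4). pose proof (M c0 _ _ Pc0 H5).
    pose proof (M c1 _ _ Pc1 H6). pose proof (M c2 _ _ Pc2 H7). lra.
  - rewrite H1. nra.
Qed.

(** The two equations say that both partial derivatives of [laurent] vanish, so by convexity the
    value 1 would be its minimum; but at (0, 0) it equals the sum of the weights, which is less than
    1. The inequality exp t (1 - t) <= 1, weighted and summed over the steps, makes this
    explicit. *)
Lemma laurent_not_critical (l m : R) : laurent l m = 1%R ->
  ((c2 + b2 * exp m + a2 * (exp m * exp m)) * (exp l * exp l) = c0 + b0 * exp m + a0 * (exp m * exp m))%R ->
  ((a0 + a1 * exp l + a2 * (exp l * exp l)) * (exp m * exp m) = c0 + c1 * exp l + c2 * (exp l * exp l))%R ->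
  False.
Proof.
  intros H1 Hx Hy. pose proof (exp_pos l) as Pl. pose proof (exp_pos m) as Pm.
  assert (T : forall t, (exp t * (1 - t) <= 1)%R).
  { intros t. pose proof (exp_ineq1_le (- t)) as I. pose proof (exp_pos t) as P.
    assert (E : (exp t * exp (- t) = 1)%R).
    { rewrite <- exp_plus. replace (t + - t)%R with 0%R by ring. apply exp_0. }
    rewrite <- E. apply Rmult_le_compat_l; lra. }
  assert (Ex : (c2 * exp (l - m) + b2 * exp l + a2 * exp (l + m) = c0 * exp (- l - m) + b0 * exp (- l) + a0 * exp (- l + m))%R).
  { apply Rmult_eq_reg_r with (exp l * exp m)%R; [|nra].
    unfold Rminus. rewrite !exp_plus, !exp_Ropp.
    transitivity ((c2 + b2 * exp m + a2 * (exp m * exp m)) * (exp l * exp l))%R; [field; lra|].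
    rewrite Hx. field. lra. }
  assert (Ey : (a0 * exp (- l + m) + a1 * exp m + a2 * exp (l + m) = c0 * exp (- l - m) + c1 * exp (- m) + c2 * exp (l - m))%R).
  { apply Rmult_eq_reg_r with (exp l * exp m)%R; [|nra].
    unfold Rminus. rewrite !exp_plus, !exp_Ropp.
    transitivity ((a0 + a1 * exp l + a2 * (exp l * exp l)) * (exp m * exp m))%R; [field; lra|].
    rewrite Hy. field. lra. }
  assert (M : forall k t, (0 <= k)%R -> (k * (exp t * (1 - t)) <= k)%R).
  { intros k t Hk. rewrite <- (Rmult_1_r k) at 2. now apply Rmult_le_compat_l. }
  unfold laurent in H1.
  pose proof (M a0 (- l + m)%R Pa0). pose proof (M a1 m Pa1). pose proof (M a2 (l + m)%R Pa2).
  pose proof (M b0 (- l)%R Pb0). pose proof (M b2 l Pb2). pose proof (M c0 (- l - m)%R Pc0).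
  pose proof (M c1 (- m)%R Pc1). pose proof (M c2 (l - m)%R Pc2).
  (* Combining l times one critical equation with m times the other cancels all the terms t exp
     t. *)
  apply (f_equal (Rmult l)) in Ex. apply (f_equal (Rmult m)) in Ey. lra.
Qed.

Lemma disc_at_x2 : discR x2 = 0%R.
Proof.
  destruct (outer_root_sign disc discR x1 x2 gx disc_real Hgx x2) as [u [_ E]].
  - pose proof (Rabs_pos x1). lra.
  - rewrite E. ring.
Qed.

Lemma disc_neg (t : R) : (x1 < t < x2)%R -> (discR t < 0)%R.
Proof.
  intros Ht. apply Rabs_def2 in Hx12 as Hx.
  destruct (outer_root_sign disc discR x1 x2 gx disc_real Hgx t) as [u [Hu E]]; [lra|].
  assert (0 < (t - x1) * (x2 - t) * u)%R by (repeat apply Rmult_lt_0_compat; lra). lra.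
Qed.

Lemma disc_pos (t : R) : (x2 < t <= 1)%R -> (0 < discR t)%R.
Proof.
  intros Ht. pose proof (Rabs_pos x1). apply Rabs_def2 in Hx12 as Hx.
  destruct (outer_root_sign disc discR x1 x2 gx disc_real Hgx t) as [u [Hu E]]; [lra|].
  rewrite E. repeat apply Rmult_lt_0_compat; lra.
Qed.

Lemma quad_pos (p q r t : R) : (0 <= p)%R -> (0 <= q)%R -> (0 <= r)%R -> (0 < p + q + r)%R ->
  (0 < t)%R -> (0 < p + q * t + r * (t * t))%R.
Proof.
  intros Hp Hq Hr Hs Ht. assert (0 < t * t)%R by now apply Rmult_lt_0_compat.
  destruct (Rlt_dec 0 p); [nra|]. destruct (Rlt_dec 0 q); [nra|]. nra.
Qed.

Lemma x2_pos : (0 < x2)%R.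
Proof. pose proof (Rabs_pos x1). lra. Qed.

(* On [(x2, 1]] the discriminant [b^2 - 4 a c] is positive while [a c > 0], so [b] keeps the
   negative sign that it has at 1. *)
Lemma b_at_x2 : (b0 - x2 + b2 * (x2 * x2) < 0)%R.
Proof.
  pose proof x2_pos as Hp.
  pose proof (quad_pos a0 a1 a2 x2 Pa0 Pa1 Pa2 Ha Hp) as Qa.
  pose proof (quad_pos c0 c1 c2 x2 Pc0 Pc1 Pc2 Hc Hp) as Qc.
  pose proof disc_at_x2 as E. unfold discR in E.
  apply Rnot_le_lt. intros N.
  set (f := fun t : R => (b0 - t + b2 * (t * t))%R) in *. change (0 <= f x2)%R in N. fold (f x2) in E.
  assert (N' : (0 < f x2)%R).
  { destruct N as [N|N]; [easy|]. rewrite <- N in E.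
    assert (0 < (a0 + a1 * x2 + a2 * (x2 * x2)) * (c0 + c1 * x2 + c2 * (x2 * x2)))%R
      by now apply Rmult_lt_0_compat. lra. }
  destruct (IVT_cor (fun t => - f t)%R x2 1) as [w [Hw Ew]].
  - intros t. unfold f. reg.
  - lra.
  - assert (f 1%R < 0)%R by (unfold f; lra). nra.
  - destruct (Req_dec w x2) as [->|Nw]; [lra|].
    pose proof (disc_pos w ltac:(lra)) as D. unfold discR in D. fold (f w) in D.
    pose proof (quad_pos a0 a1 a2 w Pa0 Pa1 Pa2 Ha ltac:(lra)) as Qa'.
    pose proof (quad_pos c0 c1 c2 w Pc0 Pc1 Pc2 Hc ltac:(lra)) as Qc'.
    assert (f w = 0)%R as F by lra. rewrite F in D. nra.
Qed.

(** The discriminant vanishes at [x2], so the root is double and equal to -b/(2a); it is positive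
    since [b] is negative there. *)
Lemma root_at_x2 (y : C) : ker x2 y = 0 -> exists u : R, (0 < u)%R /\ y = RtoC u /\
  kerR x2 u = 0%R /\ (2 * (a0 + a1 * x2 + a2 * (x2 * x2)) * u + (b0 - x2 + b2 * (x2 * x2)) = 0)%R.
Proof.
  intros Hk. pose proof b_at_x2 as Hb.
  pose proof (quad_pos a0 a1 a2 x2 Pa0 Pa1 Pa2 Ha x2_pos) as Qa.
  set (A := (a0 + a1 * x2 + a2 * (x2 * x2))%R) in *. set (B := (b0 - x2 + b2 * (x2 * x2))%R) in *.
  assert (NA : RtoC A <> 0) by (intros E; apply RtoC_inj' in E; lra).
  assert (E : (2 * A * y + B) * (2 * A * y + B) = 0).
  { transitivity (4 * a x2 * ker x2 y + disc x2).
    - unfold ker, disc. rewrite !quad_real, midquad_real. fold A B. ring.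
    - rewrite Hk, disc_real, disc_at_x2. ring. }
  assert (E' : 2 * A * y + B = 0).
  { destruct (classic (2 * A * y + B = 0)) as [Z|Z]; [easy|]. exfalso. now apply (Cmult_neq_0 _ _ Z Z). }
  assert (Ey : y = RtoC (- B / (2 * A))).
  { rewrite RtoC_div, RtoC_opp, RtoC_mult by lra.
    transitivity (((2 * A * y + B) - B) / (2 * A)); [field; easy|]. rewrite E'. field. easy. }
  exists (- B / (2 * A))%R. split; [|split; [exact Ey|split]].
  - apply Rdiv_lt_0_compat; lra.
  - apply RtoC_inj'. now rewrite <- ker_real, <- Ey.
  - field. lra.
Qed.

Lemma tdisc_neg (t : R) : (y1 < t < y2)%R -> (tdiscR t < 0)%R.
Proof.
  intros Ht. apply Rabs_def2 in Hy12 as Hy.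
  destruct (outer_root_sign tdisc tdiscR y1 y2 g tdisc_real Hg t) as [u [Hu E]]; [lra|].
  assert (0 < (t - y1) * (y2 - t) * u)%R by (repeat apply Rmult_lt_0_compat; lra). lra.
Qed.

Lemma kerR_swap (x y : R) : kerR x y =
  ((c2 + b2 * y + a2 * (y * y)) * (x * x) + (c1 - y + a1 * (y * y)) * x + (c0 + b0 * y + a0 * (y * y)))%R.
Proof. unfold kerR. ring. Qed.

(** If the double root u lay on the slit, tdisc(u) <= 0 would make [x2] a double root in x as well,
    and (x2, u) would be a critical point of [laurent] at level 1. *)
Lemma x2_off_curve : off_curve x2.
Proof.
  intros t Ht Hk. destruct (root_at_x2 _ Hk) as (u & Hu & Eu & Ku & Du). apply RtoC_inj' in Eu. subst t.
  assert (Pu : (-1 <= u <= 1)%R) by lra.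
  destruct (outer_root_sign tdisc tdiscR y1 y2 g tdisc_real Hg u Pu) as [w [Hw E]].
  assert (Nd : (tdiscR u <= 0)%R).
  { assert (0 <= (u - y1) * (y2 - u) * w)%R by (repeat apply Rmult_le_pos; lra). lra. }
  pose proof Ku as Ku'. rewrite kerR_swap in Ku'. unfold tdiscR in Nd.
  set (TA := (c2 + b2 * u + a2 * (u * u))%R) in *. set (TB := (c1 - u + a1 * (u * u))%R) in *.
  set (TC := (c0 + b0 * u + a0 * (u * u))%R) in *.
  assert (Sq : ((2 * TA * x2 + TB) * (2 * TA * x2 + TB) <= 0)%R).
  { replace ((2 * TA * x2 + TB) * (2 * TA * x2 + TB))%R with
      (4 * TA * (TA * (x2 * x2) + TB * x2 + TC) + (TB * TB - 4 * (TA * TC)))%R by ring.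
    rewrite Ku'. lra. }
  assert (Z : (2 * TA * x2 + TB = 0)%R) by nra.
  pose proof x2_pos as Hx.
  apply (laurent_not_critical (ln x2) (ln u)).
  - pose proof (kerR_exp (ln x2) (ln u)) as F. rewrite !exp_ln, Ku in F by easy.
    assert (0 < x2 * u)%R by now apply Rmult_lt_0_compat. nra.
  - rewrite !exp_ln by easy. fold TA TC. nra.
  - rewrite !exp_ln by easy. unfold kerR in Ku. nra.
Qed.

(** The root u is real and off the slit. If u < y1, the chord in logarithmic coordinates towards (1,
    1) meets a level y in (y1, y2) with K < 0. If u > y2, being on X_1 makes the x-derivative of K
    positive at (x2, u), so K < 0 just to the left of [x2]. Both contradict a negative discriminant:
    4 K times its leading coefficient is a square minus the discriminant. *)
Lemma x2_not_on_X1 : ~ has_branch_root 1 x2.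
Proof.
  intros [y (Hk & Hy & Hn & Ht)]. destruct (root_at_x2 y Hk) as (u & Hu & -> & Ku & _).
  pose proof x2_pos as Hx. pose proof y1_lt_y2 as Y12.
  rewrite Cmod_R, Rabs_right in Hy by lra.
  destruct (Rlt_dec u y1) as [L|L].
  - set (m := ((y1 + y2) / 2)%R).
    assert (Hm : (u < m < 1 /\ y1 < m < y2)%R) by (unfold m; lra).
    assert (Lu : (ln u < ln m)%R) by (apply ln_increasing; lra).
    assert (Lm : (ln m < 0)%R) by (rewrite <- ln_1; apply ln_increasing; lra).
    (* The parameter at which the chord reaches the level y = m. *)
    set (s := (ln m / ln u)%R).
    assert (Es : (s * ln u = ln m)%R) by (unfold s; field; lra).
    assert (Hs : (0 < s < 1)%R) by nra.
    assert (L1 : laurent (ln x2) (ln u) = 1%R).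
    { pose proof (kerR_exp (ln x2) (ln u)) as F. rewrite !exp_ln, Ku in F by easy.
      assert (0 < x2 * u)%R by now apply Rmult_lt_0_compat. nra. }
    pose proof (laurent_chord s _ _ Hs L1) as L2. rewrite Es in L2.
    pose proof (kerR_exp (s * ln x2) (ln m)) as F. rewrite (exp_ln m) in F by lra.
    set (X := exp (s * ln x2)) in *. assert (PX : (0 < X)%R) by apply exp_pos.
    assert (N : (kerR X m < 0)%R).
    { rewrite F. assert (0 < X * m)%R by (apply Rmult_lt_0_compat; lra). nra. }
    pose proof (tdisc_neg m ltac:(lra)) as D. rewrite kerR_swap in N. unfold tdiscR in D.
    assert (TA : (0 <= c2 + b2 * m + a2 * (m * m))%R).
    { assert (0 <= b2 * m)%R by (apply Rmult_le_pos; lra).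
      assert (0 <= a2 * (m * m))%R by (apply Rmult_le_pos; nra). lra. }
    set (ta0 := (c2 + b2 * m + a2 * (m * m))%R) in *. set (tb0 := (c1 - m + a1 * (m * m))%R) in *.
    set (tc0 := (c0 + b0 * m + a0 * (m * m))%R) in *.
    assert (4 * ta0 * (ta0 * (X * X) + tb0 * X + tc0) <= 0)%R by nra.
    pose proof (Rle_0_sqr (2 * ta0 * X + tb0)) as S. unfold Rsqr in S. nra.
  - assert (U2 : (y2 < u)%R).
    { apply Rnot_le_lt. intros G. apply Hn. exists u. split; [lra|easy]. }
    destruct (slit_root_real tdisc y1 y2 g u ltac:(lra) Hg ltac:(lra) U2) as [w [Hw E]].
    unfold branch_defect in Ht. rewrite E, quad_real, midquad_real in Ht.
    rewrite <- !RtoC_mult, <- RtoC_plus, <- RtoC_minus in Ht. apply RtoC_inj' in Ht.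
    pose proof Ku as K'. rewrite kerR_swap in K'.
    assert (TA : (0 <= c2 + b2 * u + a2 * (u * u))%R).
    { assert (0 <= b2 * u)%R by (apply Rmult_le_pos; lra).
      assert (0 <= a2 * (u * u))%R by (apply Rmult_le_pos; nra). lra. }
    set (ta0 := (c2 + b2 * u + a2 * (u * u))%R) in *. set (tb0 := (c1 - u + a1 * (u * u))%R) in *.
    set (tc0 := (c0 + b0 * u + a0 * (u * u))%R) in *.
    (* Small enough for x2 - e to be positive and to stay in (x1, x2), and for K(x2 - e, u) = -e (w
       - ta0 e) to be negative. *)
    set (e := Rmin (Rmin ((x2 - x1) / 2) (x2 / 2)) (w / (2 * (ta0 + 1)))).
    pose proof (Rle_abs x1) as X1.
    assert (He : (0 < e)%R).
    { repeat apply Rmin_pos; try lra. apply Rdiv_lt_0_compat; lra. }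
    assert (He1 : (e <= (x2 - x1) / 2)%R) by (eapply Rle_trans; [apply Rmin_l|apply Rmin_l]).
    assert (He2 : (e <= x2 / 2)%R) by (eapply Rle_trans; [apply Rmin_l|apply Rmin_r]).
    assert (He3 : (ta0 * e < w)%R).
    { apply Rle_lt_trans with ((ta0 + 1) * (w / (2 * (ta0 + 1))))%R.
      - apply Rmult_le_compat; try lra. apply Rmin_r.
      - replace ((ta0 + 1) * (w / (2 * (ta0 + 1))))%R with (w / 2)%R by (field; lra). lra. }
    set (t := (x2 - e)%R).
    assert (N : (kerR t u < 0)%R).
    { rewrite kerR_swap. fold ta0 tb0 tc0.
      replace (ta0 * (t * t) + tb0 * t + tc0)%R with (- (e * (w - ta0 * e)))%R.
      - assert (0 < e * (w - ta0 * e))%R by (apply Rmult_lt_0_compat; lra). lra.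
      - unfold t. nra. }
    pose proof (disc_neg t ltac:(unfold t; lra)) as D. unfold kerR in N. unfold discR in D.
    assert (AA : (0 <= a0 + a1 * t + a2 * (t * t))%R).
    { assert (0 < t)%R by (unfold t; lra). assert (0 <= a1 * t)%R by (apply Rmult_le_pos; lra).
      assert (0 <= a2 * (t * t))%R by (apply Rmult_le_pos; nra). lra. }
    set (A := (a0 + a1 * t + a2 * (t * t))%R) in *. set (B := (b0 - t + b2 * (t * t))%R) in *.
    set (D0 := (c0 + c1 * t + c2 * (t * t))%R) in *.
    assert (4 * A * (A * (u * u) + B * u + D0) <= 0)%R by nra.
    pose proof (Rle_0_sqr (2 * A * u + B)) as S. unfold Rsqr in S. nra.
Qed.

(** Strictly between [x1] and [x2] the discriminant is negative, so K has no real root y at all;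
    only the endpoints need a separate reason. *)
Lemma segment_off_curve (t : R) : off_curve x1 -> (x1 <= t <= x2)%R -> off_curve t.
Proof.
  intros H1 Ht. destruct (Req_dec t x1) as [-> | N1]; [easy|].
  destruct (Req_dec t x2) as [-> | N2]; [apply x2_off_curve|].
  intros s _ Hk. rewrite ker_real in Hk. apply RtoC_inj' in Hk. unfold kerR in Hk.
  pose proof (disc_neg t ltac:(lra)) as D. unfold discR in D.
  set (A := (a0 + a1 * t + a2 * (t * t))%R) in *. set (B := (b0 - t + b2 * (t * t))%R) in *.
  set (D0 := (c0 + c1 * t + c2 * (t * t))%R) in *.
  pose proof (Rle_0_sqr (2 * A * s + B)) as S. unfold Rsqr in S. nra.
Qed.

Lemma admissible_x1 : off_curve x1 -> admissible x1.
Proof.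
  intros H1. apply Rabs_def2 in Hx12 as X.
  assert (M : (Cmod x1 < 1)%R) by (rewrite Cmod_R; lra).
  split; [|lra]. intros _.
  assert (E : has_branch_root 1 x1 <-> has_branch_root 1 x2).
  { apply (interval_constant (fun t => has_branch_root 1 (RtoC t))); [lra|]. intros t Ht.
    assert (Hr : region 1 t) by (left; split; [easy|]; rewrite Cmod_R; apply Rabs_le; lra).
    destruct (has_branch_root_locally_constant 1 t (segment_off_curve t H1 Ht) Hr) as [r [Hrp H]].
    exists r. split; [easy|]. intros s _ Hs. apply H. unfold dist.
    now rewrite <- RtoC_minus, Cmod_R. }
  rewrite E. apply x2_not_on_X1.
Qed.

Lemma component_admissible (x : C) : component off_curve (RtoC x1) x -> off_curve x /\ admissible x.
Proof.
  intros H. apply (component_invariant off_curve admissible x1 x); [|easy|].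
  - intros w Hw. now apply admissible_locally_constant.
  - apply admissible_x1. destruct H as (T & HT & _ & H & _). now apply HT.
Qed.

(** * The continued function *)

Context (F0 H : C -> C) (kap : C)
  (HF0 : forall x, (Cmod x < 1)%R -> cdiff F0 x) (HH : forall y, (Cmod y < 1)%R -> cdiff H y)
  (FE : forall x y, (Cmod x < 1)%R -> (Cmod y < 1)%R -> ker x y = 0 -> F0 x + H y = kap + x * y).

Definition X0_inverse (x : C) : C := epsilon (inhabits (RtoC 0)) (branch_root (-1) x).

Definition continuation (x : C) : C :=
  if Rlt_dec (Cmod x) 1 then F0 x else x * X0_inverse x + kap - H (X0_inverse x).

Lemma continuation_disc (x : C) : (Cmod x < 1)%R -> continuation x = F0 x.
Proof. intros Hx. unfold continuation. destruct (Rlt_dec (Cmod x) 1); [easy|lra]. Qed.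

Lemma branch_root_unique (x y y' : C) : ~ two_branch_roots x -> branch_root (-1) x y -> branch_root (-1) x y' -> y = y'.
Proof.
  intros N H1 H2. apply NNPP. intros D. apply N. exists y, y'. split; [easy|]. split; [easy|].
  pose proof (Cminus_neq_0 y y' D) as D'.
  replace (a x * (y + y') + b x) with ((ker x y - ker x y') / (y - y')).
  - rewrite (proj1 H1), (proj1 H2). field. easy.
  - unfold ker. field. easy.
Qed.

Lemma X0_inverse_eq (x y : C) : ~ two_branch_roots x -> branch_root (-1) x y -> X0_inverse x = y.
Proof.
  intros N Hy. apply (branch_root_unique x); [easy| |easy]. unfold X0_inverse. apply epsilon_spec. now exists y.
Qed.

(** The formula with [X0_inverse] is valid on a full neighbourhood of [x0]; on the part inside the
    unit disc the functional equation identifies it with [F0], so the two halves of [continuation]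
    glue. The slope of the inverse branch comes from splitting K(x0 + h, Y) - K(x0, y0) into an
    x-increment and a y-increment. *)
Lemma continuation_outside (x0 : C) : off_curve x0 -> (1 <= Cmod x0)%R -> admissible x0 -> cdiff continuation x0.
Proof.
  intros Ho Hx [_ G]. destruct (G Hx) as [[y0 Hy0] N2].
  set (Y := X0_inverse).
  assert (EY : Y x0 = y0) by now apply X0_inverse_eq.
  destruct (branch_root_open (-1) x0 y0 (or_intror eq_refl) Hy0) as [e [He O]].
  pose proof (proj1 Hy0) as Hk.
  assert (near : forall e', (0 < e')%R -> ev (dist x0) (fun x => (Cmod (Y x - y0) < e')%R /\
     branch_root (-1) x (Y x) /\ ~ two_branch_roots x)).
  { intros e' He'. assert (Hm : (0 < Rmin e e')%R) by now apply Rmin_pos.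
    pose proof (root_persists (dist x0) _ _ _ _ _ _ y0 (a_lim x0) (b_lim x0) (c_lim x0)
      Hk (leading_nonzero x0 y0 Ho Hk) _ Hm) as P.
    apply ev_imp with (1 := ev_and _ _ _ P (ev_and _ _ _ (ex_intro _ e (conj He (fun a h => h)))
      (two_branch_roots_locally_constant x0 Ho Hx))).
    intros x [[y [Hy Hyy]] [Hxx N]]. unfold dist in Hxx.
    pose proof (Rmin_l e e'). pose proof (Rmin_r e e').
    assert (R1 : branch_root (-1) x y) by (apply O; [lra|lra|exact Hy]).
    assert (N' : ~ two_branch_roots x) by now rewrite N.
    replace (Y x) with y by (symmetry; now apply X0_inverse_eq). split; [lra|now split]. }
  assert (LY : lim Cmod (fun h => Y (x0 + h)) y0).
  { apply lim_shift. intros e' He'. apply ev_imp with (1 := near e' He'). tauto. }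
  set (D := 2 * a x0 * y0 + b x0).
  (* A zero y-derivative would make [y0] a double root, which [two_branch_roots] counts as the pair
     (y0, y0). *)
  assert (ND : D <> 0).
  { intros E. apply N2. exists y0, y0. split; [easy|]. split; [easy|]. rewrite <- E. unfold D. ring. }
  destruct Hy0 as (_ & My0 & _).
  destruct (slope_of_cdiff H y0 (HH y0 My0)) as (ph & l & Lph & Sph).
  set (num := fun h => ta (Y (x0 + h)) * (2 * x0 + h) + tb (Y (x0 + h))).
  set (den := fun h => a x0 * (Y (x0 + h) + y0) + b x0).
  set (psi := fun h => - num h * / den h).
  pose proof lim_id_0 as L0.
  assert (Lnum : lim Cmod num (ta y0 * (2 * x0 + 0) + tb y0)).
  { apply lim_plus; [apply lim_mult|]; [now apply quad_lim|limtac|now apply midquad_lim]. }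
  assert (Lden : lim Cmod den D).
  { replace D with (a x0 * (y0 + y0) + b x0) by (unfold D; ring). unfold den. limtac. }
  assert (Lpsi : lim Cmod psi (- (ta y0 * (2 * x0 + 0) + tb y0) * / D)).
  { apply lim_mult; [now apply lim_opp|now apply lim_inv]. }
  assert (Lcomp : lim Cmod (fun h => ph (Y (x0 + h) - y0)) l).
  { apply (lim_comp_0 Cmod (fun h => Y (x0 + h) - y0)); [|easy].
    replace (RtoC 0) with (y0 - y0) by ring. limtac. }
  set (lp := - (ta y0 * (2 * x0 + 0) + tb y0) * / D) in *.
  apply (cdiff_of_slope _ (fun h => Y (x0 + h) + x0 * psi h - psi h * ph (Y (x0 + h) - y0)) x0
    (y0 + x0 * lp - lp * l)).
  - apply lim_minus; [apply lim_plus; [easy|]|]; apply lim_mult; limtac.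
  - apply ev_imp with (1 := ev_and _ _ _ (ev_shift x0 _ (near 1%R ltac:(lra))) (lim_neq _ _ _ 0 Lden ND)).
    intros h [(_ & Hr & N) Hd].
    assert (val : forall x, branch_root (-1) x (Y x) -> continuation x = x * Y x + kap - H (Y x)).
    { intros x (Hkx & HYx & _). unfold continuation. destruct (Rlt_dec (Cmod x) 1) as [L|L]; [|easy].
      replace (F0 x) with (F0 x + H (Y x) - H (Y x)) by ring. rewrite (FE x (Y x) L HYx Hkx). ring. }
    rewrite (val _ Hr), val, EY.
    2:{ destruct (near 1%R ltac:(lra)) as [d [Hd0 Hn]]. apply Hn. unfold dist.
        replace (x0 - x0) with (RtoC 0) by ring. now rewrite Cmod_0. }
    assert (Esl : Y (x0 + h) - y0 = h * psi h).
    { assert (I : h * num h + (Y (x0 + h) - y0) * den h = 0).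
      { transitivity (ker (x0 + h) (Y (x0 + h)) - ker x0 y0).
        - unfold num, den, ker, quad, midquad. ring.
        - rewrite (proj1 Hr), Hk. ring. }
      unfold psi.
      transitivity ((h * num h + (Y (x0 + h) - y0) * den h) / den h - h * num h / den h); [field; easy|].
      rewrite I. field. easy. }
    transitivity (h * Y (x0 + h) + x0 * (Y (x0 + h) - y0) - (H (y0 + (Y (x0 + h) - y0)) - H y0)).
    + replace (y0 + (Y (x0 + h) - y0)) with (Y (x0 + h)) by ring. ring.
    + rewrite Sph. rewrite Esl at 2.
      replace (x0 * (Y (x0 + h) - y0)) with (x0 * (h * psi h)) by now rewrite Esl.
      transitivity (h * Y (x0 + h) + x0 * (h * psi h) - h * psi h * ph (Y (x0 + h) - y0)); [|ring].
      now rewrite Esl.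
Qed.

Lemma continuation_cdiff (x : C) : component off_curve (RtoC x1) x \/ (Cmod x < 1)%R -> cdiff continuation x.
Proof.
  intros Hx. destruct (Rlt_dec (Cmod x) 1) as [L|L].
  - apply (cdiff_local F0); [|now apply HF0].
    apply ev_imp with (1 := lim_Cmod_lt _ _ _ 1%R (cont_id x) L). intros w Hw. now apply continuation_disc.
  - destruct Hx as [Hx|Hx]; [|lra]. destruct (component_admissible x Hx). apply continuation_outside; [easy|lra|easy].
Qed.
End Kernel.

(** At 1 the dominance reads a + c < -b with real values, and (a + c)^2 >= 4ac. *)
Lemma disc_pos_at_1 (a0 a1 a2 b0 b2 c0 c1 c2 : R) :
  (0 <= a0)%R -> (0 <= a1)%R -> (0 <= a2)%R -> (0 <= b0)%R -> (0 <= b2)%R ->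
  (0 <= c0)%R -> (0 <= c1)%R -> (0 <= c2)%R ->
  (a0 + a1 + a2 + b0 + b2 + c0 + c1 + c2 < 1)%R ->
  disc a0 a1 a2 b0 b2 c0 c1 c2 1 = RtoC (discR a0 a1 a2 b0 b2 c0 c1 c2 1) /\
  (0 < discR a0 a1 a2 b0 b2 c0 c1 c2 1)%R.
Proof.
  intros. split; [apply disc_real|]. unfold discR.
  set (A := (a0 + a1 * 1 + a2 * (1 * 1))%R). set (D := (c0 + c1 * 1 + c2 * (1 * 1))%R).
  set (B := (b0 - 1 + b2 * (1 * 1))%R).
  assert (HA : (0 <= A)%R) by (unfold A; lra). assert (HD : (0 <= D)%R) by (unfold D; lra).
  assert (HB : (A + D < - B)%R) by (unfold A, B, D; lra).
  pose proof (Rle_0_sqr (A - D)) as S. unfold Rsqr in S.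
  assert ((A + D) * (A + D) < (- B) * (- B))%R by (apply Rmult_le_0_lt_compat; lra). lra.
Qed.

Lemma kernel_continuation (a0 a1 a2 b0 b2 c0 c1 c2 x1 x2 y1 y2 : R) (F0 H : C -> C) (kap : C) :
  (0 <= a0)%R -> (0 <= a1)%R -> (0 <= a2)%R -> (0 <= b0)%R -> (0 <= b2)%R ->
  (0 <= c0)%R -> (0 <= c1)%R -> (0 <= c2)%R ->
  (a0 + a1 + a2 + b0 + b2 + c0 + c1 + c2 < 1)%R -> (0 < a0 + a1 + a2)%R -> (0 < c0 + c1 + c2)%R ->
  branch_points (disc a0 a1 a2 b0 b2 c0 c1 c2) x1 x2 ->
  branch_points (tdisc a0 a1 a2 b0 b2 c0 c1 c2) y1 y2 ->
  (forall x, (Cmod x < 1)%R -> cdiff F0 x) -> (forall y, (Cmod y < 1)%R -> cdiff H y) ->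
  (forall x y, (Cmod x < 1)%R -> (Cmod y < 1)%R -> ker a0 a1 a2 b0 b2 c0 c1 c2 x y = 0 ->
     F0 x + H y = kap + x * y) ->
  exists F : C -> C,
    (forall x, component (off_curve a0 a1 a2 b0 b2 c0 c1 c2 y1 y2) (RtoC x1) x \/ (Cmod x < 1)%R ->
       cdiff F x) /\
    (forall x, (Cmod x < 1)%R -> F x = F0 x).
Proof.
  intros A0 A1 A2 B0 B2 C0' C1' C2' Hs Ha Hc Bx By HF HH FE.
  destruct (disc_pos_at_1 a0 a1 a2 b0 b2 c0 c1 c2 A0 A1 A2 B0 B2 C0' C1' C2' Hs) as [E1 P1].
  (* With the weights permuted by exchanging x and y, [disc] becomes [tdisc]. *)
  destruct (disc_pos_at_1 c2 b2 a2 c1 a1 c0 b0 a0 C2' B2 A2 C1' A1 C0' B0 A0 ltac:(lra)) as [E2 P2].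
  destruct (outer_root_exists _ x1 x2 _ Bx E1 P1) as (X1 & X2 & gx & Hgx).
  destruct (outer_root_exists _ y1 y2 _ By E2 P2) as (Y1 & Y2 & g & Hg).
  exists (continuation a0 a1 a2 b0 b2 c0 c1 c2 y1 y2 g F0 H kap). split.
  - now apply continuation_cdiff with (x1 := x1) (x2 := x2) (gx := gx).
  - intros x Hx. now apply continuation_disc.
Qed.

(** * Walks and generating functions *)

Ltac toC := change Cplx with C in *; change Cadd with Cplus in *; change Cmul with Cmult in *;
  change Csub with Cminus in *; change Defs.RtoC with RtoC in *;
  match goal with |- @eq _ ?u ?v => change (@eq C u v) end.

Lemma Cpow_Defs (x : C) (n : nat) : Defs.Cpow x n = Cpow x n.
Proof. reflexivity. Qed.

Fixpoint lsum {A : Type} (f : A -> C) (l : list A) : C :=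
  match l with [] => 0 | t :: l' => f t + lsum f l' end.

Lemma lsum_app {A : Type} (f : A -> C) (l l' : list A) : lsum f (l ++ l') = lsum f l + lsum f l'.
Proof. induction l as [|t l IH]; simpl; [ring|rewrite IH; ring]. Qed.

Lemma lsum_ext {A : Type} (f h : A -> C) (l : list A) :
  (forall t, In t l -> f t = h t) -> lsum f l = lsum h l.
Proof.
  induction l as [|t l IH]; intros E; simpl; [easy|].
  rewrite E, IH; [easy| |now left]. intros u Hu. apply E. now right.
Qed.

Lemma lsum_plus {A : Type} (f h : A -> C) (l : list A) :
  lsum (fun t => f t + h t) l = lsum f l + lsum h l.
Proof. induction l as [|t l IH]; simpl; [ring|rewrite IH; ring]. Qed.

Lemma lsum_scal {A : Type} (k : C) (f : A -> C) (l : list A) :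
  lsum (fun t => k * f t) l = k * lsum f l.
Proof. induction l as [|t l IH]; simpl; [ring|rewrite IH; ring]. Qed.

Lemma lsum_swap {A B : Type} (f : A -> B -> C) (l : list A) (l' : list B) :
  lsum (fun t => lsum (f t) l') l = lsum (fun u => lsum (fun t => f t u) l) l'.
Proof.
  induction l as [|t l IH]; simpl.
  - induction l' as [|u l' IH']; simpl; [easy|]. rewrite <- IH'. ring.
  - rewrite IH, <- lsum_plus. easy.
Qed.

Lemma lsum_map {A B : Type} (f : B -> C) (h : A -> B) (l : list A) :
  lsum f (map h l) = lsum (fun t => f (h t)) l.
Proof. induction l as [|t l IH]; simpl; [easy|now rewrite IH]. Qed.

Lemma lsum_flat_map {A B : Type} (f : B -> C) (h : A -> list B) (l : list A) :
  lsum f (flat_map h l) = lsum (fun t => lsum f (h t)) l.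
Proof. induction l as [|t l IH]; simpl; [easy|now rewrite lsum_app, IH]. Qed.

Lemma lsum_bound {A : Type} (f : A -> C) (M : R) (l : list A) :
  (forall t, In t l -> (Cmod (f t) <= M)%R) -> (Cmod (lsum f l) <= M * INR (length l))%R.
Proof.
  induction l as [|t l IH]; intros H.
  - simpl. rewrite Cmod_0. lra.
  - change (length (t :: l)) with (Datatypes.S (length l)). rewrite S_INR. simpl.
    pose proof (Cmod_triangle (f t) (lsum f l)). specialize (H t (or_introl eq_refl)) as H1.
    assert (H2 : forall u, In u l -> (Cmod (f u) <= M)%R) by (intros u Hu; apply H; now right).
    specialize (IH H2). lra.
Qed.

(** * Weighted sums over quadrant walks *)

Definition quadrant (p : step) : bool := (Z.leb 0 (fst p) && Z.leb 0 (snd p))%bool.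

Definition wsum (St : list step) (f : step -> C) (p : step) (n : nat) : C :=
  lsum (fun w => if stays p w then f (endpoint p w) else 0) (words St n).

Lemma wsum_first (St : list step) (f : step -> C) (p : step) (n : nat) :
  wsum St f p (Datatypes.S n) =
  lsum (fun s => if quadrant (addp p s) then wsum St f (addp p s) n else 0) St.
Proof.
  unfold wsum. simpl. rewrite lsum_flat_map.
  transitivity (lsum (fun w => lsum (fun s => if quadrant (addp p s) then
    (if stays (addp p s) w then f (endpoint (addp p s) w) else 0) else 0) St) (words St n)).
  - apply lsum_ext. intros w _. rewrite lsum_map. apply lsum_ext. intros s _.
    cbn [stays endpoint]. cbv zeta. unfold quadrant.
    now destruct (Z.leb 0 (fst (addp p s))), (Z.leb 0 (snd (addp p s))).
  - rewrite lsum_swap. apply lsum_ext. intros s _. destruct (quadrant (addp p s)); [easy|].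
    induction (words St n) as [|w l IH]; simpl; [easy|]. rewrite IH. ring.
Qed.

Lemma wsum_0 (St : list step) (f : step -> C) (p : step) : wsum St f p 0 = f p.
Proof. unfold wsum. simpl. ring. Qed.

(** [stays] and [endpoint] read a walk from its first step, while the functional equation removes
    the last one. Induction over a free starting point turns one recursion into the other. *)
Lemma wsum_last (St : list step) (f : step -> C) (p : step) (n : nat) :
  wsum St f p (Datatypes.S n) =
  wsum St (fun e => lsum (fun s => if quadrant (addp e s) then f (addp e s) else 0) St) p n.
Proof.
  revert p. induction n as [|n IH]; intros p.
  - rewrite wsum_first, wsum_0. apply lsum_ext. intros s _. now rewrite wsum_0.
  - rewrite wsum_first, (wsum_first _ _ p n). apply lsum_ext. intros s _. now rewrite IH.
Qed.

(** A box containing the endpoints of quadrant walks of length n from p. It justifies the cut-off i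
    <= n in [Qx0_term] and bounds the exponents when differentiating. *)
Definition reach (p : step) (n : nat) (e : step) : Prop :=
  (0 <= fst e <= fst p + Z.of_nat n)%Z /\ (0 <= snd e <= snd p + Z.of_nat n)%Z.

Lemma quadrant_spec (p : step) : quadrant p = true -> (0 <= fst p)%Z /\ (0 <= snd p)%Z.
Proof. unfold quadrant. intros H. apply andb_prop in H. destruct H. lia. Qed.

Lemma wsum_ext (St : list step) (f h : step -> C) (p : step) (n : nat) :
  (forall s, In s St -> small_step s) -> quadrant p = true ->
  (forall e, reach p n e -> f e = h e) -> wsum St f p n = wsum St h p n.
Proof.
  intros HS. revert p. induction n as [|n IH]; intros p Hp E.
  - rewrite !wsum_0. apply E. apply quadrant_spec in Hp. unfold reach. lia.
  - rewrite !wsum_first. apply lsum_ext. intros s Hs. destruct (quadrant (addp p s)) eqn:Q; [|easy].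
    apply IH; [easy|]. intros e He. apply E. destruct (HS s Hs) as [B1 [B2 _]].
    unfold reach, addp in *. simpl in *. lia.
Qed.

Lemma wsum_bound (St : list step) (f : step -> C) (p : step) (n : nat) (M : R) :
  (forall s, In s St -> small_step s) -> quadrant p = true ->
  (forall e, reach p n e -> (Cmod (f e) <= M)%R) ->
  (Cmod (wsum St f p n) <= M * INR (length St) ^ n)%R.
Proof.
  intros HS. revert p. induction n as [|n IH]; intros p Hp E.
  - rewrite wsum_0. simpl. rewrite Rmult_1_r. apply E. apply quadrant_spec in Hp. unfold reach. lia.
  - rewrite wsum_first.
    assert (M0 : (0 <= M)%R).
    { eapply Rle_trans; [apply Cmod_ge_0|apply (E p)]. apply quadrant_spec in Hp. unfold reach. lia. }
    assert (P : (0 <= M * INR (length St) ^ n)%R).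
    { apply Rmult_le_pos; [easy|]. apply pow_le, pos_INR. }
    simpl. replace (M * (INR (length St) * INR (length St) ^ n))%R
      with (M * INR (length St) ^ n * INR (length St))%R by ring.
    apply lsum_bound. intros s Hs. destruct (quadrant (addp p s)) eqn:Q; [|now rewrite Cmod_0].
    apply IH; [easy|]. intros e He. apply E. destruct (HS s Hs) as [B1 [B2 _]].
    unfold reach, addp in *. simpl in *. lia.
Qed.

Lemma wsum_plus (St : list step) (f h : step -> C) (p : step) (n : nat) :
  wsum St (fun e => f e + h e) p n = wsum St f p n + wsum St h p n.
Proof.
  unfold wsum. rewrite <- lsum_plus. apply lsum_ext. intros w _. destruct (stays p w); ring.
Qed.

Lemma wsum_scal (St : list step) (k : C) (f : step -> C) (p : step) (n : nat) :
  wsum St (fun e => k * f e) p n = k * wsum St f p n.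
Proof.
  unfold wsum. rewrite <- lsum_scal. apply lsum_ext. intros w _. destruct (stays p w); ring.
Qed.

Lemma wsum_Csum (St : list step) (f : nat -> step -> C) (p : step) (n k : nat) :
  Csum (fun i => wsum St (f i) p n) k = wsum St (fun e => Csum (fun i => f i e) k) p n.
Proof.
  induction k as [|k IH]; simpl; [easy|]. rewrite IH. symmetry. apply wsum_plus.
Qed.

Definition origin : step := (0, 0)%Z.
Definition mono (x : C) (i : Z) : C := Cpow x (Z.to_nat i).

Lemma q_wsum (St : list step) (i j : Z) (n : nat) :
  RtoC (INR (q St i j n)) =
  wsum St (fun e => if (Z.eqb (fst e) i && Z.eqb (snd e) j)%bool then 1 else 0) origin n.
Proof.
  unfold q, wsum, origin. induction (words St n) as [|w l IH]; [easy|]. simpl.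
  rewrite <- IH. destruct (stays (0, 0)%Z w); simpl; [|ring].
  destruct (fst (endpoint (0, 0)%Z w) =? i)%Z, (snd (endpoint (0, 0)%Z w) =? j)%Z;
    cbn [andb length]; rewrite ?S_INR, ?RtoC_plus; ring.
Qed.

Lemma Csum_delta (f : nat -> C) (m : Z) (n : nat) : (0 <= m)%Z ->
  Csum (fun i => if Z.eqb m (Z.of_nat i) then f i else RtoC 0) n =
  if Z.leb m (Z.of_nat n) then f (Z.to_nat m) else RtoC 0.
Proof.
  intros Hm. induction n as [|n IH].
  - simpl. destruct (Z.eqb_spec m 0) as [->|N]; [easy|]. destruct (Z.leb_spec m 0); [lia|easy].
  - cbn [Csum]. rewrite IH. toC.
    destruct (Z.leb_spec m (Z.of_nat n)) as [L|L];
    destruct (Z.eqb_spec m (Z.of_nat (Datatypes.S n))) as [E|E];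
    destruct (Z.leb_spec m (Z.of_nat (Datatypes.S n))) as [L'|L']; try lia; try ring.
    rewrite E, Nat2Z.id. ring.
Qed.

(** The pair (fst, snd) yields Q(x, 0) and the pair (snd, fst) yields Q(0, y). *)
Definition gx_term (u v : step -> Z) (x : C) (e : step) : C :=
  if Z.eqb (v e) 0 then mono x (u e) else 0.

Lemma Csum_ext (f h : nat -> C) (n : nat) : (forall i, f i = h i) -> Csum f n = Csum h n.
Proof. intros E. induction n as [|n IH]; simpl; [apply E|now rewrite IH, E]. Qed.

Lemma Qx0_term_wsum (St : list step) (z : R) (x : C) (n : nat) :
  (forall s, In s St -> small_step s) ->
  Qx0_term St z x n = RtoC (z ^ n) * wsum St (gx_term fst snd x) origin n.
Proof.
  intros HS. unfold Qx0_term. toC. f_equal.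
  transitivity (Csum (fun i => wsum St (fun e => Cpow x i *
    (if (Z.eqb (fst e) (Z.of_nat i) && Z.eqb (snd e) 0)%bool then RtoC 1 else RtoC 0)) origin n) n).
  - apply Csum_ext. intros i. rewrite wsum_scal, <- q_wsum. rewrite Cpow_Defs. ring.
  - rewrite wsum_Csum. apply wsum_ext; [easy|easy|]. intros e [[R1 R2] _]. unfold gx_term.
    transitivity (Csum (fun i => if Z.eqb (fst e) (Z.of_nat i) then
      (if Z.eqb (snd e) 0 then Cpow x i else RtoC 0) else RtoC 0) n).
    + apply Csum_ext. intros i. destruct (fst e =? Z.of_nat i)%Z, (snd e =? 0)%Z; simpl; ring.
    + rewrite Csum_delta by easy. destruct (Z.leb_spec (fst e) (Z.of_nat n)); [easy|].
      unfold origin in R2. simpl in R2. lia.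
Qed.

Lemma Q0y_term_wsum (St : list step) (z : R) (y : C) (n : nat) :
  (forall s, In s St -> small_step s) ->
  Q0y_term St z y n = RtoC (z ^ n) * wsum St (gx_term snd fst y) origin n.
Proof.
  intros HS. unfold Q0y_term. toC. f_equal.
  transitivity (Csum (fun i => wsum St (fun e => Cpow y i *
    (if (Z.eqb (fst e) 0 && Z.eqb (snd e) (Z.of_nat i))%bool then RtoC 1 else RtoC 0)) origin n) n).
  - apply Csum_ext. intros i. rewrite wsum_scal, <- q_wsum. rewrite Cpow_Defs. ring.
  - rewrite wsum_Csum. apply wsum_ext; [easy|easy|]. intros e [_ [R1 R2]]. unfold gx_term.
    transitivity (Csum (fun i => if Z.eqb (snd e) (Z.of_nat i) then
      (if Z.eqb (fst e) 0 then Cpow y i else RtoC 0) else RtoC 0) n).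
    + apply Csum_ext. intros i. destruct (snd e =? Z.of_nat i)%Z, (fst e =? 0)%Z; simpl; ring.
    + rewrite Csum_delta by easy. destruct (Z.leb_spec (snd e) (Z.of_nat n)); [easy|].
      unfold origin in R2. simpl in R2. lia.
Qed.

(* A step is lost from the product rule exactly when it would leave the half-line. *)
Lemma mono_step (x : C) (i s : Z) : (0 <= i)%Z -> (-1 <= s <= 1)%Z ->
  x * (if Z.leb 0 (i + s) then mono x (i + s) else 0) =
  Cpow x (e1 s) * mono x i - (if (Z.eqb s (-1) && Z.eqb i 0)%bool then 1 else 0).
Proof.
  intros Hi Hs. unfold mono, e1.
  assert (C3 : (s = -1 \/ s = 0 \/ s = 1)%Z) by lia.
  destruct (Z.eq_dec i 0) as [->|N].
  - destruct C3 as [-> | [-> | ->]]; simpl; ring.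
  - assert (Ei : exists k, Z.to_nat i = Datatypes.S k) by (exists (Z.to_nat (i - 1)); lia).
    destruct Ei as [k Ek].
    destruct (Z.leb_spec 0 (i + s)) as [L|L]; [|lia].
    replace (Z.eqb i 0) with false by (symmetry; now apply Z.eqb_neq). rewrite Bool.andb_false_r.
    destruct C3 as [-> | [-> | ->]].
    + replace (Z.to_nat (i + -1)) with k by lia. rewrite Ek. simpl. ring.
    + replace (Z.to_nat (i + 0)) with (Datatypes.S k) by lia. rewrite Ek. simpl. ring.
    + replace (Z.to_nat (i + 1)) with (Datatypes.S (Datatypes.S k)) by lia. rewrite Ek. simpl. ring.
Qed.

Lemma sumS_lsum (St : list step) (P : step -> bool) (f : step -> C) :
  sumS St P f = lsum (fun s => if P s then f s else 0) St.
Proof.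
  induction St as [|s l IH]; simpl; [easy|]. rewrite IH. toC.
  destruct (P s); [easy|]. ring.
Qed.

(** A step (-1, -1) taken at the origin is removed once by [c_] and once by [ct_]; this weight adds
    it back. *)
Definition corner (St : list step) (z : R) : C :=
  z * lsum (fun s => if (Z.eqb (fst s) (-1) && Z.eqb (snd s) (-1))%bool then 1 else 0) St.

(** The product of the rule [mono_step] in each coordinate, summed over the steps: the lost terms
    sit on the two axes and, by inclusion and exclusion, at the corner. *)
Lemma kernel_step (St : list step) (z : R) (x y : C) (e : step) :
  (forall s, In s St -> small_step s) -> (0 <= fst e)%Z -> (0 <= snd e)%Z ->
  x * y * (z * lsum (fun s => if quadrant (addp e s) then
     mono x (fst (addp e s)) * mono y (snd (addp e s)) else 0) St) =
  (K St z x y + x * y) * (mono x (fst e) * mono y (snd e)) - c_ St z x * gx_term fst snd x e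
   - ct_ St z y * gx_term snd fst y e
   + corner St z * (if (Z.eqb (fst e) 0 && Z.eqb (snd e) 0)%bool then 1 else 0).
Proof.
  intros HS H1 H2. unfold K, c_, ct_, corner. rewrite !sumS_lsum. toC.
  transitivity (z * lsum (fun s =>
     (Cpow x (e1 (fst s)) * Cpow y (e1 (snd s))) * (mono x (fst e) * mono y (snd e))
     + - gx_term fst snd x e * (if Z.eqb (snd s) (-1) then Cpow x (e1 (fst s)) else 0)
     + - gx_term snd fst y e * (if Z.eqb (fst s) (-1) then Cpow y (e1 (snd s)) else 0)
     + (if (Z.eqb (fst e) 0 && Z.eqb (snd e) 0)%bool then 1 else 0) *
       (if (Z.eqb (fst s) (-1) && Z.eqb (snd s) (-1))%bool then 1 else 0)) St).
  - transitivity (z * lsum (fun s => (x * y) * (if quadrant (addp e s) then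
     mono x (fst (addp e s)) * mono y (snd (addp e s)) else 0)) St); [rewrite lsum_scal; ring|].
    f_equal. apply lsum_ext. intros s Hs. destruct (HS s Hs) as [B1 [B2 _]].
    transitivity ((x * (if Z.leb 0 (fst e + fst s) then mono x (fst e + fst s) else 0)) *
      (y * (if Z.leb 0 (snd e + snd s) then mono y (snd e + snd s) else 0))).
    + unfold quadrant, addp. simpl.
      destruct (0 <=? fst e + fst s)%Z, (0 <=? snd e + snd s)%Z; simpl; ring.
    + rewrite !mono_step by easy. unfold gx_term.
      destruct (Z.eqb_spec (fst s) (-1)) as [E1|E1], (Z.eqb_spec (snd s) (-1)) as [E2|E2],
       (Z.eqb_spec (fst e) 0) as [E3|E3], (Z.eqb_spec (snd e) 0) as [E4|E4];
       rewrite ?E1, ?E2, ?E3, ?E4; simpl; ring.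
  - rewrite !lsum_plus, !lsum_scal.
    replace (lsum (fun s => Cpow x (e1 (fst s)) * Cpow y (e1 (snd s)) * (mono x (fst e) * mono y (snd e))) St)
      with ((mono x (fst e) * mono y (snd e)) * lsum (fun s => Cpow x (e1 (fst s)) * Cpow y (e1 (snd s))) St).
    + change Defs.Cpow with Cpow. unfold step in *. ring.
    + rewrite <- lsum_scal. apply lsum_ext. intros s _. ring.
Qed.

(* Limits along [nat] as limits along [1/(n+1) -> 0]. *)
Definition atinf (n : nat) : R := (/ INR (Datatypes.S n))%R.

Lemma ev_atinf (P : nat -> Prop) : ev atinf P <-> exists N, forall n, (N <= n)%nat -> P n.
Proof.
  unfold atinf. split.
  - intros [r [Hr H]]. destruct (archimed_cor1 r Hr) as [N [HN HN0]]. exists N. intros n Hn. apply H.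
    eapply Rle_lt_trans; [|exact HN]. apply Rinv_le_contravar; [now apply lt_0_INR|]. apply le_INR. lia.
  - intros [N H]. exists (/ INR (Datatypes.S N))%R. split; [apply Rinv_0_lt_compat, lt_0_INR; lia|].
    intros n Hn. apply H. apply Rinv_lt_cancel in Hn; [|apply lt_0_INR; lia]. apply INR_lt in Hn. lia.
Qed.

Lemma lim_atinf_unique (f : nat -> C) (l k : C) : lim atinf f l -> lim atinf f k -> l = k.
Proof.
  intros Hl Hk. apply NNPP. intros N. pose proof (proj1 (Cmod_gt_0 _) (Cminus_neq_0 l k N)) as P.
  destruct (proj1 (ev_atinf _) (ev_and _ _ _ (Hl (Cmod (l - k) / 2)%R ltac:(lra)) (Hk (Cmod (l - k) / 2)%R ltac:(lra)))) as [n H].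
  destruct (H n (Nat.le_refl n)) as [H1 H2].
  pose proof (Cmod_triangle (- (f n - l)) (f n - k)) as T. rewrite Cmod_opp in T.
  replace (- (f n - l) + (f n - k)) with (l - k) in T by ring. lra.
Qed.

(** * Complex series with a summable real majorant *)

Definition Cser (t : nat -> C) : C := (Series (fun n => Re (t n)), Series (fun n => Im (t n))).

Lemma im_le_Cmod (w : C) : (Rabs (Im w) <= Cmod w)%R.
Proof. eapply Rle_trans; [apply Rmax_r|apply Rmax_Cmod]. Qed.

Lemma Cpartial_parts (t : nat -> C) (n : nat) :
  Re (Cpartial t n) = sum_n (fun n => Re (t n)) n /\ Im (Cpartial t n) = sum_n (fun n => Im (t n)) n.
Proof.
  induction n as [|n [I1 I2]]; [now rewrite !sum_O|]. rewrite !sum_Sn, <- I1, <- I2. now split.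
Qed.

Lemma series_tail (a u : nat -> R) : (forall n, (Rabs (a n) <= u n)%R) -> ex_series u ->
  forall eps : R, (0 < eps)%R -> exists N, forall n, (N <= n)%nat -> (Rabs (sum_n a n - Series a) < eps)%R.
Proof.
  intros H Hu eps He. assert (Ha : ex_series a) by (apply (ex_series_le a u); [exact H|exact Hu]).
  pose proof (Series_correct a Ha) as L.
  assert (L' : is_lim_seq (sum_n a) (Series a)) by exact L.
  apply is_lim_seq_spec in L'. destruct (L' (mkposreal eps He)) as [N HN]. now exists N.
Qed.

Lemma Cser_cv (t : nat -> C) (u : nat -> R) : (forall n, (Cmod (t n) <= u n)%R) -> ex_series u ->
  lim atinf (Cpartial t) (Cser t).
Proof.
  intros H Hu e He. apply ev_atinf.
  destruct (series_tail (fun n => Re (t n)) u) with (eps := (e / 2)%R) as [N1 H1]; [|easy|lra|].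
  { intros n. eapply Rle_trans; [apply re_le_Cmod|apply H]. }
  destruct (series_tail (fun n => Im (t n)) u) with (eps := (e / 2)%R) as [N2 H2]; [|easy|lra|].
  { intros n. eapply Rle_trans; [apply im_le_Cmod|apply H]. }
  exists (max N1 N2). intros n Hn. specialize (H1 n ltac:(lia)). specialize (H2 n ltac:(lia)).
  destruct (Cpartial_parts t n) as [E1 E2]. rewrite <- E1 in H1. rewrite <- E2 in H2.
  set (p := Cpartial t n) in *. set (s1 := Series (fun n => Re (t n))) in *.
  set (s2 := Series (fun n => Im (t n))) in *.
  assert (Ed : (p : C) - Cser t = RtoC (Re p - s1) + Ci * RtoC (Im p - s2)).
  { unfold Cser. fold s1 s2. apply injective_projections; unfold Re, Im; simpl; ring. }
  rewrite Ed. eapply Rle_lt_trans; [apply Cmod_triangle|]. rewrite Cmod_mult, Cmod_Ci, !Cmod_R. lra.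
Qed.

Lemma Cser_bound (t : nat -> C) (u : nat -> R) : (forall n, (Cmod (t n) <= u n)%R) -> ex_series u ->
  (Cmod (Cser t) <= 2 * Series u)%R.
Proof.
  intros H Hu.
  assert (B : forall a : nat -> R, (forall n, (Rabs (a n) <= u n)%R) -> (Rabs (Series a) <= Series u)%R).
  { intros a Ha. assert (E : ex_series (fun n => Rabs (a n))).
    { apply (ex_series_le (fun n => Rabs (a n)) u); [|easy]. intros n.
      change (Rabs (Rabs (a n)) <= u n)%R. now rewrite Rabs_Rabsolu. }
    eapply Rle_trans; [now apply Series_Rabs|]. apply Series_le; [|easy].
    intros n. split; [apply Rabs_pos|easy]. }
  replace (Cser t) with (RtoC (Series (fun n => Re (t n))) + Ci * RtoC (Series (fun n => Im (t n)))).
  2:{ apply injective_projections; simpl; ring. }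
  eapply Rle_trans; [apply Cmod_triangle|]. rewrite Cmod_mult, Cmod_Ci, !Cmod_R.
  assert (B1 := B (fun n => Re (t n)) (fun n => Rle_trans _ _ _ (re_le_Cmod _) (H n))).
  assert (B2 := B (fun n => Im (t n)) (fun n => Rle_trans _ _ _ (im_le_Cmod _) (H n))). lra.
Qed.

Lemma Cpartial_lin (p q k : C) (t t' t'' : nat -> C) (n : nat) :
  Cpartial (fun n => p * t n + q * t' n + k * t'' n) n =
  p * (Cpartial t n : C) + q * (Cpartial t' n : C) + k * (Cpartial t'' n : C).
Proof.
  induction n as [|n IH]; [reflexivity|]. cbn [Cpartial]. rewrite IH. toC. ring.
Qed.

Lemma ex_series_mult_l (k : R) (a : nat -> R) : ex_series a -> ex_series (fun n => (k * a n)%R).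
Proof. exact (ex_series_scal_l k a). Qed.

(** Bernoulli's inequality gives t^n >= 1 + ne >= e(n + 1), hence (n + 1)^2 <= t^(2n) / e^2, and e
    is chosen so that t^2 r stays below 1. *)
Lemma squares_geometric_summable (r : R) : (0 <= r < 1)%R -> ex_series (fun n => ((INR n + 1) ^ 2 * r ^ n)%R).
Proof.
  intros Hr. set (e := ((1 - r) / 4)%R). set (t := (1 + e)%R).
  assert (He : (0 < e <= 1 / 4)%R) by (unfold e; lra).
  assert (Ht : (t * t * r < 1)%R) by (unfold t; unfold e; nra).
  assert (Ht0 : (0 <= t * t * r)%R) by (unfold t; apply Rmult_le_pos; nra).
  apply (ex_series_le (fun n => ((INR n + 1) ^ 2 * r ^ n)%R) (fun n => (/ (e * e) * (t * t * r) ^ n)%R)).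
  - intros n. change (Rabs ((INR n + 1) ^ 2 * r ^ n) <= / (e * e) * (t * t * r) ^ n)%R.
    pose proof (pos_INR n) as Pn. pose proof (pow_le r n ltac:(lra)) as Pr.
    rewrite Rabs_right by (apply Rle_ge, Rmult_le_pos; [nra|easy]).
    assert (B : (e * (INR n + 1) <= t ^ n)%R).
    { destruct n as [|n']; [simpl; lra|]. pose proof (poly (Datatypes.S n') e ltac:(lra)) as P. fold t in P. lra. }
    rewrite !Rpow_mult_distr.
    replace (/ (e * e) * (t ^ n * t ^ n * r ^ n))%R with ((t ^ n / e) * (t ^ n / e) * r ^ n)%R by (field; lra).
    apply Rmult_le_compat_r; [easy|].
    assert (B' : (INR n + 1 <= t ^ n / e)%R) by (apply Rle_div_r; lra).
    simpl. rewrite Rmult_1_r. apply Rmult_le_compat; lra.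
  - apply ex_series_mult_l, ex_series_geom. rewrite Rabs_right; lra.
Qed.

(** The derivative n x^(n-1), in the recursive form of the product rule. *)
Fixpoint dpow (x : C) (n : nat) : C :=
  match n with O => 0 | Datatypes.S m => x * dpow x m + Cpow x m end.

Lemma Cpow_disc (x : C) (n : nat) : (Cmod x <= 1)%R -> (Cmod (Cpow x n) <= 1)%R.
Proof.
  intros H. rewrite Cmod_pow. rewrite <- (pow1 n). apply pow_incr. split; [apply Cmod_ge_0|easy].
Qed.

Lemma dpow_bound (x : C) (n : nat) : (Cmod x <= 1)%R -> (Cmod (dpow x n) <= INR n)%R.
Proof.
  intros H. induction n as [|n IH]; [simpl; rewrite Cmod_0; lra|]. rewrite S_INR. simpl.
  eapply Rle_trans; [apply Cmod_triangle|]. rewrite Cmod_mult.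
  pose proof (Cpow_disc x n H). pose proof (Cmod_ge_0 x). pose proof (Cmod_ge_0 (dpow x n)). nra.
Qed.

(** The remainders satisfy R_(n+1) = (x + h) R_n + h^2 [dpow x n]. As |x + h| <= 1, the constant
    grows by at most n at each step, and n^2 + n <= (n + 1)^2. *)
Lemma Cpow_taylor (x h : C) (n : nat) : (Cmod x <= 1)%R -> (Cmod (x + h) <= 1)%R ->
  (Cmod (Cpow (x + h) n - Cpow x n - h * dpow x n) <= INR n ^ 2 * Cmod h ^ 2)%R.
Proof.
  intros H1 H2. induction n as [|n IH].
  - simpl. replace (1 - 1 - h * 0) with (RtoC 0) by ring. rewrite Cmod_0. lra.
  - rewrite S_INR. cbn [dpow].
    replace (Cpow (x + h) (Datatypes.S n) - Cpow x (Datatypes.S n) - h * (x * dpow x n + Cpow x n)) with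
      ((x + h) * (Cpow (x + h) n - Cpow x n - h * dpow x n) + h * h * dpow x n) by (simpl; ring).
    eapply Rle_trans; [apply Cmod_triangle|]. rewrite !Cmod_mult.
    pose proof (dpow_bound x n H1). pose proof (Cmod_ge_0 (x + h)). pose proof (Cmod_ge_0 h).
    pose proof (Cmod_ge_0 (Cpow (x + h) n - Cpow x n - h * dpow x n)). pose proof (pos_INR n).
    set (X := Cmod (Cpow (x + h) n - Cpow x n - h * dpow x n)) in *.
    assert (Cmod (x + h) * X <= 1 * X)%R by (apply Rmult_le_compat_r; lra).
    assert (Cmod h * Cmod h * Cmod (dpow x n) <= Cmod h * Cmod h * INR n)%R
      by (apply Rmult_le_compat_l; [nra|easy]).
    assert (0 <= Cmod h * Cmod h)%R by nra. nra.
Qed.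

(** * The walk series: derivative and functional equation *)

Section Walks.
Context (St : list step) (z : R) (HS : forall s, In s St -> small_step s)
  (Hz : (0 < z)%R) (Hzk : (z * INR (length St) < 1)%R).
Local Notation r := (z * INR (length St))%R.

Lemma r_range : (0 <= r < 1)%R.
Proof. split; [|easy]. apply Rmult_le_pos; [lra|apply pos_INR]. Qed.

Definition wterm (f : step -> C) (n : nat) : C := RtoC (z ^ n) * wsum St f origin n.

Lemma wterm_bound (f : step -> C) (n : nat) (M : R) :
  (forall e, reach origin n e -> (Cmod (f e) <= M)%R) -> (Cmod (wterm f n) <= M * r ^ n)%R.
Proof.
  intros H. unfold wterm. rewrite Cmod_mult, Cmod_R, Rpow_mult_distr.
  pose proof (pow_le z n ltac:(lra)) as P. rewrite Rabs_right by lra.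
  pose proof (wsum_bound St f origin n M HS eq_refl H) as B.
  replace (M * (z ^ n * INR (length St) ^ n))%R with (z ^ n * (M * INR (length St) ^ n))%R by ring.
  now apply Rmult_le_compat_l.
Qed.

Definition wgen (f : step -> C) : C := Cser (wterm f).

Lemma wgen_cv (f : step -> C) (M : R) : (forall e, (Cmod (f e) <= M)%R) ->
  lim atinf (Cpartial (wterm f)) (wgen f).
Proof.
  intros H. apply Cser_cv with (u := fun n => (M * r ^ n)%R).
  - intros n. apply wterm_bound. intros e _. apply H.
  - apply ex_series_mult_l, ex_series_geom. pose proof r_range. rewrite Rabs_right; lra.
Qed.

Lemma mono_disc (x : C) (i : Z) : (Cmod x <= 1)%R -> (Cmod (mono x i) <= 1)%R.
Proof. apply Cpow_disc. Qed.

Lemma gx_term_disc (u v : step -> Z) (x : C) (e : step) : (Cmod x <= 1)%R -> (Cmod (gx_term u v x e) <= 1)%R.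
Proof.
  intros H. unfold gx_term. destruct (v e =? 0)%Z; [now apply mono_disc|]. rewrite Cmod_0. lra.
Qed.

(** Differentiation term by term: exponents at length n are at most n, so [Cpow_taylor] bounds the
    remainder of the n-th term by |h|^2 (n + 1)^2 r^n, which is summable. *)
Lemma wgen_cdiff (u v : step -> Z) (x : C) :
  (forall n e, reach origin n e -> (0 <= u e <= Z.of_nat n)%Z) -> (Cmod x < 1)%R ->
  cdiff (fun w => wgen (gx_term u v w)) x.
Proof.
  intros Hu Hx.
  set (dterm := fun e => if Z.eqb (v e) 0 then dpow x (Z.to_nat (u e)) else 0).
  set (sq := fun n => ((INR n + 1) ^ 2 * r ^ n)%R).
  pose proof (squares_geometric_summable r r_range) as Hsq. fold sq in Hsq.
  assert (Hsq0 : forall n, (0 <= sq n)%R).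
  { intros n. unfold sq. apply Rmult_le_pos; [apply pow2_ge_0|apply pow_le, r_range]. }
  assert (Sq : (0 <= Series sq)%R).
  { rewrite <- (Rmult_0_l (Series sq)), <- Series_scal_l.
    apply Series_le; [|easy]. intros n. specialize (Hsq0 n). lra. }
  assert (Nu : forall n e, reach origin n e -> (INR (Z.to_nat (u e)) <= INR n)%R).
  { intros n e He. specialize (Hu n e He). apply le_INR. lia. }
  assert (Ld : lim atinf (Cpartial (wterm dterm)) (wgen dterm)).
  { apply Cser_cv with (u := sq); [|easy]. intros n. apply wterm_bound. intros e He.
    pose proof (pos_INR n). unfold dterm. destruct (v e =? 0)%Z; [|rewrite Cmod_0; apply pow2_ge_0].
    pose proof (dpow_bound x (Z.to_nat (u e)) ltac:(lra)). specialize (Nu n e He). simpl. nra. }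
  exists (wgen dterm). intros eps He.
  (* The first bound keeps x + h in the disc, the second turns the quadratic remainder into eps |h|;
     the factor 2 is that of [Cser_bound]. *)
  exists (Rmin (1 - Cmod x) (eps / (2 * Series sq + 1))). split.
  { apply Rmin_pos; [lra|]. apply Rdiv_lt_0_compat; lra. }
  intros h Hh.
  assert (Hh1 : (Cmod h < 1 - Cmod x)%R) by (eapply Rlt_le_trans; [exact Hh|apply Rmin_l]).
  assert (Hh2 : (Cmod h <= eps / (2 * Series sq + 1))%R).
  { apply Rlt_le. eapply Rlt_le_trans; [exact Hh|apply Rmin_r]. }
  pose proof (Cmod_triangle x h) as T.
  set (t := fun n => 1 * wterm (gx_term u v (x + h)) n + - (1) * wterm (gx_term u v x) n + - h * wterm dterm n).
  assert (Bt : forall n, (Cmod (t n) <= Cmod h ^ 2 * sq n)%R).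
  { intros n.
    replace (t n) with (wterm (fun e => gx_term u v (x + h) e + (- (1) * gx_term u v x e + - h * dterm e)) n).
    2:{ unfold t, wterm. rewrite wsum_plus, wsum_plus, !wsum_scal. ring. }
    unfold sq. rewrite <- Rmult_assoc. apply wterm_bound. intros e Hen. unfold gx_term, dterm.
    pose proof (pos_INR n). pose proof (pow2_ge_0 (Cmod h)).
    destruct (v e =? 0)%Z.
    - unfold mono. set (k := Z.to_nat (u e)) in *.
      replace (Cpow (x + h) k + (- (1) * Cpow x k + - h * dpow x k)) with
        (Cpow (x + h) k - Cpow x k - h * dpow x k) by ring.
      eapply Rle_trans; [apply Cpow_taylor; lra|]. rewrite Rmult_comm.
      apply Rmult_le_compat_l; [easy|]. apply pow_incr. specialize (Nu n e Hen). fold k in Nu.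
      pose proof (pos_INR k). lra.
    - replace (0 + (- (1) * 0 + - h * 0)) with (RtoC 0) by ring. rewrite Cmod_0.
      apply Rmult_le_pos; [easy|apply pow2_ge_0]. }
  assert (Hst : ex_series (fun n => Cmod h ^ 2 * sq n)%R) by now apply ex_series_mult_l.
  assert (Et : wgen (gx_term u v (x + h)) - wgen (gx_term u v x) - wgen dterm * h = Cser t).
  { apply (lim_atinf_unique (Cpartial t)).
    - intros e' He'.
      assert (L : lim atinf (fun n => 1 * (Cpartial (wterm (gx_term u v (x + h))) n : C) +
         - (1) * (Cpartial (wterm (gx_term u v x)) n : C) + - h * (Cpartial (wterm dterm) n : C))
         (1 * wgen (gx_term u v (x + h)) + - (1) * wgen (gx_term u v x) + - h * wgen dterm)).
      { apply lim_plus; [apply lim_plus|]; (apply lim_mult; [apply lim_const|]); try exact Ld;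
          apply wgen_cv with (M := 1%R); intros e; apply gx_term_disc; lra. }
      apply ev_imp with (1 := L e' He'). intros n Hn. unfold t. rewrite Cpartial_lin.
      replace (wgen (gx_term u v (x + h)) - wgen (gx_term u v x) - wgen dterm * h) with
        (1 * wgen (gx_term u v (x + h)) + - (1) * wgen (gx_term u v x) + - h * wgen dterm) by ring.
      exact Hn.
    - now apply Cser_cv with (u := fun n => (Cmod h ^ 2 * sq n)%R). }
  rewrite Et. eapply Rle_trans; [now apply Cser_bound with (u := fun n => (Cmod h ^ 2 * sq n)%R)|].
  rewrite Series_scal_l. pose proof (Cmod_ge_0 h).
  apply Rle_trans with (Cmod h * (2 * Series sq + 1) * Cmod h)%R; [nra|].
  apply Rmult_le_compat_r; [easy|].
  apply Rle_trans with (eps / (2 * Series sq + 1) * (2 * Series sq + 1))%R; [apply Rmult_le_compat_r; lra|].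
  right. field. lra.
Qed.

(** Where K = 0, the n-th term of the combination is xy (w_n - w_(n+1)), with w_n the part of Q(x,
    y; z) from walks of length n. It telescopes and w_n tends to 0, so the series Q(x, y; z) itself
    never has to be summed. *)
Lemma functional_equation (x y : C) : (Cmod x < 1)%R -> (Cmod y < 1)%R -> K St z x y = RtoC 0 ->
  (c_ St z x : C) * wgen (gx_term fst snd x) + (ct_ St z y : C) * wgen (gx_term snd fst y) =
  corner St z * wgen (fun e => if (Z.eqb (fst e) 0 && Z.eqb (snd e) 0)%bool then 1 else 0) + x * y.
Proof.
  intros Hx Hy HK. set (o := fun e : step => if (Z.eqb (fst e) 0 && Z.eqb (snd e) 0)%bool then RtoC 1 else 0).
  set (xy := fun e : step => mono x (fst e) * mono y (snd e)).
  assert (Hxy : forall e, (Cmod (xy e) <= 1)%R).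
  { intros e. unfold xy. rewrite Cmod_mult. pose proof (mono_disc x (fst e) ltac:(lra)).
    pose proof (mono_disc y (snd e) ltac:(lra)). pose proof (Cmod_ge_0 (mono x (fst e))).
    pose proof (Cmod_ge_0 (mono y (snd e))). nra. }
  assert (Hrec : forall n, (c_ St z x : C) * wterm (gx_term fst snd x) n + (ct_ St z y : C) * wterm (gx_term snd fst y) n
     + - corner St z * wterm o n = x * y * (wterm xy n - wterm xy (Datatypes.S n))).
  { intros n. unfold wterm. rewrite wsum_last.
    assert (E : RtoC z * (x * y) * wsum St (fun e => lsum (fun s => if quadrant (addp e s) then xy (addp e s) else 0) St) origin n =
      x * y * wsum St xy origin n + - (c_ St z x : C) * wsum St (gx_term fst snd x) origin n
      + - (ct_ St z y : C) * wsum St (gx_term snd fst y) origin n + corner St z * wsum St o origin n).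
    { rewrite <- !wsum_scal, <- !wsum_plus. apply wsum_ext; [easy|easy|]. intros e [[R1 _] [R2 _]].
      pose proof (kernel_step St z x y e HS R1 R2) as F. rewrite HK in F.
      transitivity (x * y * (z * lsum (fun s => if quadrant (addp e s) then
         mono x (fst (addp e s)) * mono y (snd (addp e s)) else 0) St)); [unfold xy; ring|].
      rewrite F. unfold xy, o. ring. }
    simpl pow. rewrite RtoC_mult.
    transitivity (RtoC (z ^ n) * (x * y * wsum St xy origin n -
      RtoC z * (x * y) * wsum St (fun e => lsum (fun s => if quadrant (addp e s) then xy (addp e s) else 0) St) origin n)).
    - rewrite E. ring.
    - ring. }
  (* The 1 is w_0, the contribution of the empty walk. *)
  assert (Htel : forall N, Cpartial (fun n => (c_ St z x : C) * wterm (gx_term fst snd x) n + (ct_ St z y : C) * wterm (gx_term snd fst y) n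
     + - corner St z * wterm o n) N = x * y * (1 - wterm xy (Datatypes.S N))).
  { induction N as [|N IH].
    - cbn [Cpartial]. rewrite Hrec. f_equal. unfold wterm at 1. rewrite wsum_0. unfold xy, mono. simpl. ring.
    - cbn [Cpartial]. rewrite IH, Hrec. toC. ring. }
  assert (L0 : lim atinf (fun N => x * y * (1 - wterm xy (Datatypes.S N))) (x * y * (1 - 0))).
  { apply lim_mult; [apply lim_const|]. apply lim_minus; [apply lim_const|].
    intros e He. apply ev_atinf.
    destruct (pow_lt_1_zero r ltac:(pose proof r_range; rewrite Rabs_right; lra) e He) as [N HN].
    exists N. intros n Hn. replace (wterm xy (Datatypes.S n) - 0) with (wterm xy (Datatypes.S n)) by ring.
    eapply Rle_lt_trans; [apply wterm_bound with (M := 1%R); intros; apply Hxy|].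
    specialize (HN (Datatypes.S n) ltac:(lia)). pose proof (Rle_abs (r ^ Datatypes.S n)). lra. }
  assert (L1 : lim atinf (fun N => (c_ St z x : C) * (Cpartial (wterm (gx_term fst snd x)) N : C) +
     (ct_ St z y : C) * (Cpartial (wterm (gx_term snd fst y)) N : C) + - corner St z * (Cpartial (wterm o) N : C))
     ((c_ St z x : C) * wgen (gx_term fst snd x) + (ct_ St z y : C) * wgen (gx_term snd fst y) + - corner St z * wgen o)).
  { apply lim_plus; [apply lim_plus|]; (apply lim_mult; [apply lim_const|]); apply wgen_cv with (M := 1%R); intros e.
    - apply gx_term_disc. lra.
    - apply gx_term_disc. lra.
    - unfold o. destruct ((fst e =? 0)%Z && (snd e =? 0)%Z)%bool; [rewrite Cmod_1|rewrite Cmod_0]; lra. }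
  assert (E : (c_ St z x : C) * wgen (gx_term fst snd x) + (ct_ St z y : C) * wgen (gx_term snd fst y) + - corner St z * wgen o = x * y * (1 - 0)).
  { apply (lim_atinf_unique _ _ _ L1). intros e He. apply ev_imp with (1 := L0 e He). intros n Hn.
    rewrite <- Cpartial_lin, Htel. exact Hn. }
  transitivity ((c_ St z x : C) * wgen (gx_term fst snd x) + (ct_ St z y : C) * wgen (gx_term snd fst y) + - corner St z * wgen o + corner St z * wgen o); [ring|].
  rewrite E. unfold o. ring.
Qed.
End Walks.

(** * Continuation of the generating functions *)

Fixpoint count (St : list step) (i j : Z) : R :=
  match St with
  | [] => 0%R
  | s :: l => ((if (Z.eqb (fst s) i && Z.eqb (snd s) j)%bool then 1 else 0) + count l i j)%R
  end.

Lemma count_nonneg (St : list step) (i j : Z) : (0 <= count St i j)%R.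
Proof.
  induction St as [|s l IH]; simpl; [lra|].
  destruct ((fst s =? i)%Z && (snd s =? j)%Z)%bool; lra.
Qed.

Lemma count_pos (St : list step) (s : step) : In s St -> (0 < count St (fst s) (snd s))%R.
Proof.
  induction St as [|u l IH]; [easy|]. intros [->|H]; simpl.
  - rewrite !Z.eqb_refl. simpl. pose proof (count_nonneg l (fst s) (snd s)). lra.
  - specialize (IH H). destruct ((fst u =? fst s)%Z && (snd u =? snd s)%Z)%bool; lra.
Qed.

Lemma small_step_cases (s : step) : small_step s ->
  s = (-1, -1)%Z \/ s = (-1, 0)%Z \/ s = (-1, 1)%Z \/ s = (0, -1)%Z \/ s = (0, 1)%Z \/
  s = (1, -1)%Z \/ s = (1, 0)%Z \/ s = (1, 1)%Z.
Proof.
  destruct s as [i j]. unfold small_step. simpl. intros [H1 [H2 N]].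
  assert (I : (i = -1 \/ i = 0 \/ i = 1)%Z) by lia. assert (J : (j = -1 \/ j = 0 \/ j = 1)%Z) by lia.
  destruct I as [-> | [-> | ->]], J as [-> | [-> | ->]]; tauto.
Qed.

Ltac step_cases H s :=
  let D := fresh in pose proof (small_step_cases s H) as D;
  destruct D as [-> | [-> | [-> | [-> | [-> | [-> | [-> | ->]]]]]]].

Lemma count_total (St : list step) : (forall s, In s St -> small_step s) ->
  (count St (-1) 1 + count St 0 1 + count St 1 1 + count St (-1) 0 + count St 1 0 +
   count St (-1) (-1) + count St 0 (-1) + count St 1 (-1) = INR (length St))%R.
Proof.
  induction St as [|s l IH]; intros HS; [simpl; lra|].
  cbn [length]. rewrite S_INR, <- IH by (intros u Hu; apply HS; now right).
  assert (Hs : small_step s) by (apply HS; now left). cbn [count].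
  step_cases Hs s; simpl; lra.
Qed.

(** This makes the coefficient of the middle power in [b_] and [bt_] exactly -1, the shape of
    [midquad]. *)
Lemma count_origin (St : list step) : (forall s, In s St -> small_step s) -> count St 0 0 = 0%R.
Proof.
  induction St as [|s l IH]; intros HS; [easy|]. cbn [count].
  rewrite IH by (intros u Hu; apply HS; now right).
  assert (Hs : small_step s) by (apply HS; now left). step_cases Hs s; simpl; lra.
Qed.

Lemma row_count (St : list step) (j : Z) (x : C) : (forall s, In s St -> small_step s) ->
  lsum (fun s => if Z.eqb (snd s) j then Cpow x (e1 (fst s)) else 0) St =
  count St (-1) j + count St 0 j * x + count St 1 j * (x * x).
Proof.
  induction St as [|s l IH]; intros HS; [simpl; ring|]. cbn [lsum count].
  rewrite IH by (intros u Hu; apply HS; now right). rewrite !RtoC_plus.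
  assert (Hs : small_step s) by (apply HS; now left).
  destruct s as [i j']. destruct Hs as [[Hi1 Hi2] _]. cbn [fst snd] in *.
  assert (I : (i = -1 \/ i = 0 \/ i = 1)%Z) by lia.
  destruct (Z.eqb_spec j' j); destruct I as [-> | [-> | ->]]; simpl; ring.
Qed.

Lemma column_count (St : list step) (i : Z) (y : C) : (forall s, In s St -> small_step s) ->
  lsum (fun s => if Z.eqb (fst s) i then Cpow y (e1 (snd s)) else 0) St =
  count St i (-1) + count St i 0 * y + count St i 1 * (y * y).
Proof.
  induction St as [|s l IH]; intros HS; [simpl; ring|]. cbn [lsum count].
  rewrite IH by (intros u Hu; apply HS; now right). rewrite !RtoC_plus.
  assert (Hs : small_step s) by (apply HS; now left).
  destruct s as [i' j]. destruct Hs as [_ [[Hj1 Hj2] _]]. cbn [fst snd] in *.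
  assert (J : (j = -1 \/ j = 0 \/ j = 1)%Z) by lia.
  destruct (Z.eqb_spec i' i); destruct J as [-> | [-> | ->]]; simpl; ring.
Qed.

Lemma kernel_rows (St : list step) (x y : C) : (forall s, In s St -> small_step s) ->
  lsum (fun s => Cpow x (e1 (fst s)) * Cpow y (e1 (snd s))) St =
  lsum (fun s => if Z.eqb (snd s) 1 then Cpow x (e1 (fst s)) else 0) St * (y * y) +
  lsum (fun s => if Z.eqb (snd s) 0 then Cpow x (e1 (fst s)) else 0) St * y +
  lsum (fun s => if Z.eqb (snd s) (-1) then Cpow x (e1 (fst s)) else 0) St.
Proof.
  induction St as [|s l IH]; intros HS; [simpl; ring|]. cbn [lsum].
  rewrite IH by (intros u Hu; apply HS; now right).
  assert (Hs : small_step s) by (apply HS; now left).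
  destruct s as [i j]. destruct Hs as [_ [[Hj1 Hj2] _]]. cbn [fst snd] in *.
  assert (J : (j = -1 \/ j = 0 \/ j = 1)%Z) by lia.
  destruct J as [-> | [-> | ->]]; simpl; ring.
Qed.

Lemma branch_points_ext (p p' : C -> C) (r1 r2 : R) :
  (forall x, p x = p' x) -> branch_points p r1 r2 -> branch_points p' r1 r2.
Proof.
  intros E (r3 & r4 & lc & H1 & H2 & H3 & H4 & H5). exists r3, r4, lc.
  repeat split; try easy.
  destruct H5 as [[H5 H6]|H6]; [left; split; [easy|]|right]; intros X; now rewrite <- E.
Qed.

Lemma component_mono (A B : C -> Prop) (p w : C) :
  (forall x, A x -> B x) -> component A p w -> component B p w.
Proof. intros HAB (T & HT & HC & Hp & Hw). exists T. split; [|easy]. intros v Hv. now apply HAB, HT. Qed.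

(** * The kernel of a step set as a kernel with eight weights *)

Section Coefficients.
Context (St : list step) (z : R) (HS : forall s, In s St -> small_step s).
Local Notation w i j := (z * count St i j)%R.
Local Notation kern := (ker (w (-1)%Z 1%Z) (w 0%Z 1%Z) (w 1%Z 1%Z) (w (-1)%Z 0%Z) (w 1%Z 0%Z)
  (w (-1)%Z (-1)%Z) (w 0%Z (-1)%Z) (w 1%Z (-1)%Z)).

Lemma a_quad (x : C) : a_ St z x = quad (w (-1)%Z 1%Z) (w 0%Z 1%Z) (w 1%Z 1%Z) x.
Proof.
  unfold a_, quad. rewrite sumS_lsum. toC. change Defs.Cpow with Cpow.
  rewrite row_count by easy. rewrite !RtoC_mult. ring.
Qed.
Lemma c_quad (x : C) : c_ St z x = quad (w (-1)%Z (-1)%Z) (w 0%Z (-1)%Z) (w 1%Z (-1)%Z) x.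
Proof.
  unfold c_, quad. rewrite sumS_lsum. toC. change Defs.Cpow with Cpow.
  rewrite row_count by easy. rewrite !RtoC_mult. ring.
Qed.
Lemma b_midquad (x : C) : b_ St z x = midquad (w (-1)%Z 0%Z) (w 1%Z 0%Z) x.
Proof.
  unfold b_, midquad. rewrite sumS_lsum. toC. change Defs.Cpow with Cpow.
  rewrite row_count by easy. rewrite count_origin, !RtoC_mult by easy. ring.
Qed.
Lemma at_quad (y : C) : at_ St z y = quad (w 1%Z (-1)%Z) (w 1%Z 0%Z) (w 1%Z 1%Z) y.
Proof.
  unfold at_, quad. rewrite sumS_lsum. toC. change Defs.Cpow with Cpow.
  rewrite column_count by easy. rewrite !RtoC_mult. ring.
Qed.
Lemma ct_quad (y : C) : ct_ St z y = quad (w (-1)%Z (-1)%Z) (w (-1)%Z 0%Z) (w (-1)%Z 1%Z) y.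
Proof.
  unfold ct_, quad. rewrite sumS_lsum. toC. change Defs.Cpow with Cpow.
  rewrite column_count by easy. rewrite !RtoC_mult. ring.
Qed.
Lemma bt_midquad (y : C) : bt_ St z y = midquad (w 0%Z (-1)%Z) (w 0%Z 1%Z) y.
Proof.
  unfold bt_, midquad. rewrite sumS_lsum. toC. change Defs.Cpow with Cpow.
  rewrite column_count by easy. rewrite count_origin, !RtoC_mult by easy. ring.
Qed.

Lemma K_ker (x y : C) : K St z x y = kern x y.
Proof.
  unfold K, ker, quad, midquad. rewrite sumS_lsum. toC. change Defs.Cpow with Cpow.
  rewrite kernel_rows, !row_count by easy. rewrite count_origin, !RtoC_mult by easy. ring.
Qed.

Lemma d_disc (x : C) : d_ St z x = disc (w (-1)%Z 1%Z) (w 0%Z 1%Z) (w 1%Z 1%Z) (w (-1)%Z 0%Z) (w 1%Z 0%Z)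
  (w (-1)%Z (-1)%Z) (w 0%Z (-1)%Z) (w 1%Z (-1)%Z) x.
Proof. unfold d_. rewrite a_quad, b_midquad, c_quad. reflexivity. Qed.

Lemma dt_tdisc (y : C) : dt_ St z y = tdisc (w (-1)%Z 1%Z) (w 0%Z 1%Z) (w 1%Z 1%Z) (w (-1)%Z 0%Z) (w 1%Z 0%Z)
  (w (-1)%Z (-1)%Z) (w 0%Z (-1)%Z) (w 1%Z (-1)%Z) y.
Proof. unfold dt_. rewrite at_quad, bt_midquad, ct_quad. reflexivity. Qed.
End Coefficients.

Lemma wgen_series (St : list step) (z : R) (f : step -> C) (t : nat -> C) :
  (forall s, In s St -> small_step s) -> (0 < z)%R -> (z * INR (length St) < 1)%R ->
  (forall e, (Cmod (f e) <= 1)%R) -> (forall n, t n = wterm St z f n) ->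
  Cseries_cv t (wgen St z f).
Proof.
  intros HS Hz Hk Hf Ht eps He.
  destruct (proj1 (ev_atinf _) (wgen_cv St z HS Hz Hk f 1 Hf eps He)) as [N H].
  exists N. intros n Hn.
  assert (E : forall m, Cpartial t m = Cpartial (wterm St z f) m).
  { induction m as [|m IH]; simpl; [apply Ht|now rewrite IH, Ht]. }
  rewrite E. exact (H n Hn).
Qed.

Open Scope R_scope.

Theorem theorem6 (S : list step) (z x1 x2 y1 y2 : R) :
  nonsingular S ->
  0 < z -> z < 1 / INR (length S) ->
  branch_points (d_ S z) x1 x2 ->
  branch_points (dt_ S z) y1 y2 ->
  (exists F : Cplx -> Cplx,
     holomorphic_on (fun x => GX S z x1 y1 y2 x \/ unit_disc x) F /\
     forall x, unit_disc x ->
       exists L, Cseries_cv (Qx0_term S z x) L /\ F x = Cmul (c_ S z x) L) /\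
  (exists G : Cplx -> Cplx,
     holomorphic_on (fun y => GY S z y1 x1 x2 y \/ unit_disc y) G /\
     forall y, unit_disc y ->
       exists L, Cseries_cv (Q0y_term S z y) L /\ G y = Cmul (ct_ S z y) L).
Proof.
  intros [[_ HS] [(Left & Right & Down & Up & _) _]] Hz Hzk Bx By.
  assert (Hlen : 0 < INR (length S)).
  { destruct Left as [s [Hs _]]. destruct S as [|u l]; [easy|]. apply lt_0_INR. simpl. lia. }
  assert (Hr : z * INR (length S) < 1).
  { apply Rmult_lt_reg_r with (/ INR (length S)); [now apply Rinv_0_lt_compat|].
    rewrite Rmult_assoc, Rinv_r by lra. lra. }
  apply (branch_points_ext _ _ _ _ (d_disc S z HS)) in Bx.
  apply (branch_points_ext _ _ _ _ (dt_tdisc S z HS)) in By.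
  assert (P : forall i j, 0 <= z * count S i j).
  { intros i j. apply Rmult_le_pos; [lra|apply count_nonneg]. }
  assert (Tot : z * count S (-1) 1 + z * count S 0 1 + z * count S 1 1 + z * count S (-1) 0 + z * count S 1 0 +
    z * count S (-1) (-1) + z * count S 0 (-1) + z * count S 1 (-1) < 1).
  { rewrite <- count_total in Hr by exact HS. lra. }
  assert (Pos : forall s, In s S -> 0 < z * count S (fst s) (snd s)).
  { intros s Hs. apply Rmult_lt_0_compat; [easy|now apply count_pos]. }
  (* Steps up and down make the outer coefficients in y positive for x > 0; steps right and left do
     the same for the exchanged problem. *)
  assert (PU : 0 < z * count S (-1) 1 + z * count S 0 1 + z * count S 1 1).
  { destruct Up as [s [Hs E]]. pose proof (Pos s Hs) as Q. pose proof (HS s Hs) as Sm.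
    pose proof (P (-1)%Z 1%Z). pose proof (P 0%Z 1%Z). pose proof (P 1%Z 1%Z).
    step_cases Sm s; simpl in E, Q; try discriminate; lra. }
  assert (PD : 0 < z * count S (-1) (-1) + z * count S 0 (-1) + z * count S 1 (-1)).
  { destruct Down as [s [Hs E]]. pose proof (Pos s Hs) as Q. pose proof (HS s Hs) as Sm.
    pose proof (P (-1)%Z (-1)%Z). pose proof (P 0%Z (-1)%Z). pose proof (P 1%Z (-1)%Z).
    step_cases Sm s; simpl in E, Q; try discriminate; lra. }
  assert (PR : 0 < z * count S 1 (-1) + z * count S 1 0 + z * count S 1 1).
  { destruct Right as [s [Hs E]]. pose proof (Pos s Hs) as Q. pose proof (HS s Hs) as Sm.
    pose proof (P 1%Z (-1)%Z). pose proof (P 1%Z 0%Z). pose proof (P 1%Z 1%Z).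
    step_cases Sm s; simpl in E, Q; try discriminate; lra. }
  assert (PL : 0 < z * count S (-1) (-1) + z * count S (-1) 0 + z * count S (-1) 1).
  { destruct Left as [s [Hs E]]. pose proof (Pos s Hs) as Q. pose proof (HS s Hs) as Sm.
    pose proof (P (-1)%Z (-1)%Z). pose proof (P (-1)%Z 0%Z). pose proof (P (-1)%Z 1%Z).
    step_cases Sm s; simpl in E, Q; try discriminate; lra. }
  set (F0 := fun x : C => Cmult (c_ S z x) (wgen S z (gx_term fst snd x))).
  set (G0 := fun y : C => Cmult (ct_ S z y) (wgen S z (gx_term snd fst y))).
  assert (DF : forall x, Cmod x < 1 -> cdiff F0 x).
  { intros x Hx. apply cdiff_mult.
    - apply (cdiff_local (quad (z * count S (-1) (-1)) (z * count S 0 (-1)) (z * count S 1 (-1)))); [|apply cdiff_quad].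
      exists 1. split; [lra|]. intros v _. now apply c_quad.
    - apply (wgen_cdiff S z HS Hz Hr fst snd); [|easy]. intros n e [He _]. exact He. }
  assert (DG : forall y, Cmod y < 1 -> cdiff G0 y).
  { intros y Hy. apply cdiff_mult.
    - apply (cdiff_local (quad (z * count S (-1) (-1)) (z * count S (-1) 0) (z * count S (-1) 1))); [|apply cdiff_quad].
      exists 1. split; [lra|]. intros v _. now apply ct_quad.
    - apply (wgen_cdiff S z HS Hz Hr snd fst); [|easy]. intros n e [_ He]. exact He. }
  pose proof (functional_equation S z HS Hz Hr) as FE.
  split.
  - destruct (kernel_continuation _ _ _ _ _ _ _ _ x1 x2 y1 y2 F0 G0
      (Cmult (corner S z) (wgen S z (fun e => if (Z.eqb (fst e) 0 && Z.eqb (snd e) 0)%bool then RtoC 1 else RtoC 0)))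
      (P _ _) (P _ _) (P _ _) (P _ _) (P _ _) (P _ _) (P _ _) (P _ _) Tot PU PD Bx By DF DG) as [F [HF EF]].
    { intros x y Hx Hy Hk. apply FE; [easy|easy|]. now rewrite K_ker. }
    exists F. split.
    + intros x Hx. apply HF. destruct Hx as [Hx|Hx]; [left|now right].
      revert Hx. apply component_mono. intros v Hv t Ht Hk. apply Hv. exists t. split; [easy|].
      rewrite K_ker by exact HS. exact Hk.
    + intros x Hx. exists (wgen S z (gx_term fst snd x)). split; [|now apply EF].
      apply wgen_series; try easy.
      * intros e. apply gx_term_disc. unfold unit_disc in Hx. apply Rlt_le. exact Hx.
      * intros n. now apply Qx0_term_wsum.
  (* The exchange of x and y: the weights are listed by columns instead of rows, and [By], [Bx] fit
     by conversion. *)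
  - assert (Tot' : z * count S 1 (-1) + z * count S 1 0 + z * count S 1 1 + z * count S 0 (-1) + z * count S 0 1 +
      z * count S (-1) (-1) + z * count S (-1) 0 + z * count S (-1) 1 < 1) by lra.
    destruct (kernel_continuation _ _ _ _ _ _ _ _ y1 y2 x1 x2 G0 F0
      (Cmult (corner S z) (wgen S z (fun e => if (Z.eqb (fst e) 0 && Z.eqb (snd e) 0)%bool then RtoC 1 else RtoC 0)))
      (P _ _) (P _ _) (P _ _) (P _ _) (P _ _) (P _ _) (P _ _) (P _ _) Tot' PR PL By Bx DG DF) as [G [HG EG]].
    { intros y x Hy Hx Hk. rewrite (Cplus_comm (G0 y)), (Cmult_comm y). apply FE; [easy|easy|].
      rewrite K_ker by exact HS. rewrite ker_swap. exact Hk. }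
    exists G. split.
    + intros y Hy. apply HG. destruct Hy as [Hy|Hy]; [left|now right].
      revert Hy. apply component_mono. intros v Hv t Ht Hk. apply Hv. exists t. split; [easy|].
      rewrite K_ker by exact HS. rewrite ker_swap. exact Hk.
    + intros y Hy. exists (wgen S z (gx_term snd fst y)). split; [|now apply EG].
      apply wgen_series; try easy.
      * intros e. apply gx_term_disc. unfold unit_disc in Hy. apply Rlt_le. exact Hy.
      * intros n. now apply Q0y_term_wsum.
Qed.
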